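(* Let $X$ be a Banach space. (i) Suppose that $X$ has cotype 2. Then $\mathfrak{A}_X^{\mathcal{QN}_p}=\{0\}$ for all $1\le p<\infty$. (ii) Suppose that the dual space $X^*$ has cotype 2. Then $\mathfrak{A}_X^{\mathcal{SK}_p}=\{0\}$ for all $1\le p<\infty$.
   Context: All Banach spaces are over the same scalar field $\mathbb K=\mathbb R$ or $\mathbb C$. $\mathcal L(X,Y)$ denotes the bounded linear operators $X\to Y$, $\mathcal F(X,Y)$ the bounded finite-rank operators, and $\mathcal F(X)=\mathcal F(X,X)$, etc. $B_X$ is the closed unit ball of $X$, and $p'$ is the conjugate exponent of $p$. Let $1\le p<\infty$. For a Banach space $E$, $\ell^p_s(E)$ is the space of strongly $p$-summable sequences $(x_k)\subset E$, i.e. $\|(x_k)\|_p=(\sum_k\|x_k\|^p)^{1/p}<\infty$. Quasi $p$-nuclear operators: $T\in\mathcal{QN}_p(X,Y)$ if $T\in\mathcal L(X,Y)$ and there is $(x_k^* )\in\ell^p_s(X^* )$ with $\|Tx\|\le(\sum_{k=1}^\infty|x_k^*(x)|^p)^{1/p}$ for all $x\in X$; $\|T\|_{\mathcal{QN}_p}$ is the infimum of $\|(x_k^* )\|_p$ over all such sequences. Sinha-Karn $p$-compact operators: $T\in\mathcal{SK}_p(X,Y)$ if $T\in\mathcal L(X,Y)$ and there is $(y_k)\in\ell^p_s(Y)$ with $T(B_X)\subset\{\sum_{k=1}^\infty\lambda_ky_k\mid(\lambda_k)\in B_{\ell^{p'}}\}$ (with $(\lambda_k)\in B_{c_0}$ if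 $p=1$); $\|T\|_{\mathcal{SK}_p}$ is the infimum of $\|(y_k)\|_p$ over all such sequences. Both are Banach operator ideals (complete normed operator ideals in the sense of Pietsch). For $\mathcal I=\mathcal{QN}_p$ or $\mathcal{SK}_p$, write $\mathcal I(X)=\mathcal I(X,X)$ and $\mathfrak A_X^{\mathcal I}=\mathcal I(X)/\overline{\mathcal F(X)}^{\|\cdot\|_{\mathcal I}}$, a Banach algebra under composition with the quotient norm, where the closure is taken in $(\mathcal I(X),\|\cdot\|_{\mathcal I})$. *)

(* Defs.v *)
From HB Require Import structures.
From mathcomp Require Import all_boot all_order all_algebra.
From mathcomp Require Import all_classical all_reals all_analysis.
From mathcomp Require Import complex.

Set Implicit Arguments.
Unset Strict Implicit.
Unset Printing Implicit Defensive.

Import Order.TTheory GRing.Theory Num.Theory.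
Import numFieldNormedType.Exports.

Local Open Scope classical_set_scope.
Local Open Scope ring_scope.

Variant scalar_kind := RealScalars | ComplexScalars.

Definition scalars (R : realType) (k : scalar_kind) : numFieldType :=
  match k with RealScalars => R | ComplexScalars => R[i] end.

Definition scalar_re (R : realType) (k : scalar_kind) : scalars R k -> R :=
  match k return scalars R k -> R with
  | RealScalars => fun a => a
  | ComplexScalars => fun a => complex.Re a
  end.

Definition of_real (R : realType) (k : scalar_kind) : R -> scalars R k :=
  match k return R -> scalars R k with
  | RealScalars => fun a => a
  | ComplexScalars => fun a => a%:C%C
  end.
Arguments of_real {R} k _.

(* The library norm of a normed module over [scalars R k] takes its values in
   [scalars R k]; [rnorm] is the same norm with values in [R]. *)
Definition rnorm (R : realType) (k : scalar_kind)
    (V : normedModType (scalars R k)) (x : V) : R := scalar_re `|x|.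

Section scalar_theory.
Context {R : realType} {k : scalar_kind}.
Implicit Types (a b : scalars R k) (x y : R).

Lemma scalar_reK a : 0 <= a -> of_real k (scalar_re a) = a.
Proof. by case: k a => //= -[r s]; rewrite lecE/= => /andP[/eqP -> _]. Qed.

Lemma of_realK x : scalar_re (of_real k x) = x.
Proof. by case: k. Qed.

Lemma of_real_le x y : (of_real k x <= of_real k y) = (x <= y).
Proof. by case: k => //=; rewrite lecR. Qed.

Lemma of_realD x y : of_real k (x + y) = of_real k x + of_real k y.
Proof. by case: k => //=; rewrite rmorphD. Qed.

Lemma of_realM x y : of_real k (x * y) = of_real k x * of_real k y.
Proof. by case: k => //=; rewrite rmorphM. Qed.

Lemma of_real0 : of_real k (0 : R) = 0.
Proof. by case: k. Qed.

Lemma of_real1 : of_real k (1 : R) = 1.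
Proof. by case: k. Qed.

Lemma ler_scalar_re a b : a <= b -> scalar_re a <= scalar_re b.
Proof.
by case: k a b => //= -[a a'] [b b']; rewrite lecE/= => /andP[].
Qed.

Context {V : normedModType (scalars R k)}.
Implicit Types v w : V.

Lemma of_real_rnorm v : of_real k (rnorm v) = `|v|.
Proof. exact: scalar_reK. Qed.

Lemma rnorm_ge0 v : 0 <= rnorm v.
Proof. by rewrite -of_real_le of_real_rnorm of_real0. Qed.

Lemma rnormD v w : rnorm (v + w) <= rnorm v + rnorm w.
Proof. by rewrite -of_real_le of_realD !of_real_rnorm ler_normD. Qed.

Lemma rnormZ a v : rnorm (a *: v) = scalar_re `|a| * rnorm v.
Proof.
rewrite -[LHS](of_realK) -[RHS](of_realK); congr scalar_re.
by rewrite of_realM !of_real_rnorm scalar_reK// normrZ.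
Qed.

Lemma rnorm0_eq0 v : rnorm v = 0 -> v = 0.
Proof.
by move=> v0; apply/normr0_eq0; rewrite -of_real_rnorm v0 of_real0.
Qed.

Lemma rnorm0 : rnorm (0 : V) = 0.
Proof. by rewrite /rnorm normr0 -of_real0 of_realK. Qed.

End scalar_theory.

Section bounded_operators.
Context {R : realType} {k : scalar_kind}.
Local Notation K := (scalars R k).
Context (X Y : normedModType K).

Definition bounded_linear : {pred X -> Y} :=
  fun f => `[< linear f /\ continuous f >].

(* For linear maps between normed spaces, bounded and continuous agree
   ([linear_bounded_continuous]). *)
Record bounded_operator := BoundedOperator {
  operator_fun :> X -> Y;
  _ : operator_fun \in bounded_linear }.

HB.instance Definition _ := [isSub for operator_fun].
HB.instance Definition _ := [Choice of bounded_operator by <:].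

Lemma bounded_linear_submod : submod_closed bounded_linear.
Proof.
split=> [|a f g /asboolP[lf cf] /asboolP[lg cg]]; apply/asboolP.
  by split; [move=> b x y; rewrite /= scaler0 addr0 | exact: cst_continuous].
split=> [b x y|x].
  by rewrite /= !fctE lf lg !scalerDr addrACA !scalerA mulrC.
by apply: cvgD; [apply: cvgZl_tmp; exact: cf | exact: cg].
Qed.

HB.instance Definition _ :=
  GRing.isSubmodClosed.Build K (X -> Y) bounded_linear bounded_linear_submod.
HB.instance Definition _ :=
  [SubChoice_isSubLmodule of bounded_operator by <:].

Lemma operator_linear (T : bounded_operator) : linear T.
Proof. by case: T => f /= /asboolP[]. Qed.

Lemma operator_continuous (T : bounded_operator) : continuous T.
Proof. by case: T => f /= /asboolP[]. Qed.

HB.instance Definition _ (T : bounded_operator) :=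
  GRing.isLinear.Build K X Y *:%R T (operator_linear T).

Definition operator_norm (T : bounded_operator) : R :=
  sup [set rnorm (T x) | x in [set x | rnorm x <= 1]].

Lemma operator_norm_has_sup (T : bounded_operator) :
  has_sup [set rnorm (T x) | x in [set x | rnorm x <= 1]].
Proof.
split; first by exists (rnorm (T 0)), 0 => //=; rewrite rnorm0 ler01.
have /linear_bounded_continuous/linear_boundedP := @operator_continuous T.
move=> /pinfty_ex_gt0[r r0 Tr]; exists (scalar_re r) => _ [x /= x1 <-].
apply: ler_scalar_re; apply: (le_trans (Tr x)).
by apply: ler_piMr; [exact: ltW | rewrite -of_real_rnorm -of_real1 of_real_le].
Qed.

Lemma rnorm_le_operator_norm (T : bounded_operator) x :
  rnorm x <= 1 -> rnorm (T x) <= operator_norm T.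
Proof.
by move=> x1; apply: sup_upper_bound; [exact: operator_norm_has_sup|exists x].
Qed.

Lemma operator_norm_le (T : bounded_operator) (M : R) :
  (forall x, rnorm x <= 1 -> rnorm (T x) <= M) -> operator_norm T <= M.
Proof.
move=> TM; apply: ge_sup; first by case: (operator_norm_has_sup T).
by move=> _ [x x1 <-]; exact: TM.
Qed.

Lemma ler_operator_normD (S T : bounded_operator) :
  of_real k (operator_norm (S + T)) <=
  of_real k (operator_norm S) + of_real k (operator_norm T).
Proof.
rewrite -of_realD of_real_le; apply: operator_norm_le => x x1.
apply: (le_trans (rnormD (S x) (T x))).
by rewrite lerD// rnorm_le_operator_norm.
Qed.

Lemma operator_normZ_le (a : K) (T : bounded_operator) :
  operator_norm (a *: T) <= scalar_re `|a| * operator_norm T.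
Proof.
apply: operator_norm_le => x x1.
rewrite [X in X <= _](rnormZ a (T x)) ler_wpM2l ?rnorm_le_operator_norm//.
by rewrite -(of_real_le (k := k)) of_real0 scalar_reK.
Qed.

Lemma operator_normZ (a : K) (T : bounded_operator) :
  of_real k (operator_norm (a *: T)) = `|a| * of_real k (operator_norm T).
Proof.
apply/le_anti/andP; split.
  by rewrite -[`|a|]scalar_reK// -of_realM of_real_le operator_normZ_le.
have [->|a0] := eqVneq a 0.
  rewrite normr0 mul0r -of_real0 of_real_le.
  apply: le_trans (rnorm_le_operator_norm _ (x := 0) _); first exact: rnorm_ge0.
  by rewrite rnorm0.
rewrite mulrC -ler_pdivlMr ?normr_gt0// -normfV mulrC.
rewrite -[`|a^-1|]scalar_reK// -of_realM of_real_le.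
by rewrite -{1}(scale1r T) -(mulVf a0) -scalerA operator_normZ_le.
Qed.

Lemma operator_norm_eq0 (T : bounded_operator) :
  of_real k (operator_norm T) = 0 -> T = 0.
Proof.
rewrite -of_real0 => /(congr1 (@scalar_re _ _)); rewrite !of_realK => T0.
apply/val_inj/funext => x /=.
have [->|x0] := eqVneq x 0; first by rewrite (linear0 T).
have nx0 : `|x| != 0 by rewrite normr_eq0.
suff /eqP : T (`|x|^-1 *: x) = 0.
  by rewrite linearZ scaler_eq0 invr_eq0 (negbTE nx0) => /eqP.
apply: rnorm0_eq0; apply/le_anti; rewrite rnorm_ge0 andbT -T0.
apply: rnorm_le_operator_norm.
rewrite -(of_real_le (k := k)) of_real_rnorm of_real1.
by rewrite normrZ normfV normr_id mulVf.
Qed.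

HB.instance Definition _ := Lmodule_isNormed.Build K bounded_operator
  ler_operator_normD operator_normZ operator_norm_eq0.

Definition finite_rank : set bounded_operator :=
  [set T | exists n (y : 'I_n -> Y),
    forall x, exists c : 'I_n -> K, T x = \sum_(i < n) c i *: y i].

End bounded_operators.

Arguments bounded_operator {R k} X Y.
Arguments finite_rank {R k} X Y.

Definition dual (R : realType) (k : scalar_kind)
    (X : normedModType (scalars R k)) : normedModType (scalars R k) :=
  bounded_operator X (scalars R k)^o.

(* The average over all choices of signs is the second moment of the Rademacher
   sum of the x_i. *)
Definition cotype2 (R : realType) (k : scalar_kind)
    (E : normedModType (scalars R k)) : Prop :=
  exists C : R, forall (n : nat) (x : 'I_n -> E),
    Num.sqrt (\sum_(i < n) rnorm (x i) ^+ 2) <=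
    C * Num.sqrt ((2 ^+ n)^-1 * \sum_(e : {ffun 'I_n -> bool})
                    rnorm (\sum_(i < n) (-1) ^+ e i *: x i) ^+ 2).

Section p_summing_sequences.
Context {R : realType} {k : scalar_kind}.
Local Notation K := (scalars R k).
Context {E : normedModType K}.
Local Open Scope ereal_scope.

(* +oo exactly when the sequence is not strongly p-summable *)
Definition strong_norm (p : R) (x : E^nat) : \bar R :=
  (\sum_(0 <= i <oo) (rnorm (x i) `^ p)%:E) `^ p^-1.

Definition strongly_summable (p : R) : set (E^nat) :=
  [set x | strong_norm p x < +oo].

End p_summing_sequences.

Section operator_ideals.
Context {R : realType} {k : scalar_kind}.
Local Notation K := (scalars R k).
Context (p : R) (X Y : normedModType K).
Implicit Type T : bounded_operator X Y.

Definition QN_majorant T (xs : (dual X)^nat) : Prop :=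
  strongly_summable p xs /\
  forall x : X, ((rnorm (T x))%:E <=
    strong_norm p (fun i => xs i x : K^o))%E.

Definition QN : set (bounded_operator X Y) :=
  [set T | exists xs, QN_majorant T xs].

Definition QN_norm T : \bar R :=
  ereal_inf [set strong_norm p xs | xs in QN_majorant T].

(* The unit ball of l^p' where 1/p + 1/p' = 1, replaced by that of c_0 for
   p = 1. *)
Definition conjugate_ball : set ((K^o)^nat) :=
  if p == 1 then
    [set a | a @ \oo --> (0 : K^o) /\ forall i, rnorm (a i) <= 1]
  else [set a | (strong_norm (1 - p^-1)^-1 a <= 1)%E].

Definition p_convex_hull (y : Y^nat) : set Y :=
  [set z | exists2 a, conjugate_ball a &
    series (fun i => a i *: y i) @ \oo --> z].

Definition SK_majorant T (y : Y^nat) : Prop :=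
  strongly_summable p y /\
  [set T x | x in [set x | rnorm x <= 1]] `<=` p_convex_hull y.

Definition SK : set (bounded_operator X Y) :=
  [set T | exists y, SK_majorant T y].

Definition SK_norm T : \bar R :=
  ereal_inf [set strong_norm p y | y in SK_majorant T].

End operator_ideals.

Arguments QN {R k} p X Y.
Arguments QN_norm {R k} p {X Y} T.
Arguments SK {R k} p X Y.
Arguments SK_norm {R k} p {X Y} T.

(* The closure is taken in I for its ideal norm N, not for the operator norm. *)
Definition finite_rank_closure (R : realType) (k : scalar_kind)
    (X : normedModType (scalars R k)) (I : set (bounded_operator X X))
    (N : bounded_operator X X -> \bar R) : set (bounded_operator X X) :=
  [set T | I T /\ forall e : R, 0 < e ->
    exists2 F, finite_rank X X F & (N (T - F)%R < e%:E)%E].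

Definition coset (V : zmodType) (J : set V) (v : V) : set V :=
  [set v + w | w in J].

Definition quotient (V : zmodType) (I J : set V) : set (set V) :=
  [set coset J v | v in I].

Definition ideal_quotient (R : realType) (k : scalar_kind)
    (X : normedModType (scalars R k)) (I : set (bounded_operator X X))
    (N : bounded_operator X X -> \bar R) : set (set (bounded_operator X X)) :=
  quotient I (finite_rank_closure I N).

(* Main.v *)
Require Import Defs.
From HB Require Import structures.
From mathcomp Require Import all_boot all_order all_algebra.
From mathcomp Require Import all_classical all_reals all_analysis.
From mathcomp Require Import complex.
From mathcomp Require Import ring lra.

Set Implicit Arguments.
Unset Strict Implicit.
Unset Printing Implicit Defensive.

Import Order.TTheory GRing.Theory Num.Theory.
Import numFieldNormedType.Exports.

Local Open Scope classical_set_scope.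
Local Open Scope ring_scope.

(* Write phi(x) = |Tx|. In (i) the pairing is that of X* with X and one shows
   that every T in QN_p satisfies phi(x) <= sum |<z_i, x>| with sum |z_i| < oo,
   and this up to a finite-rank operator and an error as small as one wishes.
   - Cotype 2 of the target and the Hahn-Banach theorem on bounded sequences
     (Maurey's factorization) replace QN_p by QN_2; a Jensen reweighting raises
     p to a power of 2 beforehand, and 1 to p at the end.
   - A QN_2 operator is dominated by a Hilbertian seminorm whose coordinates are
     removed one by one by finite-rank operators, so it is approximable.
   - The dual form of cotype 2 writes a square-summable sequence of X* as the
     Rademacher coefficients of a function G bounded in L_2; since Rademacher
     projections satisfy |c|_2^2 <= 3 |g|_1 |g|_2 for scalar g (Khintchine),
     phi_2 is bounded by an l_1 part plus a quarter of another phi_2, and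
     Maurey's extrapolation gives QN_2 inside QN_1.
   For (ii) the same argument is run for the adjoint of T, with X as a predual
   of X*; the Hahn-Banach theorem turns |T*f| <= sum |f(z_i)| back into
   T(B_X) inside {sum lam_i z_i : |lam_i| <= 1}. *)

(** * Sandwich theorem of Mazur and Orlicz *)

(** Both halves run through one argument about a pairing [B : V -> E -> K]: [V] is the dual and [E]
    is [X] for QN, the other way round for SK. Finite-rank corrections take their coefficients in
    [V], so that in the second case they are adjoints of finite-rank operators on [X]; an
    approximation of the adjoint of [T] by arbitrary finite-rank operators would not give this. The
    obstacle is that errors must be small in the norm of the ideal, while coordinates can be removed
    cheaply only in a Hilbertian seminorm, that is for exponent 2. It is overcome because the
    extrapolation from 2 to 1 is homogeneous, with a factor that depends on the lifting constant
    alone: it applies to the error [T - F], so an error small for exponent 2 is small for exponent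
    1, and then for every [p] by reweighting. Powers of 2 serve as exponents since moments of sign
    sums can then be estimated by repeated squaring. Exponent 1 is also the place where majorants
    are concatenated without loss. *)

Lemma of_realN (R : realType) (k : scalar_kind) (x : R) :
  of_real k (- x) = - of_real k x.
Proof. by apply/eqP; rewrite -addr_eq0 -of_realD addNr of_real0. Qed.

Section hahn_banach.
Context {R : realType} {k : scalar_kind} {V : lmodType (scalars R k)}.
Local Notation "t *r x" := (of_real k t *: x) (at level 40).
Implicit Types (p q : V -> R) (S : set (V * R)).

(** [V] is treated as a real space through [of_real]. One inequality suffices for homogeneity: used
    for [t] and for [t^-1] it gives equality when [t > 0]. *)
Definition sublinear p :=
  (forall x y, p (x + y) <= p x + p y) /\
  (forall t x, 0 <= t -> p (t *r x) <= t * p x).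

(** The cone is a relation, not the graph of a function: one vector may carry several values. This
    admits cones spanned by squares, as in [cotype2_dominated2], where the second component is not
    linear in the data. *)
Definition dominated_cone p S :=
  [/\ S !=set0,
      forall u v, S u -> S v -> S (u.1 + v.1, u.2 + v.2),
      forall t u, 0 <= t -> S u -> S (t *r u.1, t * u.2) &
      forall u, S u -> u.2 <= p u.1].

Lemma sublinear0 p : sublinear p -> p 0 = 0.
Proof.
move=> [pD pZ]; apply/le_anti; apply/andP; split.
  by have := pZ 0 0 (lexx 0); rewrite mul0r scaler0.
by have := pD 0 0; rewrite addr0; lra.
Qed.

Lemma sublinear_opp p x : sublinear p -> - p (- x) <= p x.
Proof.
by move=> sp; rewrite -subr_ge0 opprK -(sublinear0 sp) -(subrr x) sp.1.
Qed.

(** The auxiliary functional of the sandwich theorem: it lies below [p] and its value at [- u.1] is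
    at most [- u.2], so a linear functional below it is below [p] and above the cone. *)
Definition inf_cone p S (x : V) : R :=
  inf [set p (x + u.1) - u.2 | u in S].

Section inf_cone.
Variables (p : V -> R) (S : set (V * R)).
Hypotheses (sp : sublinear p) (pS : dominated_cone p S).

Lemma inf_cone_has_inf x : has_inf [set p (x + u.1) - u.2 | u in S].
Proof.
have [[u Su] _ _ Sp] := pS; split.
  by exists (p (x + u.1) - u.2), u.
exists (- p (- x)) => _ [v Sv <-].
have := Sp _ Sv; have := sp.1 (x + v.1) (- x).
rewrite addrAC subrr add0r; lra.
Qed.

Lemma inf_cone_le x u : S u -> inf_cone p S x <= p (x + u.1) - u.2.
Proof.
by move=> Su; apply: inf_lbound; [case: (inf_cone_has_inf x)|exists u].
Qed.

Lemma le_inf_cone x (c : R) :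
  (forall u, S u -> c <= p (x + u.1) - u.2) -> c <= inf_cone p S x.
Proof.
move=> cp; apply: lb_le_inf; first by case: (inf_cone_has_inf x).
by move=> _ [u Su <-]; exact: cp.
Qed.

Lemma cone0 : S (0, 0).
Proof.
have [[u Su] _ SZ _] := pS.
by have := SZ 0 u (lexx 0) Su; rewrite of_real0 scale0r mul0r.
Qed.

Lemma inf_cone_le_fun x : inf_cone p S x <= p x.
Proof. by have := inf_cone_le x cone0; rewrite /= addr0 subr0. Qed.

Lemma inf_cone_oppr u : S u -> inf_cone p S (- u.1) <= - u.2.
Proof. by move=> /(inf_cone_le (- u.1)); rewrite addNr sublinear0// add0r. Qed.

Lemma sublinear_inf_cone : sublinear (inf_cone p S).
Proof.
have [_ SD SZ Sp] := pS; split=> [x y|t x t0].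
  rewrite -lerBlDr; apply: le_inf_cone => u Su.
  rewrite lerBlDr -lerBlDl; apply: le_inf_cone => v Sv; rewrite lerBlDl.
  apply: le_trans (inf_cone_le (x + y) (SD _ _ Su Sv)) _ => /=.
  by have := sp.1 (x + u.1) (y + v.1); rewrite addrACA; lra.
have [->|tn0] := eqVneq t 0.
  rewrite of_real0 scale0r mul0r.
  by have := inf_cone_le 0 cone0; rewrite /= addr0 subr0 (sublinear0 sp).
have {tn0} t0' : 0 < t by rewrite lt_neqAle eq_sym tn0.
rewrite mulrC -ler_pdivrMr//; apply: le_inf_cone => u Su.
rewrite ler_pdivrMr// mulrC.
apply: le_trans (inf_cone_le _ (SZ _ _ t0 Su)) _ => /=.
by rewrite -scalerDr mulrBr lerD2r sp.2.
Qed.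

End inf_cone.

Definition real_linear (f : V -> R) :=
  (forall x y, f (x + y) = f x + f y) /\ (forall t x, f (t *r x) = t * f x).

(* A minimal sublinear functional [q] is linear: [inf_cone] applied to the ray
   [(t y, t q(y))] gives a smaller one, whose value at [-y] is at most [- q y]. *)
Lemma minimal_sublinear_linear q : sublinear q ->
  (forall q', sublinear q' -> (forall x, q' x <= q x) -> q' = q) ->
  real_linear q.
Proof.
move=> sq qmin.
have qN y : q (- y) = - q y.
  apply/le_anti.
  have := sublinear_opp (- y) sq; rewrite opprK => ->; rewrite andbT.
  pose S : set (V * R) := [set u | exists2 t, 0 <= t & u = (t *r y, t * q y)].
  have S1 : S (y, q y) by exists 1; rewrite ?ler01// of_real1 scale1r mul1r.
  have qS : dominated_cone q S.
    split.
    - by exists (y, q y).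
    - move=> _ _ [t t0 ->] [s s0 ->]; exists (t + s); first exact: addr_ge0.
      by rewrite of_realD scalerDl mulrDl.
    - move=> t _ t0 [s s0 ->]; exists (t * s); first exact: mulr_ge0.
      by rewrite of_realM scalerA mulrA.
    - move=> _ [t t0 ->] /=.
      have [->|tn0] := eqVneq t 0.
        by rewrite mul0r of_real0 scale0r sublinear0.
      rewrite mulrC -ler_pdivlMr ?lt_neqAle 1?eq_sym ?tn0// mulrC.
      have := sq.2 t^-1 (t *r y); rewrite invr_ge0 => /(_ t0).
      by rewrite scalerA -of_realM mulVf// of_real1 scale1r.
  have := qmin _ (sublinear_inf_cone sq qS) (inf_cone_le_fun sq qS).
  by have := inf_cone_oppr sq qS S1; rewrite /= => /[swap] ->.
have qZ t x : 0 <= t -> q (t *r x) = t * q x.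
  move=> t0; apply/le_anti; rewrite sq.2//= -[leRHS]opprK -qN -scalerN.
  by rewrite lerNr (le_trans (sq.2 _ _ t0))// qN mulrN.
split=> [x y|t x].
  apply/le_anti; rewrite sq.1 -[leRHS]opprK -qN lerNr opprD.
  by rewrite (le_trans (sq.1 _ _))// !qN opprD.
have [t0|t0] := leP 0 t; first exact: qZ.
have -> : t *r x = - ((- t) *r x) by rewrite of_realN scaleNr opprK.
by rewrite qN qZ ?mulNr ?opprK//; lra.
Qed.

(** Zorn's lemma for the reversed pointwise order. The bound of a chain is its pointwise infimum,
    finite because every member is at least [- p (- x)] at [x]. *)
Lemma exists_minimal_sublinear p : sublinear p ->
  exists q, [/\ sublinear q, forall x, q x <= p x &
    forall q', sublinear q' -> (forall x, q' x <= q x) -> q' = q].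
Proof.
move=> sp; pose P : set (V -> R) :=
  [set q | sublinear q /\ forall x, q x <= p x].
pose le (a b : {q | P q}) := `[< forall x, sval b x <= sval a x >].
have p0 : P p by split.
have [|||A Atot|[q [sq qp]] qmax] := @Zorn {q | P q} le.
- by move=> t; apply/asboolP.
- by move=> r s t /asboolP rs /asboolP st; apply/asboolP => x;
    exact: le_trans (rs x).
- move=> [s Ps] [t Pt] /asboolP/= st /asboolP/= ts; apply: eq_exist => /=.
  by apply/funext => x; apply/le_anti; rewrite st ts.
- have [->|/set0P[a0 Aa0]] := eqVneq A set0; first by exists (exist _ p p0).
  pose r x := inf [set sval a x | a in A].
  have hinf x : has_inf [set sval a x | a in A].
    split; first by exists (sval a0 x), a0.
    exists (- p (- x)) => _ [[a [sa ap]] Aa <-] /=.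
    apply: le_trans (sublinear_opp x sa); rewrite lerN2; exact: ap.
  have r_le x a : A a -> r x <= sval a x.
    by move=> Aa; apply: inf_lbound; [case: (hinf x)|exists a].
  have le_r x c : (forall a, A a -> c <= sval a x) -> c <= r x.
    move=> ca; apply: lb_le_inf; first by case: (hinf x).
    by move=> _ [a Aa <-]; exact: ca.
  have Pr : P r.
    split; last by move=> x; apply: le_trans (r_le x _ Aa0) _;
      case: (a0) => ? [].
    split=> [x y|t x t0].
      rewrite -lerBlDr; apply: (le_r) => a Aa.
      rewrite lerBlDr -lerBlDl; apply: (le_r) => b Ab; rewrite lerBlDl.
      (* An infimum of sublinear functionals need not be subadditive; on a chain, the smaller of [a]
         and [b] can serve for both arguments. *)
      have [/asboolP ab|/asboolP ba] := Atot _ _ Aa Ab.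
      + apply: le_trans (r_le _ _ Ab) _.
        case: b {Ab} ab => b [sb bp]/= ab.
        by have := sb.1 x y; have := ab x; lra.
      + apply: le_trans (r_le _ _ Aa) _.
        case: a {Aa} ba => a [sa ap]/= ba.
        by have := sa.1 x y; have := ba y; lra.
    have [->|tn0] := eqVneq t 0.
      rewrite of_real0 scale0r mul0r (le_trans (r_le _ _ Aa0))//.
      by case: (a0) => a [sa ?] /=; rewrite (sublinear0 sa).
    have {tn0} t0' : 0 < t by rewrite lt_neqAle eq_sym tn0.
    rewrite mulrC -ler_pdivrMr//; apply: (le_r) => a Aa.
    rewrite ler_pdivrMr// mulrC (le_trans (r_le _ _ Aa))//.
    by case: (a) => ? [[_ +] ?] /=; apply.
  exists (exist _ r Pr) => a Aa; apply/asboolP => x /=; exact: r_le.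
exists q; split=> // q' sq' q'q.
have Pq' : P q' by split=> // x; exact: le_trans (q'q x) (qp x).
have := qmax (exist _ q' Pq'); rewrite /le asboolE/= => /(_ q'q).
by move=> /(congr1 sval).
Qed.

Lemma mazur_orlicz p S : sublinear p -> dominated_cone p S ->
  exists f, [/\ real_linear f, forall x, f x <= p x &
    forall u, S u -> u.2 <= f u.1].
Proof.
move=> sp pS.
have [q [sq qp qmin]] := exists_minimal_sublinear (sublinear_inf_cone sp pS).
have lq := minimal_sublinear_linear sq qmin.
exists q; split => // [x|u Su].
  by rewrite (le_trans (qp x))// inf_cone_le_fun.
have := le_trans (qp (- u.1)) (inf_cone_oppr sp pS Su).
have -> : q (- u.1) = - q u.1.
  by apply/eqP; rewrite -addr_eq0 -lq.1 addNr sublinear0.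
by rewrite lerN2.
Qed.

End hahn_banach.

(** * Scalars, operators and functionals, uniformly over the real and complex fields *)

Section scalar_lemmas.
Context {R : realType} {k : scalar_kind}.
Local Notation K := (scalars R k).
Implicit Types a b : K.

Definition modulus a : R := rnorm (a : K^o).

Lemma scalar_reD a b : scalar_re (a + b) = scalar_re a + scalar_re b.
Proof. by case: k a b => //= -[? ?] [? ?]. Qed.

Lemma scalar_reB a b : scalar_re (a - b) = scalar_re a - scalar_re b.
Proof. by case: k a b => //= -[? ?] [? ?]. Qed.

Lemma scalar_reM (t : R) a : scalar_re (of_real k t * a) = t * scalar_re a.
Proof. by case: k a => //= -[? ?] /=; rewrite mul0r subr0. Qed.

Lemma scalar_re_le_modulus a : scalar_re a <= modulus a.
Proof.
rewrite /modulus /rnorm; case: k a => /= [a|[a b]]; first exact: ler_norm.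
apply: (le_trans (ler_norm _)).
by rewrite -sqrtr_sqr ler_wsqrtr// lerDl sqr_ge0.
Qed.

Lemma modulus_ge0 a : 0 <= modulus a.
Proof. exact: rnorm_ge0. Qed.

Lemma modulusM a b : modulus (a * b) = modulus a * modulus b.
Proof. exact: (rnormZ (V := K^o)). Qed.

Lemma modulusD a b : modulus (a + b) <= modulus a + modulus b.
Proof. exact: (rnormD (V := K^o)). Qed.

Lemma modulus_of_real t : modulus (of_real k t) = `|t|.
Proof.
by rewrite /modulus /rnorm; case: k => //=;
  rewrite /Normc.normc/= expr0n addr0 sqrtr_sqr.
Qed.

Lemma modulus0 : modulus (0 : K) = 0.
Proof. exact: (rnorm0 (V := K^o)). Qed.

Lemma modulus1 : modulus (1 : K) = 1.
Proof. by rewrite -of_real1 modulus_of_real normr1. Qed.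

Lemma modulusN a : modulus (- a) = modulus a.
Proof. by rewrite /modulus /rnorm normrN. Qed.

Lemma normE a : `|a| = of_real k (modulus a).
Proof. by rewrite /modulus of_real_rnorm. Qed.

Lemma modulus_phase a : exists2 u : K, modulus u <= 1 &
  u * a = of_real k (modulus a).
Proof.
have [->|a0] := eqVneq a 0.
  by exists 0; rewrite ?modulus0 ?ler01// mul0r of_real0.
exists (`|a| / a); last by rewrite mulfVK// normE.
have -> : modulus (`|a| / a) = modulus (1 : K); last by rewrite modulus1.
by rewrite /modulus /rnorm normrM normfV normr_id mulfV ?normr_eq0// normr1.
Qed.

Lemma modulus_parallelogram a b :
  modulus (a + b) ^+ 2 + modulus (a - b) ^+ 2 =
  2 * (modulus a ^+ 2 + modulus b ^+ 2).
Proof.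
rewrite /modulus /rnorm; case: k a b => /= [a b|[a a'] [b b']].
  rewrite !real_normK ?num_real//; ring.
by rewrite /Normc.normc/= !sqr_sqrtr ?addr_ge0 ?sqr_ge0//; ring.
Qed.

Lemma rnormZ_modulus (V : normedModType K) a (v : V) :
  rnorm (a *: v) = modulus a * rnorm v.
Proof. exact: rnormZ. Qed.

Lemma rnormN (V : normedModType K) (v : V) : rnorm (- v) = rnorm v.
Proof. by rewrite /rnorm normrN. Qed.

Lemma rnormB (V : normedModType K) (v w : V) :
  rnorm (v - w) <= rnorm v + rnorm w.
Proof. by rewrite -(rnormN w); exact: rnormD. Qed.

Lemma rnorm_sum (V : normedModType K) (I : Type) (r : seq I) (P : pred I)
  (F : I -> V) :
  rnorm (\sum_(i <- r | P i) F i) <= \sum_(i <- r | P i) rnorm (F i).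
Proof.
elim/big_ind2 : _ => //; first by rewrite rnorm0.
by move=> v x w y vx wy; apply: le_trans (rnormD _ _) _; exact: lerD.
Qed.

End scalar_lemmas.

Section operators.
Context {R : realType} {k : scalar_kind}.
Local Notation K := (scalars R k).
Context {X Y : normedModType K}.

Lemma rnormE (T : bounded_operator X Y) : rnorm T = operator_norm T.
Proof. by rewrite /rnorm of_realK. Qed.

Lemma operator_le (T : bounded_operator X Y) x :
  rnorm (T x) <= operator_norm T * rnorm x.
Proof.
have [->|x0] := eqVneq x 0; first by rewrite linear0 !rnorm0 mulr0.
have nx0 : 0 < rnorm x.
  by rewrite lt_neqAle rnorm_ge0 andbT eq_sym; apply: contra_neq x0;
    exact: rnorm0_eq0.
rewrite -ler_pdivrMr// mulrC.
have := @rnorm_le_operator_norm _ _ _ _ T (of_real k (rnorm x)^-1 *: x).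
rewrite linearZ !rnormZ_modulus modulus_of_real gtr0_norm ?invr_gt0//.
by rewrite mulVf ?gt_eqF// => ->.
Qed.

Lemma operator_of_bounded (f : X -> Y) (c : R) : linear f ->
  (forall x, rnorm (f x) <= c * rnorm x) ->
  exists2 T : bounded_operator X Y, T =1 f & (0 <= c -> operator_norm T <= c).
Proof.
move=> lf fc.
pose F : {linear X -> Y} := HB.pack f (GRing.isLinear.Build _ _ _ _ f lf).
have cf : continuous F.
  apply/linear_bounded_continuous/linear_boundedP.
  exists (of_real k c); split; first by case: (k) => /=;
    rewrite ?num_real ?complex_real.
  move=> r cr x; apply: (@le_trans _ _ (of_real k c * `|x|)).
    by rewrite -!of_real_rnorm -of_realM of_real_le fc.
  by rewrite ler_wpM2r// ltW.
have bf : f \in @bounded_linear R k X Y by apply/asboolP.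
exists (BoundedOperator bf) => // c0; apply: operator_norm_le => x x1 /=.
by apply: le_trans (fc x) _; rewrite ler_piMr.
Qed.

End operators.

Section dual_lemmas.
Context {R : realType} {k : scalar_kind}.
Local Notation K := (scalars R k).
Context {X : normedModType K}.
Implicit Types f : dual X.

Lemma dual_le f x : modulus (f x) <= rnorm f * rnorm x.
Proof. by rewrite rnormE; exact: operator_le. Qed.

(** Multiplying [x] by a scalar [u] of modulus at most 1 with [u * f x = |f x|] reduces the modulus
    to a real part, and [c] does not increase. *)
Lemma functional_modulus_le (f : X -> K^o) (c : X -> R) :
  (forall a x, f (a *: x) = a * f x) ->
  (forall a x, modulus a <= 1 -> c (a *: x) <= c x) ->
  (forall x, scalar_re (f x) <= c x) -> forall x, modulus (f x) <= c x.
Proof.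
move=> fZ cZ fc x; have [u u1 ufx] := modulus_phase (f x).
rewrite -[leLHS](of_realK (k := k)) -ufx -fZ.
exact: le_trans (fc _) (cZ _ _ u1).
Qed.

Lemma rnorm_dual_le f (c : R) : 0 <= c ->
  (forall x, scalar_re (f x) <= c * rnorm x) -> rnorm f <= c.
Proof.
move=> c0 fc; rewrite rnormE; apply: operator_norm_le => x x1.
apply: le_trans (_ : c * rnorm x <= _); last by rewrite ler_piMr.
apply: (@functional_modulus_le f (fun x => c * rnorm x)) => // [a y|a y a1].
  by rewrite linearZ.
by rewrite rnormZ_modulus ler_wpM2l// ler_piMl// rnorm_ge0.
Qed.

Lemma dual_of_real_linear (l : X -> R) (c : R) : 0 <= c -> real_linear l ->
  (forall x, l x <= c * rnorm x) ->
  exists2 f : dual X, rnorm f <= c & forall x, scalar_re (f x) = l x.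
Proof.
move=> c0 [lD lZ] lc.
have [f [lf fl]] : exists f : X -> K^o, linear f /\ forall x, scalar_re (f x) =
  l x.
  case: k X l lD lZ {lc} => /= Y l lD lZ; first by exists l; split=> // a x y;
    rewrite lD lZ.
  (* Over the complex field the functional with real part [l] is [l x - i l (i x)]; linearity is
     checked on the real and imaginary parts of the scalar. *)
  exists (fun x => (l x +i* (- l ('i%C *: x)))%C); split=> // -[a b] x y.
  have abE z : ((a +i* b)%C *: z : Y) = a%:C%C *: z + b%:C%C *: ('i%C *: z).
    rewrite scalerA -scalerDl; congr (_ *: _).
    by apply/eqP; rewrite eq_complex/=; apply/andP; split; apply/eqP; ring.
  have iiE z : 'i%C *: ('i%C *: z) = (-1)%:C%C *: z :> Y.
    rewrite scalerA; congr (_ *: _).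
    by apply/eqP; rewrite eq_complex/=; apply/andP; split; apply/eqP; ring.
  rewrite scalerDr (scalerA 'i%C) (mulrC 'i%C) -scalerA !abE iiE !(lD, lZ).
  by apply/eqP; rewrite eq_complex/=; apply/andP; split; apply/eqP; ring.
have fc x : rnorm (f x) <= c * rnorm x.
  apply: (@functional_modulus_le f (fun x => c * rnorm x)) => [a y|a y a1|y].
  - by have := lf a y 0; rewrite !addr0 -[X in _ + X]/(f 0);
      have := lf (-1) 0 0;
      rewrite scaler0 addr0 scaleN1r addNr => ->; rewrite addr0.
  - by rewrite rnormZ_modulus ler_wpM2l// ler_piMl// rnorm_ge0.
  - by rewrite fl.
have [T Tf Tc] := operator_of_bounded lf fc.
exists T; first by rewrite rnormE Tc.
by move=> x; rewrite Tf.
Qed.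

End dual_lemmas.

Lemma sum_cauchy_schwarz (R : realFieldType) (I : finType) (f g : I -> R) :
  (\sum_i f i * g i) ^+ 2 <= (\sum_i f i ^+ 2) * (\sum_i g i ^+ 2).
Proof.
set A := \sum_i f i ^+ 2; set C := \sum_i g i ^+ 2; set B := \sum_i f i * g i.
have A0 : 0 <= A by apply: sumr_ge0 => i _; exact: sqr_ge0.
have [A00|An0] := eqVneq A 0.
  suff -> : B = 0 by rewrite expr0n mulr_ge0// sumr_ge0// => i _;
    exact: sqr_ge0.
  apply: big1 => i _; have /eqP := A00; rewrite psumr_eq0; last by move=> ? _;
    exact: sqr_ge0.
  by move=> /allP/(_ i (mem_index_enum i)); rewrite sqrf_eq0 => /eqP ->;
    rewrite mul0r.
have : 0 <= \sum_i (A * g i - B * f i) ^+ 2 by apply: sumr_ge0 => i _;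
  exact: sqr_ge0.
have -> : \sum_i (A * g i - B * f i) ^+ 2 = A * (A * C - B ^+ 2).
  transitivity (\sum_i
    (A ^+ 2 * g i ^+ 2 - 2 * A * B * (f i * g i) + B ^+ 2 * f i ^+ 2)).
    by apply: eq_bigr => i _; ring.
  by rewrite big_split sumrB/= -!mulr_sumr -/A -/B -/C; ring.
by rewrite pmulr_rge0 ?subr_ge0// lt_neqAle eq_sym An0.
Qed.

(** * Khintchine's inequality and Rademacher projections *)

Section sign_average.
Context {R : realType}.
Implicit Types n l : nat.

Definition sign_avg n (F : {ffun 'I_n -> bool} -> R) : R :=
  (2 ^+ n)^-1 * \sum_e F e.

Definition cons_sign n (b : bool) (e : {ffun 'I_n -> bool}) :
  {ffun 'I_n.+1 -> bool} := [ffun i => oapp e b (unlift ord0 i)].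

Lemma cons_sign0 n b (e : {ffun 'I_n -> bool}) : cons_sign b e ord0 = b.
Proof. by rewrite ffunE unlift_none. Qed.

Lemma cons_signS n b (e : {ffun 'I_n -> bool}) i :
  cons_sign b e (lift ord0 i) = e i.
Proof. by rewrite ffunE liftK. Qed.

Lemma sign_avg0 (F : {ffun 'I_0 -> bool} -> R) : sign_avg F = F [ffun=> false].
Proof.
rewrite /sign_avg expr0 invr1 mul1r (big_pred1 [ffun=> false])// => e.
by apply/esym/eqP/ffunP => -[].
Qed.

Lemma sign_avgS n (F : {ffun 'I_n.+1 -> bool} -> R) :
  sign_avg F = 2^-1 * (sign_avg (fun e => F (cons_sign false e)) +
                       sign_avg (fun e => F (cons_sign true e))).
Proof.
rewrite /sign_avg exprS invfM -mulrA -mulrDr; congr (_ * (_ * _)).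
rewrite (reindex (fun u : bool * {ffun 'I_n -> bool} => cons_sign u.1 u.2))/=.
  rewrite -(pair_big xpredT xpredT (fun b e => F (cons_sign b e)))/=.
  by rewrite big_bool/= addrC.
exists (fun e : {ffun 'I_n.+1 -> bool} =>
  (e ord0, [ffun i => e (lift ord0 i)] : {ffun 'I_n -> bool})) =>
    /= [[b e]|e] _ /=.
  by rewrite cons_sign0; congr (_, _); apply/ffunP => i;
    rewrite ffunE cons_signS.
apply/ffunP => i; rewrite ffunE; case: unliftP => [j ->|->] //=.
by rewrite ffunE.
Qed.

Lemma sign_avg_const n c : sign_avg (fun _ : {ffun 'I_n -> bool} => c) = c.
Proof.
rewrite /sign_avg big_const iter_addr_0 card_ffun card_bool card_ord.
by rewrite -[c *+ _]mulr_natl natrX mulKf// expf_neq0// pnatr_eq0.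
Qed.

Lemma le_sign_avg n (F G : {ffun 'I_n -> bool} -> R) :
  (forall e, F e <= G e) -> sign_avg F <= sign_avg G.
Proof.
by move=> FG; rewrite ler_wpM2l ?invr_ge0 ?exprn_ge0// ler_sum.
Qed.

Lemma sign_avg_ge0 n (F : {ffun 'I_n -> bool} -> R) :
  (forall e, 0 <= F e) -> 0 <= sign_avg F.
Proof. by move=> F0; rewrite -(sign_avg_const n 0) le_sign_avg. Qed.

Lemma sign_avg_cauchy_schwarz n (F G : {ffun 'I_n -> bool} -> R) :
  sign_avg (fun e => F e * G e) ^+ 2 <=
  sign_avg (fun e => F e ^+ 2) * sign_avg (fun e => G e ^+ 2).
Proof.
rewrite /sign_avg exprMn [leRHS]mulrACA -expr2 ler_wpM2l ?exprn_ge0 ?invr_ge0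
  ?exprn_ge0//.
exact: sum_cauchy_schwarz.
Qed.

(** Jensen's inequality for the powers [2 ^ l], by iterating Cauchy-Schwarz against the constant
    1. *)
Lemma sign_avg_pow n l (F : {ffun 'I_n -> bool} -> R) :
  (forall e, 0 <= F e) ->
  sign_avg F ^+ (2 ^ l) <= sign_avg (fun e => F e ^+ (2 ^ l)).
Proof.
move=> F0; elim: l => [|l IH]; first by rewrite expr1.
have := sign_avg_cauchy_schwarz (fun=> 1) (fun e => F e ^+ (2 ^ l)).
rewrite expr1n sign_avg_const mul1r expnS mulnC.
under eq_fun do rewrite mul1r.
rewrite (_ : (fun e => (F e ^+ _) ^+ 2) = (fun e => F e ^+ (2 ^ l * 2)));
  last first.
  by apply/funext => e; rewrite exprM.
apply: le_trans; rewrite exprM ler_pXn2r// nnegrE ?exprn_ge0 ?sign_avg_ge0// =>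
  e.
by rewrite exprn_ge0.
Qed.

(** The recursion comes from [two_point_moment]: after one squaring [P^2 + Q^2 + 4 c P h] has to be
    at most [(P + c' h)^2], and as [Q^2 <= 4 P h] the value [c' = 2 + 2 c] is enough. Hence
    [khintchine_const l] is [2^(l+1) - 1], the exponent in [khintchine] minus one. *)
Fixpoint khintchine_aux l : R :=
  if l is l'.+1 then 2 + 2 * khintchine_aux l' else 0.
Definition khintchine_const l : R := 1 + khintchine_aux l.

Lemma khintchine_aux_ge0 l : 0 <= khintchine_aux l.
Proof. by elim: l => //= l IH; rewrite addr_ge0// mulr_ge0. Qed.

Lemma khintchine_const_ge0 l : 0 <= khintchine_const l.
Proof. by rewrite addr_ge0 ?khintchine_aux_ge0. Qed.

(* Squaring both terms replaces [P], [Q], [h] by [P^2 + Q^2], [2PQ], [4Ph]. *)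
Lemma two_point_moment l (P Q h : R) :
  0 <= P -> 0 <= h -> Q ^+ 2 <= 4 * P * h ->
  (P + Q) ^+ (2 ^ l) + (P - Q) ^+ (2 ^ l) <=
  2 * (P + khintchine_aux l * h) ^+ (2 ^ l).
Proof.
elim: l P Q h => [|l IH] P Q h P0 h0 Qh /=.
  by rewrite mul0r addr0 !expr1; lra.
rewrite expnS !exprM.
have -> : (P + Q) ^+ 2 = (P ^+ 2 + Q ^+ 2) + 2 * P * Q by ring.
have -> : (P - Q) ^+ 2 = (P ^+ 2 + Q ^+ 2) - 2 * P * Q by ring.
have c0 := khintchine_aux_ge0 l; set c := khintchine_aux l in c0 IH *.
have P'0 : 0 <= P ^+ 2 + Q ^+ 2 by rewrite addr_ge0 ?sqr_ge0.
have h'0 : 0 <= 4 * P * h by rewrite !mulr_ge0.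
apply: le_trans (IH _ _ (4 * P * h) P'0 h'0 _) _.
  have -> : (2 * P * Q) ^+ 2 = 4 * P ^+ 2 * Q ^+ 2 by ring.
  apply: (@le_trans _ _ (4 * P ^+ 2 * (4 * P * h))).
    by rewrite ler_wpM2l// mulr_ge0// sqr_ge0.
  by rewrite ler_wpM2r// ler_wpM2l// lerDl sqr_ge0.
have c20 : 0 <= (2 + 2 * c) * h by rewrite mulr_ge0 ?addr_ge0 ?mulr_ge0.
have PQ0 : 0 <= P ^+ 2 + Q ^+ 2 + c * (4 * P * h) by rewrite addr_ge0 ?mulr_ge0.
rewrite ler_wpM2l// lerXn2r ?nnegrE//; first by rewrite exprn_ge0 ?addr_ge0.
have : 0 <= ((2 + 2 * c) * h) ^+ 2 by exact: sqr_ge0.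
by rewrite sqrrD; nra.
Qed.

End sign_average.

Section khintchine.
Context {R : realType} {k : scalar_kind}.
Local Notation K := (scalars R k).

Definition sign_sum n (V : lmodType K) (x : 'I_n -> V)
  (e : {ffun 'I_n -> bool}) : V :=
  \sum_(i < n) (-1) ^+ e i *: x i.

Lemma sign_sum_cons n (V : lmodType K) (x : 'I_n.+1 -> V) b e :
  sign_sum x (cons_sign b e) =
  (-1) ^+ b *: x ord0 + sign_sum (fun i => x (lift ord0 i)) e.
Proof.
rewrite /sign_sum big_ord_recl cons_sign0; congr (_ + _).
by apply: eq_bigr => i _; rewrite cons_signS.
Qed.

(** The squared quantity is twice the real part of [s] times the conjugate of [a]. The parallelogram
    law and the triangle inequality bound it for both fields at once. This supplies the hypothesis
    [Q ^+ 2 <= 4 * P * h] of the two-point inequality. *)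
Lemma modulus_sqr_diff (s a : K) :
  ((modulus (s + a) ^+ 2 - modulus (s - a) ^+ 2) / 2) ^+ 2 <=
  4 * modulus s ^+ 2 * modulus a ^+ 2.
Proof.
have := modulus_parallelogram s a.
have := modulusD s a; have := modulusD s (- a); rewrite modulusN.
have := modulus_ge0 s; have := modulus_ge0 a.
have := modulus_ge0 (s + a); have := modulus_ge0 (s - a).
move: (modulus (s + a)) (modulus (s - a)) (modulus s) (modulus a) => p m t u.
move=> m0 p0 u0 t0 mtu ptu pl.
have -> : 4 * t ^+ 2 * u ^+ 2 = (2 * t * u) ^+ 2 by ring.
rewrite -ler_sqrt ?sqr_ge0// !sqrtr_sqr [leRHS]ger0_norm ?mulr_ge0// ler_norml.
have p2 : p ^+ 2 <= (t + u) ^+ 2 by rewrite lerXn2r ?nnegrE ?addr_ge0.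
have m2 : m ^+ 2 <= (t + u) ^+ 2 by rewrite lerXn2r ?nnegrE ?addr_ge0.
by rewrite !sqrrD in p2 m2; apply/andP; split; lra.
Qed.

(** Induction on the number of signs, with the signs already fixed collected in [s]. The first sign
    is averaged last, by the two-point inequality with [h = |a_0|^2]; the parallelogram law puts one
    more [|a_0|^2] into [P], whence the [1 +] in [khintchine_const]. *)
Lemma khintchine_shifted n l (a : 'I_n -> K) (s : K) (W : R) : 0 <= W ->
  sign_avg (fun e => (modulus (s + sign_sum (a : 'I_n -> K^o) e) ^+ 2 + W) ^+
    (2 ^ l)) <=
  (modulus s ^+ 2 + W + khintchine_const l * \sum_i modulus (a i) ^+ 2) ^+
    (2 ^ l).
Proof.
elim: n a s W => [|n IH] a s W W0.
  by rewrite sign_avg0 /sign_sum !big_ord0 addr0 mulr0 addr0.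
rewrite sign_avgS big_ord_recl/=.
set S := \sum_(i < n) modulus (a (lift ord0 i)) ^+ 2.
have S0 : 0 <= S by apply: sumr_ge0 => i _; exact: sqr_ge0.
have bound (b : bool) : sign_avg (fun e : {ffun 'I_n -> bool} =>
    (modulus (s + sign_sum (a : 'I_n.+1 -> K^o) (cons_sign b e)) ^+ 2 + W) ^+
      (2 ^ l)) <=
  (modulus (s + (-1) ^+ b * a ord0) ^+ 2 + W + khintchine_const l * S) ^+
    (2 ^ l).
  under eq_fun do rewrite sign_sum_cons addrA.
  exact: IH.
have := bound false; have := bound true; rewrite expr0 expr1 mul1r mulN1r.
have h0 : 0 <= modulus (a ord0) ^+ 2 by exact: sqr_ge0.
have C0 := @khintchine_const_ge0 R l.
have WS0 : 0 <= W + khintchine_const l * S by rewrite addr_ge0// mulr_ge0.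
have s0 : 0 <= modulus s ^+ 2 by exact: sqr_ge0.
pose P := modulus s ^+ 2 + modulus (a ord0) ^+ 2 + (W + khintchine_const l * S).
pose Q := (modulus (s + a ord0) ^+ 2 - modulus (s - a ord0) ^+ 2) / 2.
have pl := modulus_parallelogram s (a ord0).
have -> : modulus (s - a ord0) ^+ 2 + W + khintchine_const l * S = P - Q.
  by rewrite /P /Q; lra.
have -> : modulus (s + a ord0) ^+ 2 + W + khintchine_const l * S = P + Q.
  by rewrite /P /Q; lra.
have P0 : 0 <= P by rewrite /P; lra.
have := @two_point_moment _ l P Q _ P0 h0 _.
have -> : P + khintchine_aux l * modulus (a ord0) ^+ 2 =
  modulus s ^+ 2 + W + khintchine_const l * (modulus (a ord0) ^+ 2 + S).
  by rewrite /P /khintchine_const; ring.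
move=> /(_ _)/wrap[]; last lra.
apply: le_trans (modulus_sqr_diff _ _) _; rewrite ler_wpM2r// ler_wpM2l//.
by rewrite /P; lra.
Qed.

Lemma khintchine n l (a : 'I_n -> K) :
  sign_avg (fun e => modulus (sign_sum (a : 'I_n -> K^o) e) ^+ (2 ^ l.+1)) <=
  (khintchine_const l * \sum_i modulus (a i) ^+ 2) ^+ (2 ^ l).
Proof.
have := khintchine_shifted l a 0 (lexx 0); rewrite modulus0 expr0n/= !add0r.
apply: le_trans; apply: le_sign_avg => e.
by rewrite add0r addr0 expnS exprM.
Qed.

End khintchine.

Section rademacher_projection.
Context {R : realType} {k : scalar_kind}.
Local Notation K := (scalars R k).

Definition sign_coef n (V : lmodType K) (G : {ffun 'I_n -> bool} -> V)
  (i : 'I_n) : V :=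
  of_real k (2 ^+ n)^-1 *: \sum_(e : {ffun 'I_n -> bool}) (-1) ^+ e i *: G e.

Lemma modulus_sum (I : Type) (r : seq I) (P : pred I) (F : I -> K) :
  modulus (\sum_(i <- r | P i) F i) <= \sum_(i <- r | P i) modulus (F i).
Proof. exact: (rnorm_sum (V := K^o)). Qed.

(* Rademacher projections are bounded from L_{4/3} to L_2, by duality with
   Khintchine's inequality in L_4; the L_{4/3} norm is interpolated between
   the L_1 and L_2 norms. *)
Lemma rademacher_projection n (g : {ffun 'I_n -> bool} -> K) :
  (\sum_i modulus (sign_coef (g : _ -> K^o) i) ^+ 2) ^+ 2 <=
  9 * sign_avg (fun e => modulus (g e)) ^+ 2 * sign_avg
    (fun e => modulus (g e) ^+ 2).
Proof.
set c := sign_coef _; set Q := \sum_i _.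
pose G e := modulus (g e); have G0 e : 0 <= G e by exact: modulus_ge0.
set A1 := sign_avg G; set A2 := sign_avg (fun e => G e ^+ 2).
have A10 : 0 <= A1 by exact: sign_avg_ge0.
have A20 : 0 <= A2 by apply: sign_avg_ge0 => e; exact: sqr_ge0.
have Q0 : 0 <= Q by apply: sumr_ge0 => i _; exact: sqr_ge0.
have [->|Qn0] := eqVneq Q 0.
  by rewrite expr0n/= mulr_ge0// mulr_ge0// sqr_ge0.
have Qgt0 : 0 < Q by rewrite lt_neqAle eq_sym Qn0.
have /choice[d dP] i : exists d : K, modulus d <= 1 /\
  d * c i = of_real k (modulus (c i)).
  by have [d ? ?] := modulus_phase (c i : K); exists d.
(* [b i] acts as the conjugate of [c i]: [b i * c i = |c i|^2] and [|b i| <= |c i|]. Integrating [g]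
   against the sign sum [S] of the [b i] returns [Q]. *)
pose b i : K := of_real k (modulus (c i)) * d i.
pose S e : K := sign_sum (b : 'I_n -> K^o) e.
have QE : of_real k Q = of_real k (2 ^+ n)^-1 *
  \sum_(e : {ffun 'I_n -> bool}) S e * g e.
  transitivity (\sum_i b i * c i).
    rewrite /Q (big_morph _ (@of_realD R k) (@of_real0 R k));
      apply: eq_bigr => i _.
    by rewrite /b -mulrA (dP i).2 -of_realM.
  under eq_bigr do rewrite /c /sign_coef -[of_real k _ *: _]/(of_real k _ * _)
    mulrCA mulr_sumr.
  rewrite -mulr_sumr exchange_big/=; congr (_ * _); apply: eq_bigr => e _.
  rewrite /S /sign_sum mulr_suml; apply: eq_bigr => i _.
  by rewrite -![_ *: _]/(_ * _); ring.
pose T e := modulus (S e).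
have QGT : Q <= sign_avg (fun e => G e * T e).
  rewrite -[leLHS]ger0_norm// -(modulus_of_real (k := k)) QE modulusM
    modulus_of_real.
  rewrite ger0_norm ?invr_ge0 ?exprn_ge0// ler_wpM2l ?invr_ge0 ?exprn_ge0//.
  apply: le_trans (modulus_sum _ _ _) _; apply: ler_sum => e _.
  by rewrite modulusM mulrC.
(* Two uses of Cauchy-Schwarz: [Q^2 <= A1 B] by splitting [G T] into [sqrt G] and [sqrt G T], then
   [B^2 <= A2 E[T^4] <= 9 A2 Q^2] by Khintchine with constant 3. Squaring the first bound and
   dividing by [Q^2] gives the claim. *)
pose B := sign_avg (fun e => G e * T e ^+ 2).
have B0 : 0 <= B by apply: sign_avg_ge0 => e; rewrite mulr_ge0// sqr_ge0.
have QA1 : Q ^+ 2 <= A1 * B.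
  apply: (@le_trans _ _ (sign_avg (fun e => G e * T e) ^+ 2)).
    by rewrite lerXn2r ?nnegrE// (le_trans Q0).
  have := sign_avg_cauchy_schwarz (fun e => Num.sqrt (G e))
    (fun e => Num.sqrt (G e) * T e).
  under eq_fun do rewrite mulrA -expr2 sqr_sqrtr//.
  have -> : (fun e => Num.sqrt (G e) ^+ 2) = G by apply/funext => e;
    rewrite sqr_sqrtr.
  have -> // : (fun e => (Num.sqrt (G e) * T e) ^+ 2) =
    (fun e => G e * T e ^+ 2).
  by apply/funext => e; rewrite exprMn sqr_sqrtr.
have BA2 : B ^+ 2 <= A2 * (9 * Q ^+ 2).
  apply: le_trans (sign_avg_cauchy_schwarz _ _) _.
  rewrite ler_wpM2l//; under eq_fun do rewrite -exprM.
  apply: le_trans (khintchine 1 b) _; rewrite expn1.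
  have -> : khintchine_const 1 = 3 :> R by rewrite /khintchine_const/=; ring.
  have -> : 9 * Q ^+ 2 = (3 * Q) ^+ 2 by ring.
  have bQ : \sum_i modulus (b i) ^+ 2 <= Q.
    apply: ler_sum => i _; rewrite lerXn2r ?nnegrE ?modulus_ge0//.
    rewrite modulusM modulus_of_real ger0_norm ?modulus_ge0//.
    by rewrite ler_piMr ?modulus_ge0 ?(dP i).1.
  by rewrite lerXn2r ?nnegrE ?mulr_ge0 ?ler_wpM2l// sumr_ge0// => i _;
    exact: sqr_ge0.
have : Q ^+ 2 * Q ^+ 2 <= Q ^+ 2 * (9 * A1 ^+ 2 * A2).
  rewrite -expr2; apply: (@le_trans _ _ ((A1 * B) ^+ 2)).
    by rewrite lerXn2r// nnegrE ?sqr_ge0// (mulr_ge0 A10 B0).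
  rewrite exprMn (le_trans (ler_wpM2l (sqr_ge0 A1) BA2))//.
  by rewrite le_eqVlt; apply/orP; left; apply/eqP; ring.
by rewrite ler_pM2l// exprn_gt0.
Qed.

Lemma sign_coefE n (V : normedModType K) (G : {ffun 'I_n -> bool} -> V)
  (x : 'I_n -> dual V) :
  \sum_i x i (sign_coef G i) = of_real k (2 ^+ n)^-1 *
    \sum_(e : {ffun 'I_n -> bool}) sign_sum x e (G e).
Proof.
transitivity (\sum_i of_real k (2 ^+ n)^-1 * \sum_(e : {ffun 'I_n -> bool})
  (-1) ^+ e i * x i (G e)).
  apply: eq_bigr => i _; rewrite /sign_coef linearZ linear_sum; congr (_ * _).
  by apply: eq_bigr => e _; rewrite linearZ.
rewrite -mulr_sumr exchange_big/=; congr (_ * _); apply: eq_bigr => e _.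
rewrite /sign_sum.
have -> : (\sum_i (-1) ^+ e i *: x i) (G e) = \sum_i ((-1) ^+ e i *: x i) (G e).
  by elim/big_ind2 : _ => // [f y g z <- <-].
by [].
Qed.

End rademacher_projection.

(** * Dual forms of cotype 2 *)

Section l2_norm.
Context {R : rcfType} {I : finType}.
Implicit Types f g : I -> R.

Definition l2 f : R := Num.sqrt (\sum_i f i ^+ 2).

Lemma l2_ge0 f : 0 <= l2 f. Proof. exact: sqrtr_ge0. Qed.

Lemma sum_sqr_ge0 f : 0 <= \sum_i f i ^+ 2.
Proof. by apply: sumr_ge0 => i _; exact: sqr_ge0. Qed.

Lemma l2_sqr f : l2 f ^+ 2 = \sum_i f i ^+ 2.
Proof. by rewrite sqr_sqrtr// sum_sqr_ge0. Qed.

Lemma sum_le_l2M f g : \sum_i f i * g i <= l2 f * l2 g.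
Proof.
apply: le_trans (ler_norm _) _; rewrite -sqrtr_sqr -sqrtrM ?sum_sqr_ge0//.
by rewrite ler_wsqrtr// sum_cauchy_schwarz.
Qed.

Lemma l2D f g : l2 (fun i => f i + g i) <= l2 f + l2 g.
Proof.
rewrite -(@ler_pXn2r _ 2)// ?nnegrE ?addr_ge0 ?l2_ge0// sqrrD !l2_sqr.
have -> : \sum_i (f i + g i) ^+ 2 =
    \sum_i f i ^+ 2 + (\sum_i f i * g i) *+ 2 + \sum_i g i ^+ 2.
  by rewrite -sumrMnl -!big_split/=; apply: eq_bigr => i _; rewrite sqrrD.
by rewrite lerD2r lerD2l lerMn2r sum_le_l2M.
Qed.

Lemma le_l2 f g : (forall i, 0 <= f i <= g i) -> l2 f <= l2 g.
Proof.
move=> fg; rewrite ler_wsqrtr// ler_sum// => i _; case/andP: (fg i) => f0 fgi.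
by rewrite lerXn2r ?nnegrE// (le_trans f0).
Qed.

Lemma l2Z (t : R) f : 0 <= t -> l2 (fun i => t * f i) = t * l2 f.
Proof.
move=> t0; rewrite /l2; under eq_bigr do rewrite exprMn.
by rewrite -mulr_sumr sqrtrM ?sqr_ge0// sqrtr_sqr ger0_norm.
Qed.

End l2_norm.

Section lifting.
Context {R : realType} {k : scalar_kind}.
Local Notation K := (scalars R k).

(** The supremum that defines the norm need not be attained; the factor one half makes room for
    this, and its cost is the 2 in [sign_l2_dual_le]. *)
Lemma dual_half_norming (X : normedModType K) (f : dual X) :
  exists2 x, rnorm x <= 1 & rnorm f / 2 <= scalar_re (f x).
Proof.
apply: contrapT => fN.
have Hf x : rnorm x <= 1 -> scalar_re (f x) < rnorm f / 2.
  by move=> x1; rewrite ltNge; apply/negP => fx; apply: fN; exists x.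
have f0 : 0 < rnorm f.
  by have := Hf 0; rewrite rnorm0 ler01 linear0 -of_real0 of_realK => /(_ isT);
    lra.
suff : rnorm f <= rnorm f / 2 by lra.
rewrite [leLHS]rnormE; apply: operator_norm_le => x x1.
have [u u1 ufx] := modulus_phase (f x).
rewrite -[leLHS](of_realK (k := k)) -ufx -[u * _]/(u *: _) -linearZ ltW// Hf//.
by rewrite rnormZ_modulus mulr_ile1 ?modulus_ge0 ?rnorm_ge0.
Qed.

Lemma cotype2_pos (E : normedModType K) : cotype2 E ->
  exists2 C : R, 0 < C & forall n (x : 'I_n -> E),
    l2 (fun i => rnorm (x i)) <=
    C * Num.sqrt (sign_avg (fun e => rnorm (sign_sum x e) ^+ 2)).
Proof.
move=> [C HC]; exists (`|C| + 1); first by rewrite ltr_wpDl.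
move=> n x; apply: le_trans (HC n x) _; rewrite ler_wpM2r ?sqrtr_ge0//.
by rewrite (le_trans (ler_norm C))// lerDl.
Qed.

Definition sign_l2 (V : normedModType K) n (G : {ffun 'I_n -> bool} -> V) : R :=
  Num.sqrt (sign_avg (fun e => rnorm (G e) ^+ 2)).

Lemma sign_l2E (V : normedModType K) n (G : {ffun 'I_n -> bool} -> V) :
  sign_l2 G = Num.sqrt (2 ^+ n)^-1 * l2 (fun e => rnorm (G e)).
Proof. by rewrite /sign_l2 /sign_avg sqrtrM// invr_ge0 exprn_ge0. Qed.

Lemma sign_l2_ge0 (V : normedModType K) n (G : {ffun 'I_n -> bool} -> V) :
  0 <= sign_l2 G.
Proof. exact: sqrtr_ge0. Qed.

Lemma sign_l2_sqr (V : normedModType K) n (G : {ffun 'I_n -> bool} -> V) :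
  sign_l2 G ^+ 2 = sign_avg (fun e => rnorm (G e) ^+ 2).
Proof. by rewrite sqr_sqrtr// sign_avg_ge0// => e; exact: sqr_ge0. Qed.

Lemma sign_l2D (V : normedModType K) n (F G : {ffun 'I_n -> bool} -> V) :
  sign_l2 (fun e => F e + G e) <= sign_l2 F + sign_l2 G.
Proof.
rewrite !sign_l2E -mulrDr ler_wpM2l ?sqrtr_ge0//.
apply: le_trans (l2D _ _); apply: le_l2 => e.
by rewrite rnorm_ge0 rnormD.
Qed.

Lemma sign_l2Z (V : normedModType K) n (t : R) (G : {ffun 'I_n -> bool} -> V) :
  0 <= t ->
  sign_l2 (fun e => of_real k t *: G e) = t * sign_l2 G.
Proof.
move=> t0; rewrite !sign_l2E mulrCA -(l2Z _ t0).
have -> // : (fun e => rnorm (of_real k t *: G e)) = (fun e => t * rnorm (G e)).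
by apply/funext => e; rewrite rnormZ_modulus modulus_of_real ger0_norm.
Qed.

(* Half-norming vectors turn a bound on the pairing with [F] into a bound on
   the L_2 norm of [F] itself. *)
Lemma sign_l2_dual_le (X : normedModType K) n
  (F : {ffun 'I_n -> bool} -> dual X) (c : R) :
  (forall G : {ffun 'I_n -> bool} -> X,
    sign_avg (fun e => scalar_re (F e (G e))) <= c * sign_l2 G) ->
  0 <= c -> sign_l2 F <= 2 * c.
Proof.
move=> Fc c0; have /choice[x xP] e : exists x, rnorm x <= 1 /\
  rnorm (F e) / 2 <= scalar_re (F e x).
  by have [x ? ?] := dual_half_norming (F e); exists x.
pose G e := of_real k (rnorm (F e)) *: x e.
have G_le : sign_l2 G <= sign_l2 F.
  rewrite !sign_l2E ler_wpM2l ?sqrtr_ge0//; apply: le_l2 => e.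
  rewrite rnorm_ge0 rnormZ_modulus modulus_of_real ger0_norm ?rnorm_ge0//=.
  by rewrite ler_piMr ?rnorm_ge0 ?(xP e).1.
have : sign_l2 F ^+ 2 / 2 <= c * sign_l2 F.
  apply: le_trans (ler_wpM2l c0 G_le); apply: le_trans (Fc G).
  rewrite sign_l2_sqr /sign_avg -mulrA ler_wpM2l ?invr_ge0 ?exprn_ge0//.
  rewrite mulr_suml ler_sum// => e _.
  rewrite /G linearZ scalar_reM expr2 -mulrA ler_wpM2l ?rnorm_ge0//;
    exact: (xP e).2.
have := sign_l2_ge0 F; rewrite le_eqVlt => /predU1P[<- _|F0].
  by rewrite mulr_ge0.
by rewrite expr2 mulrAC ler_pM2r//; lra.
Qed.

(* [E] is seen through the functionals of [V]; in the application [V] is the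
   dual of [E] or a predual of [E]. *)
Definition pairing (E V : normedModType K) (B : V -> E -> K^o) : Prop :=
  [/\ forall e, linear (B^~ e), forall v, linear (B v) &
      forall v e, modulus (B v e) <= rnorm v * rnorm e].

(* The dual form of cotype 2: every sequence of [V] is almost the sequence of
   Rademacher coefficients of a function controlled in L_2. *)
Definition rademacher_lifting (V : normedModType K) (C : R) : Prop :=
  forall n (a : 'I_n -> V) (eta : R), 0 < eta ->
  \sum_i rnorm (a i) ^+ 2 <= 1 ->
  exists2 G : {ffun 'I_n -> bool} -> V, sign_l2 G <= C &
    forall i, rnorm (a i - sign_coef G i) <= eta.

Lemma real_linear_sum (V : lmodType K) (f : V -> R) (I : Type) (r : seq I)
  (P : pred I) (F : I -> V) :
  real_linear f -> f (\sum_(i <- r | P i) F i) = \sum_(i <- r | P i) f (F i).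
Proof.
move=> [fD fZ]; apply: (big_morph f fD).
by have := fZ 0 0; rewrite scaler0 mul0r.
Qed.

Lemma scalar_re_sum (I : Type) (r : seq I) (P : pred I) (F : I -> K) :
  scalar_re (\sum_(i <- r | P i) F i) = \sum_(i <- r | P i) scalar_re (F i).
Proof.
apply: (big_morph (@scalar_re R k) (@scalar_reD R k)).
by rewrite -of_real0 of_realK.
Qed.

Lemma dual_ext (X : normedModType K) (f g : dual X) :
  (forall x, scalar_re (f x) = scalar_re (g x)) -> f = g.
Proof.
move=> fg; apply/eqP; rewrite -subr_eq0; apply/eqP/rnorm0_eq0/le_anti.
rewrite rnorm_ge0 andbT; apply: rnorm_dual_le => // x.
by rewrite mul0r -[(f - g) x]/(f x - g x) scalar_reD fg -scalar_reD subrr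
  -of_real0 of_realK.
Qed.

Lemma dual_sum_apply (X : normedModType K) (I : Type) (r : seq I) (P : pred I)
    (F : I -> dual X) x :
  (\sum_(i <- r | P i) F i) x = \sum_(i <- r | P i) F i x.
Proof. by elim/big_ind2 : _ => // [f y g z <- <-]. Qed.

Lemma dualZ_apply (X : normedModType K) (c : K) (f : dual X) x :
  (c *: f) x = c * f x.
Proof. by []. Qed.

Lemma sign_coef_dual (X : normedModType K) n
  (G : {ffun 'I_n -> bool} -> dual X) i x :
  sign_coef G i x = of_real k (2 ^+ n)^-1 *
    \sum_(e : {ffun 'I_n -> bool}) (-1) ^+ e i * G e x.
Proof.
by rewrite /sign_coef dualZ_apply dual_sum_apply.
Qed.

Lemma sign_sumD (V : lmodType K) n (x y : 'I_n -> V) e :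
  sign_sum (fun i => x i + y i) e = sign_sum x e + sign_sum y e.
Proof.
by rewrite /sign_sum -big_split/=; apply: eq_bigr => i _; rewrite scalerDr.
Qed.

Lemma sign_sumZ (V : lmodType K) n (t : K) (x : 'I_n -> V) e :
  sign_sum (fun i => t *: x i) e = t *: sign_sum x e.
Proof.
by rewrite /sign_sum scaler_sumr; apply: eq_bigr => i _; rewrite !scalerA mulrC.
Qed.

(** Cotype 2 and Cauchy-Schwarz bound the sum of the real parts of [a_i(x_i)] by the L_2 norm of the
    sign sum of the [x_i]. Hahn-Banach extends this functional from sign sums to all [E]-valued
    functions of the signs, and the extension is integration against a function [G] with values in
    the dual. *)
Lemma cotype2_lifting_dual (E : normedModType K) : cotype2 E ->
  exists C : R, 0 < C /\ rademacher_lifting (dual E) C.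
Proof.
move=> /cotype2_pos[C C0 HC]; exists (2 * C); split=> [|n a eta eta0 a1];
  first exact: mulr_gt0.
pose Om := {ffun 'I_n -> bool}.
pose p (F : Om -> E) : R := C * sign_l2 F.
have sp : sublinear (k := k) p.
  split=> [F G|t F t0]; first by rewrite -mulrDr ler_pM2l// sign_l2D.
  by rewrite /p mulrCA sign_l2Z.
pose S : set ((Om -> E) * R) := [set u | exists x : 'I_n -> E,
  u = (sign_sum x, \sum_i scalar_re (a i (x i)))].
have pS : dominated_cone (k := k) p S.
  split.
  - by exists (sign_sum (fun=> 0), \sum_(i < n) scalar_re (a i 0)), (fun=> 0).
  - move=> _ _ [x ->] [y ->]; exists (fun i => x i + y i); congr (_, _) => /=.
      by apply/funext => e; rewrite sign_sumD.
    by rewrite -big_split; apply: eq_bigr => i _; rewrite linearD scalar_reD.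
  - move=> t _ t0 [x ->]; exists (fun i => of_real k t *: x i);
      congr (_, _) => /=.
      by apply/funext => e; rewrite sign_sumZ.
    by rewrite mulr_sumr; apply: eq_bigr => i _; rewrite linearZ scalar_reM.
  - move=> _ [x ->] /=; rewrite /p; apply: le_trans (HC n x).
    apply: (@le_trans _ _ (\sum_i rnorm (a i) * rnorm (x i))).
      by apply: ler_sum => i _;
        apply: le_trans (scalar_re_le_modulus _) (dual_le _ _).
    apply: le_trans (sum_le_l2M _ _) _.
    by rewrite ler_piMl ?l2_ge0// -sqrtr1 ler_wsqrtr.
have [f [lf fp fS]] := mazur_orlicz sp pS.
(* Functions carried by a single sign pattern split [f] into functionals on [E]; the factor [2 ^+ n]
   below turns the sum over patterns into an average. *)
pose delta (e : Om) (x : E) : Om -> E := fun e' => if e' == e then x else 0.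
have deltaD e x y : delta e (x + y) = delta e x + delta e y.
  by apply/funext => e'; rewrite /delta fctE; case: eqP => //; rewrite addr0.
have deltaZ e t x : delta e (t *: x) = t *: delta e x.
  by apply/funext => e'; rewrite /delta fctE; case: eqP => //; rewrite scaler0.
have fdelta F : f F = \sum_e f (delta e (F e)).
  rewrite -real_linear_sum//; congr f; apply/funext => e.
  rewrite fct_sumE (bigD1 e)//= /delta eqxx big1 ?addr0// => e' /negbTE.
  by rewrite eq_sym => ->.
have n2 : 0 < 2 ^+ n :> R by rewrite exprn_gt0.
have /choice[G GP] e : exists g : dual E, forall x, scalar_re (g x) =
  2 ^+ n * f (delta e x).
  have [||x|g _ gE] :=
    @dual_of_real_linear _ _ _ (fun x => 2 ^+ n * f (delta e x)) (2 ^+ n * C).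
  - by rewrite mulr_ge0 ?ltW.
  - split=> [x y|t x]; first by rewrite deltaD lf.1 mulrDr.
    by rewrite deltaZ lf.2; ring.
  - rewrite -mulrA ler_pM2l//; apply: le_trans (fp _) _; rewrite ler_pM2l//.
    rewrite sign_l2E /l2 (bigD1 e)//= big1 => [|e' /negbTE e'e]; last first.
      by rewrite /delta e'e rnorm0 expr0n.
    rewrite /delta eqxx addr0 sqrtr_sqr ger0_norm ?rnorm_ge0//.
    by rewrite ler_piMl ?rnorm_ge0// -[leRHS]sqrtr1 ler_wsqrtr// invf_le1//
      exprn_ege1// ler1n.
  - by exists g.
have fG F : f F = sign_avg (fun e => scalar_re (G e (F e))).
  rewrite fdelta /sign_avg mulr_sumr; apply: eq_bigr => e _.
  by rewrite GP mulKf// gt_eqF.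
exists G.
  by apply: sign_l2_dual_le => [F|]; [rewrite -fG fp|exact: ltW].
move=> i; suff -> : a i = sign_coef G i by rewrite subrr rnorm0 ltW.
(* The cone gives only a lower bound for [f], but it also contains the opposite sign sums; hence
   equality, and the coefficients are exact. *)
have fsign x : f (sign_sum x) = \sum_i scalar_re (a i (x i)).
  apply/le_anti; rewrite (fS (sign_sum x, _))/=; last by exists x.
  rewrite andbT -lerN2.
  have := fS _ (ex_intro _ (fun i => -1 *: x i) erefl).
  rewrite [X in _ <= f X](_ : _ = of_real k (-1) *: sign_sum x); last first.
    by apply/funext => e /=; rewrite sign_sumZ of_realN of_real1.
  rewrite lf.2 mulN1r; apply: le_trans.
  rewrite -sumrN ler_sum// => j _.
  by rewrite linearZ -of_real1 -of_realN scalar_reM mulN1r.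
apply: dual_ext => x.
pose y j := if j == i then x else 0.
transitivity (f (sign_sum y)).
  rewrite fsign (bigD1 i)//= /y eqxx big1 ?addr0// => j /negbTE ->.
  by rewrite linear0 -of_real0 of_realK.
rewrite fG sign_coef_dual scalar_reM scalar_re_sum /sign_avg.
congr (_ * _); apply: eq_bigr => e _.
rewrite /sign_sum (bigD1 i)//= /y eqxx big1 ?addr0; last by move=> j /negbTE ->;
  rewrite scaler0.
by rewrite linearZ.
Qed.

End lifting.

Section lifting_predual.
Context {R : realType} {k : scalar_kind}.
Local Notation K := (scalars R k).

Lemma sign_coefD (V : lmodType K) n (F G : {ffun 'I_n -> bool} -> V) i :
  sign_coef (fun e => F e + G e) i = sign_coef F i + sign_coef G i.
Proof.
rewrite /sign_coef -scalerDr -big_split/=; congr (_ *: _).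
by apply: eq_bigr => e _; rewrite scalerDr.
Qed.

Lemma sign_coefZ (V : lmodType K) n t (G : {ffun 'I_n -> bool} -> V) i :
  sign_coef (fun e => t *: G e) i = t *: sign_coef G i.
Proof.
rewrite /sign_coef [RHS]scalerA mulrC -scalerA [in RHS]scaler_sumr;
  congr (_ *: _).
by apply: eq_bigr => e _; rewrite !scalerA mulrC.
Qed.

(* Otherwise a functional on the pairs (b, G) separates the obstruction; on the
   first factor it is a sequence of functionals, whose sign sums have L_2 norm
   at most 2, which contradicts cotype 2. *)
Lemma cotype2_lifting_predual (X : normedModType K) : cotype2 (dual X) ->
  exists C : R, 0 < C /\ rademacher_lifting X C.
Proof.
(* Any value above [2 * C] would do: the separation argument ends in [nu <= 2 * C]. *)
move=> /cotype2_pos[C C0 HC]; pose nu := 2 * C + 1.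
have nu0 : 0 < nu by rewrite addr_gt0// mulr_gt0.
exists nu; split=> // n a eta eta0 a1.
pose Om := {ffun 'I_n -> bool}.
(* With this penalty [p (a, G) < nu] makes every error [|a_i - sign_coef G i|] at most [eta], so
   without a lifting [p (a, G)] is at least [nu] for all [G]. *)
pose M := nu / eta; have M0 : 0 < M by rewrite divr_gt0.
pose W := (('I_n -> X) * (Om -> X))%type.
pose p (w : W) : R := sign_l2 w.2 + M * \sum_i rnorm (w.1 i - sign_coef w.2 i).
have sp : sublinear (k := k) (V := W) p.
  split=> [v w|t w t0].
    rewrite /p addrACA -mulrDr -big_split/= lerD ?sign_l2D// ler_pM2l//.
    apply: ler_sum => i _; rewrite sign_coefD opprD addrACA; exact: rnormD.
  rewrite /p mulrDr /= sign_l2Z// lerD2l mulrCA ler_pM2l// mulr_sumr ler_sum//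
    => i _.
  by rewrite sign_coefZ -scalerBr rnormZ_modulus modulus_of_real ger0_norm.
apply: contrapT => noG.
have sum_ge0 (F : 'I_n -> X) : 0 <= M * \sum_i rnorm (F i).
  by apply: mulr_ge0; [exact: ltW | apply: sumr_ge0 => i _; exact: rnorm_ge0].
have nup G : nu <= p (a, G).
  rewrite leNgt; apply/negP => pnu; apply: noG; exists G.
    by apply: le_trans (ltW pnu); rewrite lerDl sum_ge0.
  move=> i; rewrite -(ler_pM2l M0) {2}/M divfK ?gt_eqF//;
    apply: le_trans (ltW pnu).
  rewrite /p/= (bigD1 i)//= mulrDr addrCA lerDl addr_ge0 ?sign_l2_ge0//.
  by rewrite (mulr_ge0 (ltW M0))// sumr_ge0// => j _; exact: rnorm_ge0.
(* [G] is free even for [t = 0], where the prescribed value is 0. The separating functional is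
   therefore nonnegative, hence zero, on the second factor. *)
pose S : set (W * R) := [set u | exists t G, 0 <= t /\
  u = ((fun i => of_real k t *: a i, G), t * nu)].
have pS : dominated_cone (k := k) (V := W) p S.
  split.
  - by eexists; exists 0, (fun=> 0); split; [exact: lexx|reflexivity].
  - move=> _ _ [t [F [t0 ->]]] [s [G [s0 ->]]]; exists (t + s), (F + G).
    split; first exact: addr_ge0.
    rewrite mulrDl; congr ((_, _), _); apply/funext => i /=.
    by rewrite of_realD scalerDl.
  - move=> s _ s0 [t [G [t0 ->]]]; exists (s * t), (of_real k s *: G).
    split; first exact: mulr_ge0.
    rewrite mulrA; congr ((_, _), _); apply/funext => i /=.
    by rewrite of_realM -scalerA.
  - move=> _ [t [G [t0 ->]]] /=.
    have [->|tn0] := eqVneq t 0.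
      by rewrite mul0r addr_ge0 ?sign_l2_ge0// sum_ge0.
    have t_gt0 : 0 < t by rewrite lt_neqAle eq_sym tn0.
    have := nup (of_real k t^-1 *: G); rewrite -(ler_pM2l t_gt0) => /le_trans;
      apply.
    rewrite mulrC -ler_pdivlMr// mulrC.
    apply: le_trans (sp.2 t^-1 (fun i => of_real k t *: a i, G) _);
      last by rewrite invr_ge0.
    rewrite le_eqVlt; apply/orP; left; apply/eqP.
    congr p; congr (_, _); apply/funext => i /=.
    by rewrite scalerA -of_realM mulVf// of_real1 scale1r.
have [f [lf fp fS]] := mazur_orlicz sp pS.
have f0 : f 0 = 0 by have := lf.2 0 0; rewrite scaler0 mul0r.
have fN w : f (- w) = - f w by apply/eqP; rewrite -addr_eq0 -lf.1 addNr f0.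
have f0G G : f (0, G) = 0.
  have f0G_ge0 F : 0 <= f (0, F).
    have := fS ((fun i => of_real k 0 *: a i, F), 0 * nu); rewrite mul0r => /=.
    rewrite (_ : (fun i => _) = 0); last first.
      by apply/funext => i; rewrite of_real0 scale0r.
    apply; exists 0, F; rewrite mul0r; split=> //; congr ((_, _), _).
    by apply/funext => i; rewrite of_real0 scale0r.
  apply/le_anti; rewrite f0G_ge0 andbT -oppr_ge0 -fN.
  by rewrite -[- (0, G)]/(- (0 : 'I_n -> X), - G) oppr0.
have fb b G : f (b, G) = f (b, 0).
  have -> : (b, G) = (b, 0) + (0, G) :> W by congr (_, _);
    rewrite ?addr0 ?add0r.
  by rewrite lf.1 f0G addr0.
pose delta (i : 'I_n) (x : X) : 'I_n -> X := fun j => if j == i then x else 0.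
have deltaD i x y : delta i (x + y) = delta i x + delta i y.
  by apply/funext => j; rewrite /delta fctE; case: eqP => //; rewrite addr0.
have deltaZ i t x : delta i (t *: x) = t *: delta i x.
  by apply/funext => j; rewrite /delta fctE; case: eqP => //; rewrite scaler0.
have sc0 i : sign_coef (0 : Om -> X) i = 0.
  by rewrite /sign_coef big1 ?scaler0// => e _; rewrite scaler0.
have sl0 : sign_l2 (0 : Om -> X) = 0.
  have := @sign_l2Z _ k X n 0 0 (lexx 0); rewrite mul0r => <-; congr sign_l2.
  by apply/funext => e; rewrite scaler0.
have /choice[x xP] i : exists g : dual X, forall y, scalar_re (g y) =
  f (delta i y, 0).
  have [||y|g _ gE] := @dual_of_real_linear _ _ _ (fun y => f (delta i y, 0)) M.
  - exact: ltW.
  - split=> [y z|t y].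
      by rewrite deltaD -lf.1; congr f; congr (_, _); rewrite addr0.
    by rewrite deltaZ -lf.2; congr f; congr (_, _); rewrite scaler0.
  - apply: le_trans (fp _) _;
      rewrite /p/= sl0 add0r ler_pM2l// (bigD1 i)//= big1.
      by rewrite addr0 sc0 subr0 /delta eqxx.
    by move=> j /negbTE ji; rewrite sc0 subr0 /delta ji rnorm0.
  - by exists g.
have fx b : f (b, 0) = \sum_i scalar_re (x i (b i)).
  under eq_bigr do rewrite xP.
  rewrite -(@real_linear_sum _ _ W)//; congr f.
  have -> : \sum_i (delta i (b i), 0 : Om -> X) = (\sum_i delta i (b i), 0).
    by elim/big_ind2 : _ => // [? u ? v -> ->]; congr (_, _); rewrite addr0.
  congr (_, _); apply/funext => i.
  rewrite fct_sumE (bigD1 i)//= /delta eqxx big1 ?addr0// => j /negbTE.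
  by rewrite eq_sym => ->.
(* At [(sign_coef G, G)] the penalty vanishes, so the real part of the pairing of [sign_sum x] with
   any [G] is at most [sign_l2 G]. *)
have l2x : sign_l2 (sign_sum x) <= 2 * 1.
  apply: sign_l2_dual_le => // G; rewrite mul1r.
  have := fp (sign_coef G, G); rewrite /p/=.
  rewrite [X in _ <= _ + _ * X]big1 ?mulr0 ?addr0; last by move=> i _;
    rewrite subrr rnorm0.
  apply: le_trans;
    rewrite fb fx -scalar_re_sum sign_coefE scalar_reM scalar_re_sum.
  by [].
suff : nu <= 2 * C by rewrite /nu; lra.
have := fS ((fun i => of_real k 1 *: a i, 0), 1 * nu).
rewrite mul1r => /(_ _)/wrap[]; first by exists 1, 0; rewrite mul1r.
move=> /= /le_trans; apply; rewrite fx.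
apply: (@le_trans _ _ (l2 (fun i => rnorm (x i)) * l2 (fun i => rnorm (a i)))).
  apply: le_trans (sum_le_l2M _ _); apply: ler_sum => i _.
  rewrite of_real1 scale1r.
  exact: le_trans (scalar_re_le_modulus _) (dual_le _ _).
apply: (@le_trans _ _ (l2 (fun i => rnorm (x i)))).
  by rewrite ler_piMr ?l2_ge0// -sqrtr1 ler_wsqrtr.
apply: le_trans (HC n x) _; rewrite mulrC.
by rewrite ler_wpM2r ?(ltW C0)// (le_trans l2x)// mulr1.
Qed.

End lifting_predual.

(** * Extrapolation from QN_2 to QN_1 *)

Section nonnegative_sums.
Context {R : realType}.
Local Open Scope ereal_scope.
Implicit Types u v : nat -> R.

Definition nsum u : \bar R := \sum_(k <oo) (u k)%:E.

Lemma nsum_ge0 u : (forall k, 0 <= u k)%R -> 0 <= nsum u.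
Proof. by move=> u0; apply: nneseries_ge0 => n _ _; rewrite lee_fin. Qed.

Lemma le_nsum u v : (forall k, 0 <= u k <= v k)%R -> nsum u <= nsum v.
Proof.
by move=> uv; apply: lee_nneseries => k *; rewrite lee_fin; case/andP: (uv k).
Qed.

Lemma eq_nsum u v : u =1 v -> nsum u = nsum v.
Proof. by move=> uv; congr nsum; exact/funext. Qed.

Lemma nsumD u v : (forall k, 0 <= u k)%R -> (forall k, 0 <= v k)%R ->
  nsum (fun k => u k + v k)%R = nsum u + nsum v.
Proof.
move=> u0 v0; by rewrite /nsum -nneseriesD => [|i *|i *]; rewrite ?lee_fin.
Qed.

Lemma nsumZ (t : R) u : (forall k, 0 <= u k)%R ->
  nsum (fun k => t * u k)%R = t%:E * nsum u.
Proof.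
by move=> u0; rewrite /nsum -nneseriesZl => [|i *]; rewrite ?lee_fin.
Qed.

Lemma nsum_split n u : (forall k, 0 <= u k)%R ->
  nsum u = (\sum_(i < n) u i)%:E + nsum (fun k => u (k + n)%N).
Proof.
move=> u0; rewrite /nsum (nneseries_split 0 n) => [|k *];
  last by rewrite lee_fin.
rewrite add0n big_mkord sumEFin; congr (_ + _).
by rewrite -(@nneseries_addn _ (fun k => (u k)%:E))// => k; rewrite lee_fin.
Qed.

Lemma nsum0 u : (forall k, u k = 0)%R -> nsum u = 0.
Proof. by move=> u0; apply: eseries0 => i _ _; rewrite u0. Qed.

Lemma nsum_fin n u : (forall k, 0 <= u k)%R ->
  (forall k, (n <= k)%N -> u k = 0%R) ->
  nsum u = (\sum_(i < n) u i)%:E.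
Proof.
move=> u0 un; rewrite (nsum_split n)// nsum0 ?adde0// => k.
by rewrite un// leq_addl.
Qed.

Lemma sum_le_nsum n u : (forall k, 0 <= u k)%R -> (\sum_(i < n) u i)%:E <=
  nsum u.
Proof. by move=> u0; rewrite (nsum_split n)// leeDl// nsum_ge0. Qed.

Lemma nsum_le u (c : \bar R) : (forall k, 0 <= u k)%R ->
  (forall n, (\sum_(i < n) u i)%:E <= c) -> nsum u <= c.
Proof.
move=> u0 uc; apply: lime_le; first by apply: is_cvg_nneseries => i *;
  rewrite lee_fin.
by near=> n; rewrite big_mkord sumEFin.
Unshelve. all: by end_near. Qed.

Lemma nsum_tail u (e : R) : (forall k, 0 <= u k)%R -> nsum u < +oo ->
  (0 < e)%R ->
  exists n, nsum (fun k => u (k + n)%N) <= e%:E.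
Proof.
move=> u0 uoo e0.
have := @nneseries_tail_cvg _ (fun k => (u k)%:E) xpredT uoo.
move=> /(_ _)/wrap[]; first by move=> k _; rewrite lee_fin.
move=> /fine_cvgP[fin /cvgrPdist_le/(_ e e0)] cv.
have [n _ nP] := filterI fin cv.
exists n; have [nfin] := nP n (leqnn n).
rewrite sub0r normrN => ne.
rewrite /nsum (@nneseries_addn _ (fun k => (u k)%:E)); last by move=> k;
  rewrite lee_fin.
by rewrite -(fineK nfin) lee_fin (le_trans (ler_norm _)).
Qed.

(** Reads a double sequence along the coding of pairs by integers. Integers that code no pair
    receive [x0], which the summed function sends to 0 in [nsum_flatten]. *)
Definition flatten_seq (T : Type) (x0 : T) (z : nat -> nat -> T)
    (k : nat) : T :=
  if pickle_inv k is Some u then z u.1 u.2 else x0.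

Lemma nsum_flatten (T : Type) (x0 : T) (z : nat -> nat -> T) (h : T -> R) :
  (forall x, 0 <= h x)%R -> h x0 = 0%R ->
  nsum (fun k => h (flatten_seq x0 z k)) = \sum_(n <oo) nsum
    (fun j => h (z n j)).
Proof.
move=> h0 hx0; rewrite /nsum.
pose G k := (h (flatten_seq x0 z k))%:E.
rewrite (@nneseries_esumT _ G) => [|n]; last by rewrite lee_fin.
rewrite nneseries_esumT => [|n]; last by apply: nneseries_ge0 => *;
  rewrite lee_fin.
under [RHS]eq_esum do (rewrite nneseries_esumT; last by move=> *;
  rewrite lee_fin).
rewrite esum_esum => [|i j _ _]; last by rewrite lee_fin.
rewrite (_ : setT `*`` _ = setT); last by apply/seteqP; split.
transitivity (\esum_(u in [set: nat * nat]) G (pickle u)); last first.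
  by apply: eq_esum => -[i j] _; rewrite /G /flatten_seq pickleK_inv.
pose e : nat * nat -> nat := pickle.
have bij_e : set_bij [set: nat * nat] (range e) e.
  split; [by move=> u _; exists u | by move=> u v _ _;
    exact: (pcan_inj pickleK) |].
  by move=> _ [u _ <-]; exists u.
transitivity (\esum_(j in range e) G j);
  last exact: (reindex_esum _ _ _ G bij_e).
rewrite [RHS]esum_mkcond; apply: eq_esum => n _; case: ifPn => // nP.
rewrite /G /flatten_seq; case E : (pickle_inv n) => [u|]; last by rewrite hx0.
exfalso; move/negP: nP; apply; rewrite inE; exists u => //.
by have := @pickle_invK (nat * nat)%type n; rewrite E.
Qed.

End nonnegative_sums.

Definition power_sum (R : realType) (k : scalar_kind)
  (W : normedModType (scalars R k))
    (m : nat) (w : nat -> W) : \bar R :=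
  nsum (fun i => rnorm (w i) ^+ m).

Section domination.
Context {R : realType} {k : scalar_kind}.
Local Notation K := (scalars R k).
Context {E V : normedModType K} (B : V -> E -> K^o).
Hypothesis pB : pairing B.
Implicit Types (phi psi : E -> R) (e : E) (a z : nat -> V).

Lemma pairingDl v w e : B (v + w) e = B v e + B w e.
Proof. by have [lB _ _] := pB; have := lB e 1 v w; rewrite /= !scale1r. Qed.

Lemma pairingDr v e f : B v (e + f) = B v e + B v f.
Proof. by have [_ lB _] := pB; have := lB v 1 e f; rewrite /= !scale1r. Qed.

Lemma pairing0l e : B 0 e = 0.
Proof. by apply: (@addrI _ (B 0 e)); rewrite -pairingDl !addr0. Qed.

Lemma pairing0r v : B v 0 = 0.
Proof. by apply: (@addrI _ (B v 0)); rewrite -pairingDr !addr0. Qed.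

Lemma pairingZl t v e : B (t *: v) e = t * B v e.
Proof.
by have [lB _ _] := pB; have := lB e t v 0; rewrite /= pairing0l !addr0.
Qed.

Lemma pairingZr t v e : B v (t *: e) = t * B v e.
Proof.
by have [_ lB _] := pB; have := lB v t e 0; rewrite /= pairing0r !addr0.
Qed.

Lemma pairing_suml (I : Type) (r : seq I) (P : pred I) (F : I -> V) e :
  B (\sum_(i <- r | P i) F i) e = \sum_(i <- r | P i) B (F i) e.
Proof. by apply: (big_morph (B^~ e)) => [v w|];
  [exact: pairingDl|exact: pairing0l]. Qed.

Lemma pairing_sumr (I : Type) (r : seq I) (P : pred I) v (F : I -> E) :
  B v (\sum_(i <- r | P i) F i) = \sum_(i <- r | P i) B v (F i).
Proof. by apply: (big_morph (B v)) => [f g|];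
  [exact: pairingDr|exact: pairing0r]. Qed.

Lemma pairing_le v e : modulus (B v e) <= rnorm v * rnorm e.
Proof. by case: pB. Qed.

Lemma pairing_sign_coef n (G : {ffun 'I_n -> bool} -> V) i e :
  B (sign_coef G i) e = sign_coef (fun w => B (G w) e) i.
Proof.
rewrite /sign_coef pairingZl pairing_suml; congr (_ * _); apply: eq_bigr => w _.
by rewrite pairingZl.
Qed.

(** For [c >= 0], [phi e = |T e|] and the pairing of the dual with [X], this says that [T] has a
    QN_m majorant of norm at most [c]. Arbitrary functions [phi] are allowed because extrapolation
    splits [|T e|] into pieces that are not norms of operators. *)
Definition dominated (m : nat) phi (c : R) : Prop :=
  exists2 a, (power_sum m a <= (c ^+ m)%:E)%E &
    forall e, ((phi e ^+ m)%:E <= power_sum m (fun i => B (a i) e))%E.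

Lemma exp_rnorm_ge0 (W : normedModType K) m (w : W) : 0 <= rnorm w ^+ m.
Proof. by rewrite exprn_ge0// rnorm_ge0. Qed.

Lemma exp_modulus_ge0 m (w : K) : 0 <= modulus w ^+ m.
Proof. by rewrite exprn_ge0// modulus_ge0. Qed.
Hint Resolve exp_rnorm_ge0 exp_modulus_ge0 : core.

Lemma le_dominated m phi psi c d :
  0 <= c <= d -> (forall e, 0 <= phi e <= psi e) ->
  dominated m psi c -> dominated m phi d.
Proof.
move=> /andP[c0 cd] fg [a ac aB]; exists a.
  by apply: le_trans ac _; rewrite lee_fin lerXn2r ?nnegrE// (le_trans c0).
move=> e; apply: le_trans (aB e); rewrite lee_fin; case/andP: (fg e) => f0 fge.
by rewrite lerXn2r ?nnegrE// (le_trans f0).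
Qed.

Lemma dominatedZ m phi c (t : R) : 0 <= t ->
  dominated m phi c -> dominated m (fun e => t * phi e) (t * c).
Proof.
move=> t0 [a ac aB]; exists (fun i => of_real k t *: a i).
  rewrite /power_sum (eq_nsum (v := fun i => t ^+ m * rnorm (a i) ^+ m));
    last first.
    by move=> i; rewrite rnormZ_modulus modulus_of_real ger0_norm// exprMn.
  by rewrite nsumZ// exprMn EFinM lee_wpmul2l ?lee_fin ?exprn_ge0.
move=> e; rewrite /power_sum
  (eq_nsum (v := fun i => t ^+ m * modulus (B (a i) e) ^+ m)); last first.
  by move=> i; rewrite -[rnorm _]/(modulus _) pairingZl modulusM modulus_of_real
    ger0_norm// exprMn.
rewrite nsumZ// exprMn EFinM; by rewrite lee_wpmul2l ?lee_fin ?exprn_ge0.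
Qed.

Lemma dominated_flatten m phi c (z : nat -> nat -> V) : (0 < m)%N ->
  (\sum_(n <oo) power_sum m (z n) <= (c ^+ m)%:E)%E ->
  (forall e, ((phi e ^+ m)%:E <=
    \sum_(n <oo) power_sum m (fun j => B (z n j) e))%E) ->
  dominated m phi c.
Proof.
move=> m0 zc zB; exists (flatten_seq 0 z) => [|e].
  rewrite /power_sum (nsum_flatten (x0 := 0) z (h := fun v => rnorm v ^+ m))//.
  by rewrite rnorm0 expr0n eqn0Ngt m0.
rewrite /power_sum
  (nsum_flatten (x0 := 0) z (h := fun v => modulus (B v e) ^+ m))//.
by rewrite pairing0l modulus0 expr0n eqn0Ngt m0.
Qed.

(** At exponent 1, concatenating majorants adds both their norms and the functions they dominate, so
    countable sums cost no constant. *)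
Lemma dominated1_series (phi : nat -> E -> R) (c : nat -> R) psi d :
  (forall n, dominated 1 (phi n) (c n)) -> (\sum_(n <oo) (c n)%:E <= d%:E)%E ->
  (forall e, 0 <= psi e) ->
  (forall n e, 0 <= phi n e) ->
    (forall e, ((psi e)%:E <= \sum_(n <oo) (phi n e)%:E)%E) ->
  dominated 1 psi d.
Proof.
move=> phic cd psi0 phi0 psiphi.
have /choice[z zP] n : exists z, (power_sum 1 z <= (c n ^+ 1)%:E)%E /\
    forall e, ((phi n e ^+ 1)%:E <= power_sum 1 (fun i => B (z i) e))%E.
  by have [z ? ?] := phic n; exists z.
apply: (dominated_flatten (z := z)) => // [|e]; rewrite expr1.
  apply: le_trans cd; apply: lee_nneseries => n *; first by rewrite nsum_ge0.
  exact: (zP n).1.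
apply: le_trans (psiphi e) _; apply: lee_nneseries => n *;
  first by rewrite lee_fin.
exact: (zP n).2.
Qed.

Lemma nsum_nth (s : seq V) (h : V -> R) : (forall v, 0 <= h v) -> h 0 = 0 ->
  nsum (fun i => h (nth 0 s i)) = (\sum_(v <- s) h v)%:E.
Proof.
move=> h0 hz; rewrite (nsum_fin (n := size s))//.
  by rewrite (big_nth 0) big_mkord.
by move=> i si; rewrite nth_default.
Qed.

Lemma dominated_finite m (I : finType) (a : I -> V) phi c : (0 < m)%N ->
  \sum_i rnorm (a i) ^+ m <= c ^+ m ->
  (forall e, phi e ^+ m <= \sum_i modulus (B (a i) e) ^+ m) ->
  dominated m phi c.
Proof.
move=> m0 ac aB; exists (fun i => nth 0 [seq a i | i <- index_enum I] i) =>
  [|e].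
  rewrite /power_sum (nsum_nth _ (h := fun v => rnorm v ^+ m)) ?big_map
    ?lee_fin//.
  by rewrite rnorm0 expr0n eqn0Ngt m0.
rewrite /power_sum (nsum_nth _ (h := fun v => modulus (B v e) ^+ m)) ?big_map
  ?lee_fin//.
by rewrite pairing0l modulus0 expr0n eqn0Ngt m0.
Qed.

Lemma power_sum_ge0 (W : normedModType K) m (w : nat -> W) :
  (0 <= power_sum m w)%E.
Proof. exact: nsum_ge0. Qed.

Lemma power_sum_pairing_le m a e :
  (power_sum m (fun i => B (a i) e) <= (rnorm e ^+ m)%:E * power_sum m a)%E.
Proof.
rewrite /power_sum -nsumZ//; apply: le_nsum => i;
  rewrite exp_rnorm_ge0/= mulrC -exprMn.
by rewrite lerXn2r ?nnegrE ?mulr_ge0 ?rnorm_ge0// pairing_le.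
Qed.

(** Concatenation of [2 a] and [2 b], which leaves room for [(phi + psi)^2 <= 4 phi^2 + 4 psi^2].
    The loss is affordable because only a few pieces with adjustable constants are added. *)
Lemma dominated2D phi psi c d : 0 <= c -> 0 <= d ->
  dominated 2 phi c -> dominated 2 psi d ->
  dominated 2 (fun e => phi e + psi e) (2 * (c + d)).
Proof.
move=> c0 d0 /(@dominatedZ _ _ _ 2 _)[//|a ac aB]
  /(@dominatedZ _ _ _ 2 _)[//|b bd bB].
pose z n := if n is 0%N then a else if n is 1%N then b else fun=> 0.
have zE (h : (nat -> V) -> \bar R) : (forall v, 0 <= h v)%E ->
  h (fun=> 0) = 0%E ->
    (\sum_(n <oo) h (z n) = h a + h b)%E.
  move=> h0 hz; rewrite (nneseries_split 0 2) => [|? _]; last exact: h0.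
  rewrite eseries0 ?adde0; last by move=> [|[|]].
  by rewrite add0n !big_nat_recr//= big_geq// add0e.
have ps0 (W : normedModType K) : power_sum 2 (fun=> 0 : W) = 0%E.
  by apply: nsum0 => i; rewrite rnorm0 expr0n.
apply: (dominated_flatten (z := z)) => // [|e].
  rewrite (zE (power_sum 2))//; last by move=> v; exact: power_sum_ge0.
  apply: le_trans (leeD ac bd) _; rewrite -EFinD lee_fin.
  rewrite !exprMn -mulrDr ler_wpM2l ?sqr_ge0// sqrrD addrAC lerDl.
  by rewrite mulrn_wge0// mulr_ge0.
rewrite (zE (fun v => power_sum 2 (fun j => B (v j) e))); last 2 first.
- by move=> v; exact: power_sum_ge0.
- rewrite -(ps0 K^o); apply: eq_nsum => i; by rewrite pairing0l.
apply: le_trans (leeD (aB e) (bB e)); rewrite -EFinD lee_fin.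
have := sqr_ge0 (phi e - psi e); have := sqr_ge0 (phi e);
  have := sqr_ge0 (psi e).
nra.
Qed.

(** Up to a tail [tau] and a lifting error [rho], [phi e] is controlled by the l_2 norm of the
    Rademacher coefficients of [w |-> B (G w) e]. By [rademacher_projection] the square of that norm
    is at most [3 g1 g2], with [g1] and [g2] the L_1 and L_2 norms of this function. As [G] is
    bounded in L_2, [g1] is dominated for exponent 1 and [g2] for exponent 2; the product is split
    with a large factor on [g1] and a small one on [g2]. *)
Lemma extrapolation_step (C : R) phi : 0 < C -> rademacher_lifting V C ->
  (forall e, 0 <= phi e) -> dominated 2 phi 1 ->
  exists psi1 psi2 : E -> R, [/\ forall e, 0 <= psi1 e, forall e, 0 <= psi2 e,
    dominated 1 psi1 (48 * C ^+ 2), dominated 2 psi2 1 &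
    forall e, phi e <= psi1 e + psi2 e / 4].
Proof.
move=> C0 liftV phi0 [a a1 aphi]; rewrite expr1n in a1.
(* The budget for [psi2]: with [kap * C = 1/32] and the errors [2 del] and [del], two uses of
   [dominated2D] and the final factor 4 give [11/12 <= 1]. *)
pose del : R := 96^-1; have del0 : 0 < del by rewrite invr_gt0.
have [n tail_n] := nsum_tail (fun i => exp_rnorm_ge0 2 (a i))
  (le_lt_trans a1 (ltry 1)) (exprn_gt0 2 del0).
(* [n] errors of size [eta] amount to at most [del] in l_2; the successor covers [n = 0]. *)
pose eta := del / n.+1%:R; have eta0 : 0 < eta by rewrite divr_gt0.
have [|G GC Geta] := liftV n (fun i => a i) eta eta0.
  by rewrite -lee_fin; apply: le_trans (sum_le_nsum _ _) a1.
pose r (i : 'I_n) := a i - sign_coef G i.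
pose rho e := l2 (fun i => modulus (B (r i) e)).
pose tau e := Num.sqrt (fine (power_sum 2 (fun i => B (a (i + n)%N) e))).
pose g1 e := sign_avg (fun w => modulus (B (G w) e)).
pose g2 e := Num.sqrt (sign_avg (fun w => modulus (B (G w) e) ^+ 2)).
(* Matched with 48 so that [4 x y = 6 g1 g2] for [x = 48 C g1] and [y = kap g2]: then
   [2 Q <= 6 g1 g2 <= (x + y)^2]. *)
pose kap := (32 * C)^-1; have kap0 : 0 < kap by rewrite invr_gt0 mulr_gt0.
have rho0 e : 0 <= rho e by exact: sqrtr_ge0.
have tau0 e : 0 <= tau e by exact: sqrtr_ge0.
have g10 e : 0 <= g1 e by apply: sign_avg_ge0 => w; exact: modulus_ge0.
have g20 e : 0 <= g2 e by exact: sqrtr_ge0.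
have n20 : 0 <= (2 ^+ n)^-1 :> R by rewrite invr_ge0 exprn_ge0.
have Dg1 : dominated 1 g1 C.
  apply: (dominated_finite (a := fun w => of_real k (2 ^+ n)^-1 *: G w)) =>
    // [|e].
    under eq_bigr do rewrite expr1 rnormZ_modulus modulus_of_real ger0_norm//.
    rewrite -mulr_sumr expr1; apply: le_trans GC.
    rewrite -(@ler_pXn2r _ 2)// ?nnegrE ?sign_l2_ge0//; last first.
      by rewrite mulr_ge0// sumr_ge0// => w _; exact: rnorm_ge0.
    rewrite sign_l2_sqr; apply: (@sign_avg_pow _ _ 1) => w; exact: rnorm_ge0.
  under eq_bigr do rewrite expr1 pairingZl modulusM modulus_of_real ger0_norm//.
  by rewrite -mulr_sumr expr1.
have Dg2 : dominated 2 g2 C.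
  apply: (dominated_finite
    (a := fun w => of_real k (Num.sqrt (2 ^+ n)^-1) *: G w)) => // [|e].
    under eq_bigr do rewrite rnormZ_modulus modulus_of_real ger0_norm
      ?sqrtr_ge0// exprMn sqr_sqrtr//.
    rewrite -mulr_sumr -[leLHS]sign_l2_sqr lerXn2r ?nnegrE ?sign_l2_ge0//.
    exact: ltW.
  under eq_bigr do rewrite pairingZl modulusM modulus_of_real ger0_norm
    ?sqrtr_ge0// exprMn sqr_sqrtr//.
  by rewrite -mulr_sumr sqr_sqrtr// sign_avg_ge0.
have Drho : dominated 2 rho del.
  apply: (dominated_finite (a := r)) => // [|e]; last by rewrite l2_sqr.
  apply: (@le_trans _ _ (\sum_(i < n) eta ^+ 2)).
    by apply: ler_sum => i _; rewrite lerXn2r ?nnegrE ?rnorm_ge0 ?(ltW eta0)//;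
      exact: Geta.
  rewrite sumr_const card_ord -mulr_natr /eta exprMn -mulrA ler_piMr ?sqr_ge0//.
  rewrite exprVn mulrC ler_pdivrMr ?exprn_gt0// mul1r -natrX ler_nat.
  by rewrite (leq_trans (leqnSn n))// leq_pmulr.
have Dtau : dominated 2 tau del.
  exists (fun i => a (i + n)%N) => // e.
  rewrite sqr_sqrtr ?fine_ge0 ?power_sum_ge0// fineK// ge0_fin_numE
    ?power_sum_ge0//.
  apply: le_lt_trans (power_sum_pairing_le _ _ _) _.
  by rewrite lte_mul_pinfty ?lee_fin//; apply: le_lt_trans tail_n (ltry _).
have C48 : 0 <= 48 * C by rewrite mulr_ge0// ltW.
have h1 e : 0 <= 48 * C * g1 e := mulr_ge0 C48 (g10 e).
have h2 e : 0 <= kap * g2 e := mulr_ge0 (ltW kap0) (g20 e).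
have h3 e : 0 <= 2 * rho e := mulr_ge0 (ler0n _ 2) (rho0 e).
have h4 e : 0 <= kap * g2 e + 2 * rho e + tau e :=
  addr_ge0 (addr_ge0 (h2 e) (h3 e)) (tau0 e).
exists (fun e => 48 * C * g1 e),
  (fun e => 4 * (kap * g2 e + 2 * rho e + tau e)); split.
- by [].
- by move=> e; exact: mulr_ge0.
- by rewrite expr2 mulrA; apply: dominatedZ.
- have kC : kap * C = 32^-1 by rewrite /kap invfM mulfVK// gt_eqF.
  have D0 : 0 <= kap * C by rewrite mulr_ge0// ltW.
  have Dkr := dominated2D D0 _ (dominatedZ (ltW kap0) Dg2)
    (dominatedZ (ler0n _ 2) Drho).
  have del2 : 0 <= 2 * del by rewrite mulr_ge0// ltW.
  have := dominatedZ (ler0n _ 4) (dominated2D _ (ltW del0) (Dkr del2) Dtau).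
  rewrite kC => /(_ _)/wrap[]; first by rewrite mulr_ge0// addr_ge0.
  apply: le_dominated; last first.
    by move=> e; rewrite lexx andbT mulr_ge0.
  by rewrite /del; apply/andP; split; lra.
move=> e; rewrite [4 * _]mulrC mulfK//.
pose Q := \sum_(i < n) modulus (B (sign_coef G i) e) ^+ 2.
have Q0 : 0 <= Q by apply: sumr_ge0.
have Qle : Q <= 3 * (g1 e * g2 e).
  rewrite -(@ler_pXn2r _ 2)// ?nnegrE//; last first.
    exact: (mulr_ge0 _ (mulr_ge0 (g10 e) (g20 e))).
  have := rademacher_projection (fun w => B (G w) e).
  rewrite (_ : \sum_i _ = Q); last first.
    by apply: eq_bigr => i _; rewrite pairing_sign_coef.
  move/le_trans; apply; rewrite !exprMn sqr_sqrtr ?sign_avg_ge0//.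
  by rewrite le_eqVlt -/(g1 e); apply/orP; left; apply/eqP; ring.
have phi2 : phi e ^+ 2 <= 2 * Q + 2 * rho e ^+ 2 + tau e ^+ 2.
  rewrite -lee_fin; apply: le_trans (aphi e) _.
  rewrite /power_sum (nsum_split n)// EFinD leeD//; last first.
    rewrite sqr_sqrtr ?fine_ge0 ?power_sum_ge0// fineK// ge0_fin_numE
      ?power_sum_ge0//.
    apply: le_lt_trans (power_sum_pairing_le _ _ _) _.
    by rewrite lte_mul_pinfty ?lee_fin//; apply: le_lt_trans tail_n (ltry _).
  rewrite lee_fin l2_sqr -mulrDr -big_split/= mulr_sumr ler_sum// => i _.
  have -> : B (a i) e = B (sign_coef G i) e + B (r i) e.
    by rewrite -pairingDl /r addrC subrK.
  have := modulusD (B (sign_coef G i) e) (B (r i) e).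
  have := modulus_ge0 (B (sign_coef G i) e); have := modulus_ge0 (B (r i) e).
  rewrite -[rnorm _]/(modulus _).
  move: (modulus _) (modulus _) (modulus (_ + _))
    (modulus_ge0 (B (sign_coef G i) e + B (r i) e)).
  move=> x y z z0 y0 x0 zxy;
    have : z ^+ 2 <= (x + y) ^+ 2 by rewrite lerXn2r ?nnegrE ?addr_ge0.
  by have := sqr_ge0 (x - y); nra.
rewrite -(@ler_pXn2r _ 2)// ?nnegrE//; last exact: (addr_ge0 (h1 e) (h4 e)).
apply: le_trans phi2 _.
have : 6 * (g1 e * g2 e) <= (48 * C * g1 e + kap * g2 e) ^+ 2.
  have -> : 6 * (g1 e * g2 e) = 4 * (48 * C * g1 e) * (kap * g2 e).
    by rewrite /kap; field; rewrite gt_eqF.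
  by have := sqr_ge0 (48 * C * g1 e - kap * g2 e); nra.
have u0 : 0 <= 48 * C * g1 e + kap * g2 e := addr_ge0 (h1 e) (h2 e).
rewrite !addrA; move: (48 * C * g1 e + kap * g2 e) u0 (rho0 e) (tau0 e) =>
  u u0 r0 t0.
have := mulr_ge0 u0 r0; have := mulr_ge0 u0 t0; have := mulr_ge0 r0 t0;
  have := sqr_ge0 (rho e).
by rewrite !sqrrD exprMn; nra.
Qed.

Lemma dominated_le_rnorm m phi c e : (0 < m)%N -> 0 <= c ->
  (forall e, 0 <= phi e) ->
  dominated m phi c -> phi e <= c * rnorm e.
Proof.
move=> m0 c0 phi0 [a ac aphi].
rewrite -(@ler_pXn2r _ m)// ?nnegrE ?mulr_ge0 ?rnorm_ge0// -lee_fin.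
apply: le_trans (aphi e) _; apply: le_trans (power_sum_pairing_le _ _ _) _.
by rewrite mulrC exprMn EFinM lee_wpmul2l ?lee_fin.
Qed.

Lemma sum_pow4 n : \sum_(i < n) (4 ^+ i)^-1 = 4 / 3 * (1 - (4 ^+ n)^-1) :> R.
Proof.
elim: n => [|n IH]; first by rewrite big_ord0 expr0 invr1 subrr mulr0.
rewrite big_ord_recr/= IH exprS; field.
by rewrite expf_neq0// pnatr_eq0.
Qed.

(* Iterating [extrapolation_step] bounds [phi] by the geometric series of the
   l_1 parts, the remainder [4^-n phi_n] being at most [4^-n |e|]. *)
Lemma dominated2_dominated1 (C c : R) phi : 0 < C -> rademacher_lifting V C ->
  0 < c -> (forall e, 0 <= phi e) -> dominated 2 phi c ->
  dominated 1 phi (c * (96 * C ^+ 2)).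
Proof.
(* By homogeneity: [phi / c] is dominated with constant 1. *)
move=> C0 liftV; wlog -> : phi c / c = 1.
  move=> wlog1 c0 phi0 /(dominatedZ (t := c^-1));
    rewrite invr_ge0 ltW// mulVf ?gt_eqF// => /(_ isT).
  move=> /(wlog1 _ _ erefl ltr01)/wrap[e|];
    first by rewrite mulr_ge0// invr_ge0 ltW.
  rewrite mul1r => /(dominatedZ (ltW c0)); congr dominated; apply/funext => e.
  by rewrite mulVKf// gt_eqF.
move=> _ phi0 Dphi; rewrite mul1r.
(* The class that [extrapolation_step] reproduces with the same constant 1; a choice function on it
   is iterated. *)
pose P : set (E -> R) := [set f | (forall e, 0 <= f e) /\ dominated 2 f 1].
have /choice[f fP] (x : {f | P f}) : exists y : (E -> R) * {f | P f},
    [/\ forall e, 0 <= y.1 e, dominated 1 y.1 (48 * C ^+ 2) &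
        forall e, sval x e <= y.1 e + sval y.2 e / 4].
  case: x => g [g0 Dg]; have [p1 [p2 [p10 p20 Dp1 Dp2 gp]]] :=
    extrapolation_step C0 liftV g0 Dg.
  by exists (p1, exist _ p2 (conj p20 Dp2)).
pose Phi n := iter n (fun x => (f x).2)
  (exist _ phi (conj phi0 Dphi) : {f | P f}).
pose psi n := (f (Phi n)).1.
have step n e : phi e <= \sum_(i < n) (4 ^+ i)^-1 * psi i e + (4 ^+ n)^-1 * sval
  (Phi n) e.
  elim: n => [|n IH]; first by rewrite big_ord0 add0r expr0 invr1 mul1r.
  apply: le_trans IH _; rewrite big_ord_recr/= -addrA lerD2l.
  have [_ _ /(_ e)] := fP (Phi n); rewrite -/(psi n) => fle.
  have -> : (4 ^+ n.+1)^-1 * sval (f (Phi n)).2 e =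
    (4 ^+ n)^-1 * (sval (f (Phi n)).2 e / 4).
    by rewrite exprS invfM; ring.
  by rewrite -mulrDr ler_wpM2l// invr_ge0 exprn_ge0.
have psi0 n e : 0 <= psi n e by have [h _ _] := fP (Phi n); exact: h.
have p4 n : 0 <= (4 ^+ n)^-1 :> R by rewrite invr_ge0 exprn_ge0.
apply: (dominated1_series (phi := fun n e => (4 ^+ n)^-1 * psi n e)
  (c := fun n => (4 ^+ n)^-1 * (48 * C ^+ 2))) => // [n||n e|e].
- by apply: dominatedZ => //; case: (fP (Phi n)).
- have C20 : 0 <= 48 * C ^+ 2 by rewrite mulr_ge0// sqr_ge0.
  apply: nsum_le => n; first by rewrite mulr_ge0.
  rewrite lee_fin -mulr_suml sum_pow4.
  (* The geometric series sums to 4/3, rounded up to 2. *)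
  have -> : 96 * C ^+ 2 = 2 * (48 * C ^+ 2) by ring.
  by rewrite ler_wpM2r//; have := p4 n; lra.
- by rewrite mulr_ge0.
apply/lee_addgt0Pr => eps eps0.
have [n ne] : exists n, (4 ^+ n)^-1 * rnorm e <= eps.
  exists (Num.bound (rnorm e / eps)); set n := Num.bound _.
  rewrite mulrC ler_pdivrMr ?exprn_gt0// mulrC -ler_pdivrMr//.
  apply: ltW; apply: (@lt_le_trans _ _ n%:R).
    by apply: archi_boundP; rewrite divr_ge0 ?rnorm_ge0// ltW.
  by rewrite -natrX ler_nat ltnW// ltn_expl.
apply: (@le_trans _ _ (\sum_(i < n) (4 ^+ i)^-1 * psi i e + eps)%:E).
  rewrite lee_fin; apply: le_trans (step n e) _; rewrite lerD2l;
    apply: le_trans ne.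
  rewrite ler_wpM2l//; case: (Phi n) => g [g0 Dg] /=.
  by have := dominated_le_rnorm e (ltn0Sn 1) ler01 g0 Dg; rewrite mul1r.
rewrite EFinD leeD2r//;
  apply: (sum_le_nsum n (u := fun i => (4 ^+ i)^-1 * psi i e)) => i.
by rewrite mulr_ge0.
Qed.

End domination.

(** * Approximation of QN_2 operators *)

Section hilbertian_approximation.
Context {R : realType} {k : scalar_kind}.
Local Notation K := (scalars R k).
Context {E V Z : normedModType K} (B : V -> E -> K^o).
Hypothesis pB : pairing B.

(* [q] is the square of a Hilbertian seminorm; only convex combinations are
   needed, which makes the real and complex cases uniform. *)
Definition quadratic (q : E -> R) : Prop :=
  [/\ forall x, 0 <= q x,
      forall a x, q (a *: x) = modulus a ^+ 2 * q x &
      forall t x y, 0 <= t <= 1 ->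
        q (of_real k (1 - t) *: x + of_real k t *: y) =
        (1 - t) * q x + t * q y - t * (1 - t) * q (x - y)].

Lemma modulus_convex (t : R) (a b : K) :
  modulus (of_real k (1 - t) * a + of_real k t * b) ^+ 2 =
  (1 - t) * modulus a ^+ 2 + t * modulus b ^+ 2 - t * (1 - t) * modulus
    (a - b) ^+ 2.
Proof.
rewrite /modulus /rnorm; case: k a b => /= [a b|[a a'] [b b']].
  rewrite !real_normK ?num_real//; ring.
by rewrite /Normc.normc/= !sqr_sqrtr ?addr_ge0 ?sqr_ge0//; ring.
Qed.

(* A vector u almost minimizing |1 - f(u)|^2 + q(u) is almost the projection
   of the first basis vector onto the graph of x |-> (f(x), x). *)
Lemma remove_functional (T : E -> Z) (f : E -> K) (q : E -> R) (eta : R) :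
  (forall x y, T (x + y) = T x + T y) -> (forall a x, T (a *: x) = a *: T x) ->
  (forall x y, f (x + y) = f x + f y) -> (forall a x, f (a *: x) = a * f x) ->
  quadratic q -> 0 < eta ->
  (forall x, rnorm (T x) ^+ 2 <= modulus (f x) ^+ 2 + q x) ->
  exists z : Z, forall x,
    rnorm (T x - f x *: z) ^+ 2 <= eta * modulus (f x) ^+ 2 + (1 + eta) * q x.
Proof.
move=> TD TZ fD fZ [q0 qZ qC] eta0 Tfq.
have TN x y : T (x - y) = T x - T y by rewrite TD -scaleN1r TZ scaleN1r.
have fN x y : f (x - y) = f x - f y by rewrite fD -scaleN1r fZ mulN1r.
pose h u := modulus (1 - f u) ^+ 2 + q u.
pose D := inf (range h).
have infh : has_inf (range h).
  split; first by exists (h 0), 0.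
  by exists 0 => _ [u _ <-]; rewrite addr_ge0 ?sqr_ge0.
have Dh u : D <= h u by apply: inf_lbound; [case: infh|exists u].
have D0 : 0 <= D.
  by apply: lb_le_inf;
    [case: infh|move=> _ [u _ <-]; rewrite addr_ge0 ?sqr_ge0].
(* Chosen so that [(1 - t)^-1 = 1 + eta]; accordingly [del] is [eta] times the factor [t (1 - t)] by
   which the last inequality is divided. *)
pose t := eta / (1 + eta).
have eta1 : 0 < 1 + eta by rewrite addr_gt0.
have t0 : 0 < t by rewrite divr_gt0.
have t1E : 1 - t = (1 + eta)^-1 by rewrite /t; field; rewrite gt_eqF.
have t1 : 0 < 1 - t by rewrite t1E invr_gt0.
pose del := eta * (t * (1 - t)).
have tt0 : 0 < t * (1 - t) := mulr_gt0 t0 t1.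
have del0 : 0 < del := mulr_gt0 eta0 tt0.
have [_ [u _ <-] hu] := inf_adherent del0 infh.
rewrite -/D in hu.
exists (T u) => x; rewrite -TZ -TN; set c := f x; pose zz := x - c *: u.
apply: (le_trans (Tfq zz)).
pose N := modulus (f zz) ^+ 2 + q zz.
have fzz : f zz = c - c * f u by rewrite fN fZ.
have key : modulus c ^+ 2 * D <=
    (1 - t) * (modulus c ^+ 2 * h u) + t * q x - t * (1 - t) * N.
  (* [w] lies on the segment from [c *: u] to [x] and, after division by [c], competes in the
     infimum [D]. The convexity gain [t (1 - t) N] along this segment is what bounds [N]. *)
  pose w := c *: u + of_real k t *: zz.
  have wE : w = of_real k (1 - t) *: (c *: u) + of_real k t *: x.
    rewrite /w /zz scalerBr of_realD of_realN of_real1 scalerBl scale1r.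
    by rewrite [_ *: x - _]addrC addrA.
  have cfwE : c - f w = of_real k (1 - t) * (c - c * f u) + of_real k t * 0.
    rewrite /w fD !fZ fzz of_realD of_realN of_real1; ring.
  have lhs : modulus c ^+ 2 * D <= modulus (c - f w) ^+ 2 + q w.
    have [c0|c0] := eqVneq c 0.
      by rewrite c0 modulus0 expr0n/= mul0r addr_ge0 ?sqr_ge0.
    apply: le_trans (ler_wpM2l (sqr_ge0 _) (Dh (c^-1 *: w))) _.
    rewrite /h mulrDr -qZ scalerA mulfV// scale1r lerD2r -exprMn -modulusM.
    by rewrite mulrBr mulr1 fZ mulVKf.
  apply: (le_trans lhs); rewrite cfwE modulus_convex wE qC; last by apply/andP;
    split; lra.
  rewrite modulus0 expr0n/= mulr0 addr0.
  have chu : modulus c ^+ 2 * h u = modulus (c - c * f u) ^+ 2 + q (c *: u).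
    by rewrite /h mulrDr qZ -exprMn -modulusM mulrBr mulr1.
  rewrite chu /N fzz subr0.
  have -> : q (c *: u - x) = q zz.
    by rewrite -opprB -scaleN1r qZ modulusN modulus1 expr1n mul1r.
  by rewrite le_eqVlt; apply/orP; left; apply/eqP; ring.
have hu' : h u <= D + del by exact: ltW.
have c20 : 0 <= modulus c ^+ 2 by exact: sqr_ge0.
have key2 : t * (1 - t) * N <= t * q x + del * modulus c ^+ 2.
  have : (1 - t) * (modulus c ^+ 2 * h u) <=
    (1 - t) * (modulus c ^+ 2 * (D + del)).
    by rewrite ler_wpM2l ?ler_wpM2l// ltW.
  have : 0 <= t * (modulus c ^+ 2 * D) := mulr_ge0 (ltW t0) (mulr_ge0 c20 D0).
  have : 0 <= t * (modulus c ^+ 2 * del) :=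
    mulr_ge0 (ltW t0) (mulr_ge0 c20 (ltW del0)).
  lra.
rewrite -(ler_pM2l tt0); apply: (le_trans key2).
rewrite le_eqVlt; apply/orP; left; apply/eqP.
by rewrite /del t1E /t; field; rewrite gt_eqF.
Qed.

Lemma quadraticD p q : quadratic p -> quadratic q ->
  quadratic (fun x => p x + q x).
Proof.
move=> [p0 pZ pC] [q0 qZ qC]; split=> [x|a x|t x y t01];
  first by rewrite addr_ge0.
  by rewrite pZ qZ mulrDr.
by rewrite pC// qC//; ring.
Qed.

Lemma quadraticZ (t : R) q : 0 <= t -> quadratic q ->
  quadratic (fun x => t * q x).
Proof.
move=> t0 [q0 qZ qC]; split=> [x|a x|s x y s01]; first by rewrite mulr_ge0.
  by rewrite qZ mulrCA.
by rewrite qC//; ring.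
Qed.

Lemma quadratic_sum (I : Type) (r : seq I) (q : I -> E -> R) :
  (forall i, quadratic (q i)) -> quadratic (fun x => \sum_(i <- r) q i x).
Proof.
move=> qq; elim: r => [|i r IH].
  have -> : (fun x => \sum_(i <- [::]) q i x) = fun=> 0.
    by apply/funext => x; rewrite big_nil.
  by split=> [//|a x|t x y _]; rewrite !mulr0// addr0 subr0.
have -> : (fun x => \sum_(j <- i :: r) q j x) = fun x =>
  q i x + \sum_(j <- r) q j x.
  by apply/funext => x; rewrite big_cons.
exact: quadraticD.
Qed.

Lemma pairing_modulus_convex v (t : R) x y :
  modulus (B v (of_real k (1 - t) *: x + of_real k t *: y)) ^+ 2 =
  (1 - t) * modulus (B v x) ^+ 2 + t * modulus (B v y) ^+ 2 -
  t * (1 - t) * modulus (B v (x - y)) ^+ 2.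
Proof.
have -> : B v (x - y) = B v x - B v y.
  by rewrite (pairingDr pB) -scaleN1r (pairingZr pB) mulN1r.
by rewrite -modulus_convex (pairingDr pB) !(pairingZr pB).
Qed.

Lemma quadratic_modulus v : quadratic (fun x => modulus (B v x) ^+ 2).
Proof.
split=> [x|a x|t x y _]; first exact: sqr_ge0;
  last exact: pairing_modulus_convex.
by rewrite pairingZr// modulusM exprMn.
Qed.

Lemma power_sum_fin_num m (a : nat -> V) e : (power_sum m a < +oo)%E ->
  power_sum m (fun i => B (a i) e) \is a fin_num.
Proof.
move=> aoo; rewrite ge0_fin_numE ?power_sum_ge0//.
apply: le_lt_trans (power_sum_pairing_le pB _ _ _) _.
by rewrite lte_mul_pinfty// lee_fin exp_rnorm_ge0.
Qed.

Lemma quadratic_power_sum (a : nat -> V) : (power_sum 2 a < +oo)%E ->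
  quadratic (fun e => fine (power_sum 2 (fun i => B (a i) e))).
Proof.
move=> aoo; have fin e := power_sum_fin_num e aoo.
split=> [x|c x|t x y /andP[t0 t1]]; first by rewrite fine_ge0// power_sum_ge0.
  apply: EFin_inj; rewrite EFinM !fineK// -nsumZ; last by move=> i;
    exact: sqr_ge0.
  by apply: eq_nsum => i;
    rewrite -![rnorm _]/(modulus _) pairingZr// modulusM exprMn.
have t1' : 0 <= 1 - t by rewrite subr_ge0.
have ge0 (s : R) e i : 0 <= s -> 0 <= s * rnorm (B (a i) e) ^+ 2.
  by move=> s0; rewrite mulr_ge0// sqr_ge0.
apply/eqP; rewrite eq_sym subr_eq; apply/eqP/EFin_inj.
rewrite !EFinD [in RHS]EFinM ![in LHS]EFinM !fineK//.
rewrite -!nsumZ; try by move=> i; exact: sqr_ge0.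
rewrite -!nsumD; try by move=> i; rewrite ?ge0 ?mulr_ge0 ?sqr_ge0.
  2: by move=> i; exact: exp_rnorm_ge0.
apply: eq_nsum => i; rewrite -![rnorm _]/(modulus _) pairing_modulus_convex.
by ring.
Qed.

(** The coefficients come from [V]. For [V = X] and [E] its dual this is weak-star continuity, which
    makes [F] the adjoint of a finite-rank operator on [X] when [Z] is the dual too
    ([finite_form_adjoint]). *)
Definition finite_form (F : E -> Z) : Prop :=
  exists n (a : 'I_n -> V) (z : 'I_n -> Z), forall e, F e =
    \sum_i B (a i) e *: z i.

Lemma finite_form_add F v z : finite_form F ->
  finite_form (fun e => F e + B v e *: z).
Proof.
move=> [n [a [y Fay]]].
exists n.+1, (fun i => oapp a v (unlift ord0 i)),
  (fun i => oapp y z (unlift ord0 i)) => e.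
rewrite big_ord_recl unlift_none /= addrC Fay; congr (_ + _).
by apply: eq_bigr => i _; rewrite liftK.
Qed.

Lemma finite_form_linear F : finite_form F ->
  (forall x y, F (x + y) = F x + F y) /\ (forall a x, F (a *: x) = a *: F x).
Proof.
move=> [n [a [z FE]]]; split=> [x y|c x]; rewrite !FE.
  by rewrite -big_split; apply: eq_bigr => i _; rewrite pairingDr// scalerDl.
by rewrite scaler_sumr; apply: eq_bigr => i _; rewrite pairingZr// scalerA.
Qed.

(** [remove_functional] takes away the first [n] coordinates of the seminorm one at a time. There
    remain [eta] times the removed part, small by the choice of [eta], and [1 + eta] times a tail,
    small by the choice of [n]. *)
Lemma approx_dominated2 (T : E -> Z) (c eps : R) : linear T ->
  dominated B 2 (fun e => rnorm (T e)) c -> 0 < eps ->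
  exists2 F, finite_form F & dominated B 2 (fun e => rnorm (T e - F e)) eps.
Proof.
move=> lT [a ac aT] eps0.
have T0 : T 0 = 0 by have := lT (-1) 0 0; rewrite scaler0 addr0 scaleN1r addNr.
have TD x y : T (x + y) = T x + T y by have := lT 1 x y; rewrite !scale1r.
have TZ s x : T (s *: x) = s *: T x by have := lT s x 0; rewrite T0 !addr0.
have aoo : (power_sum 2 a < +oo)%E by exact: le_lt_trans ac (ltry _).
pose tl n e := fine (power_sum 2 (fun i => B (a (i + n)%N) e)).
have tloo n : (power_sum 2 (fun i => a (i + n)%N) < +oo)%E.
  apply: le_lt_trans aoo; rewrite {2}/power_sum (nsum_split n) => [|i];
    last exact: sqr_ge0.
  by rewrite leeDr// lee_fin sumr_ge0// => i _; exact: sqr_ge0.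
have tl0 n e : 0 <= tl n e by rewrite fine_ge0// power_sum_ge0.
have tlS n e : tl n e = modulus (B (a n) e) ^+ 2 + tl n.+1 e.
  apply: EFin_inj; rewrite EFinD !fineK ?power_sum_fin_num//.
  rewrite /power_sum (nsum_split 1) => [|i]; last exact: sqr_ge0.
  rewrite big_ord1 add0n; congr (_ + _)%E; apply: eq_nsum => i.
  by rewrite addn1 addSnnS.
have approx n (eta : R) : 0 < eta -> exists2 F, finite_form F & forall e,
    rnorm (T e - F e) ^+ 2 <= eta * \sum_(i < n) modulus (B (a i) e) ^+ 2 +
      (1 + eta) * tl n e.
  elim: n eta => [|n IH] eta eta0.
    exists (fun=> 0); first by exists 0%N, (fun=> 0), (fun=> 0) => e;
      rewrite big_ord0.
    move=> e; rewrite big_ord0 mulr0 add0r subr0.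
    apply: (@le_trans _ _ (tl 0%N e)); last by rewrite ler_peMl// lerDl ltW.
    rewrite -lee_fin fineK ?power_sum_fin_num//; apply: le_trans (aT e) _.
    by rewrite le_eqVlt; apply/orP; left; apply/eqP/eq_nsum => i; rewrite addn0.
  (* The error [th] enters twice, through the induction hypothesis and through the removal; the
     results [th + th^2] and [2 th + th^2] are both at most [eta]. *)
  pose th := Num.min (eta / 4) 1.
  have th0 : 0 < th by rewrite lt_min ltr01 andbT divr_gt0.
  have th1 : th <= 1 by rewrite ge_min lexx orbT.
  have th4 : th <= eta / 4 by rewrite ge_min lexx.
  have [F FF TF] := IH th th0.
  have [FD FZ] := finite_form_linear FF.
  (* The coordinate split off from the tail carries the factor [1 + th] of the induction hypothesis,
     absorbed here into the functional to be removed. *)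
  pose s := Num.sqrt (1 + th).
  have s2 : s ^+ 2 = 1 + th by rewrite sqr_sqrtr// addr_ge0// ltW.
  pose f e : K := of_real k s * B (a n) e.
  have fM e : modulus (f e) ^+ 2 = (1 + th) * modulus (B (a n) e) ^+ 2.
    by rewrite modulusM modulus_of_real exprMn real_normK ?num_real// s2.
  have qq : quadratic (fun e => th * (\sum_(i < n) modulus (B (a i) e) ^+ 2) +
    (1 + th) * tl n.+1 e).
    apply: quadraticD.
      apply: quadraticZ; first exact: ltW.
      by apply: quadratic_sum => i; exact: quadratic_modulus.
    apply: quadraticZ; first by rewrite addr_ge0// ltW.
    exact: quadratic_power_sum.
  have [||||x|z zP] :=
    @remove_functional (fun e => T e - F e) f _ th _ _ _ _ qq th0.
  - by move=> x y; rewrite TD FD opprD addrACA.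
  - by move=> b x; rewrite TZ FZ scalerBr.
  - by move=> x y; rewrite /f pairingDr// mulrDr.
  - by move=> b x; rewrite /f pairingZr// mulrCA.
  - by rewrite fM; have := TF x; rewrite tlS; lra.
  exists (fun e => F e + B (a n) e *: (of_real k s *: z));
    first exact: finite_form_add.
  move=> e; rewrite big_ord_recr/=; set A := \sum_(i < n) _;
    set b := modulus (B (a n) e) ^+ 2.
  have A0 : 0 <= A by apply: sumr_ge0 => i _; exact: sqr_ge0.
  have b0 : 0 <= b by exact: sqr_ge0.
  have := zP e; rewrite fM -/A -/b opprD addrA scalerA [B _ _ * _]mulrC -/(f e).
  move/le_trans; apply; have t0 := tl0 n.+1 e.
  have th2 : th ^+ 2 <= th by rewrite expr2 ler_piMl// ltW.
  have -> : th * ((1 + th) * b) + (1 + th) * (th * A + (1 + th) * tl n.+1 e) =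
    (th + th ^+ 2) * (A + b) + (1 + 2 * th + th ^+ 2) * tl n.+1 e by ring.
  apply: lerD; first by rewrite ler_wpM2r ?addr_ge0//; lra.
  by rewrite ler_wpM2r//; lra.
have eps2 : 0 < eps ^+ 2 / 8 by rewrite divr_gt0 ?exprn_gt0.
have [n tn] := nsum_tail (fun i => exp_rnorm_ge0 2 (a i)) aoo eps2.
have c1 : 0 < 2 * (c ^+ 2 + 1) by rewrite mulr_gt0// ltr_wpDl// sqr_ge0.
pose eta := Num.min 1 (eps ^+ 2 / (2 * (c ^+ 2 + 1))).
have eta0 : 0 < eta by rewrite lt_min ltr01/= divr_gt0// exprn_gt0.
have eta1 : eta <= 1 by rewrite ge_min lexx.
have etac : eta * c ^+ 2 <= eps ^+ 2 / 2.
  apply: (@le_trans _ _ (eta * (c ^+ 2 + 1))).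
    by rewrite ler_wpM2l ?(ltW eta0)// lerDl.
  have : eta <= eps ^+ 2 / (2 * (c ^+ 2 + 1)) by rewrite ge_min lexx orbT.
  by rewrite ler_pdivlMr//; lra.
have [F FF TF] := approx n eta eta0.
exists F => //.
(* Rescaling [a] turns the seminorm bound into a majorant: the squared weight [eta] on the first [n]
   terms costs at most [eps^2 / 2], and the squared weight 4, above [1 + eta], costs at most
   [4 eps^2 / 8] on the tail. *)
pose w i : R := if (i < n)%N then Num.sqrt eta else 2.
have w0 i : 0 <= w i by rewrite /w; case: ifP.
have wlt i : (i < n)%N -> w i ^+ 2 = eta by rewrite /w => ->;
  rewrite sqr_sqrtr ?ltW.
have wge i : w (i + n)%N = 2 by rewrite /w ltnNge leq_addl.
exists (fun i => of_real k (w i) *: a i) => [|e].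
  rewrite /power_sum (nsum_split n) => [|i]; last exact: exp_rnorm_ge0.
  rewrite (eq_nsum (v := fun i => 4 * rnorm (a (i + n)%N) ^+ 2)); last first.
    by move=> i; rewrite rnormZ_modulus modulus_of_real wge exprMn ger0_norm//;
      congr (_ * _); ring.
  rewrite nsumZ; last by move=> i; exact: exp_rnorm_ge0.
  apply: (@le_trans _ _ ((eta * c ^+ 2)%:E + 4%:E * (eps ^+ 2 / 8)%:E)%E).
    apply: leeD; last by rewrite lee_wpmul2l ?lee_fin.
    rewrite lee_fin; under eq_bigr => i _ do
      rewrite rnormZ_modulus modulus_of_real ger0_norm// exprMn wlt//.
    rewrite -mulr_sumr ler_wpM2l ?(ltW eta0)// -lee_fin; apply: le_trans ac.
    by apply: sum_le_nsum => i; exact: exp_rnorm_ge0.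
  by rewrite -EFinM -EFinD lee_fin; lra.
apply: (@le_trans _ _ (eta * \sum_(i < n) modulus (B (a i) e) ^+ 2 + (1 + eta) *
  tl n e)%:E).
  by rewrite lee_fin TF.
rewrite /power_sum (nsum_split n) => [|i]; last exact: exp_modulus_ge0.
rewrite EFinD; apply: leeD.
  rewrite lee_fin mulr_sumr ler_sum// => i _.
  by rewrite -[rnorm _]/(modulus _) pairingZl// modulusM modulus_of_real
    ger0_norm// exprMn wlt.
rewrite (eq_nsum (v := fun i => 4 * rnorm (B (a (i + n)%N) e) ^+ 2));
  last first.
  move=> i; rewrite -![rnorm _]/(modulus _) pairingZl// modulusM modulus_of_real
    wge exprMn ger0_norm//.
  by congr (_ * _); ring.
rewrite nsumZ; last by move=> i; exact: exp_modulus_ge0.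
rewrite EFinM fineK ?power_sum_fin_num// lee_wpmul2r ?nsum_ge0// => [i|].
  exact: exp_modulus_ge0.
by rewrite lee_fin; lra.
Qed.

End hilbertian_approximation.

(** * Operators into spaces of cotype 2 *)

Section bounded_sequences.
Context {R : realType} {k : scalar_kind}.
Local Notation K := (scalars R k).

Definition bounded_seq : {pred nat -> K^o} :=
  fun a => `[< exists M : R, forall i, modulus (a i) <= M >].

(** The vector space l_infinity, to which [mazur_orlicz] is applied with weighted l_m seminorms. *)
Record bseq := BSeq { bseq_fun :> nat -> K^o; _ : bseq_fun \in bounded_seq }.

HB.instance Definition _ := [isSub for bseq_fun].
HB.instance Definition _ := [Choice of bseq by <:].

Lemma bounded_seq_submod : submod_closed bounded_seq.
Proof.
split=> [|a u v /asboolP[M uM] /asboolP[N vN]]; apply/asboolP.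
  by exists 0 => i; rewrite modulus0.
exists (modulus a * M + N) => i; rewrite !fctE.
apply: le_trans (modulusD _ _) _;
  rewrite lerD// modulusM ler_wpM2l ?modulus_ge0//.
Qed.

HB.instance Definition _ :=
  GRing.isSubmodClosed.Build K (nat -> K^o) bounded_seq bounded_seq_submod.
HB.instance Definition _ := [SubChoice_isSubLmodule of bseq by <:].

Lemma bseqP (a : bseq) : exists M : R, forall i, modulus (a i) <= M.
Proof. by case: a => u /= /asboolP. Qed.

Lemma bseq_of (u : nat -> K^o) (M : R) : (forall i, modulus (u i) <= M) ->
  exists a : bseq, forall i, a i = u i.
Proof.
move=> uM; have bu : u \in bounded_seq by apply/asboolP; exists M.
by exists (BSeq bu).
Qed.

Lemma bseqD (a b : bseq) i : (a + b) i = a i + b i. Proof. by []. Qed.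
Lemma bseqZ (t : K) (a : bseq) i : (t *: a) i = t * a i. Proof. by []. Qed.

Lemma bseq_ext (a b : bseq) : (forall i, a i = b i) -> a = b.
Proof. by move=> ab; apply/val_inj/funext. Qed.

Definition cut_seq (n : nat) (u : nat -> K^o) (i : nat) : K^o :=
  if (i < n)%N then u i else 0.

Lemma cut_bseq_subproof n (a : bseq) : cut_seq n a \in bounded_seq.
Proof.
have [M aM] := bseqP a; apply/asboolP; exists M => i; rewrite /cut_seq.
by case: ifP => // _; rewrite modulus0 (le_trans (modulus_ge0 _) (aM 0%N)).
Qed.
Definition cut_bseq n a := BSeq (cut_bseq_subproof n a).

Lemma unit_bseq_subproof (n : nat) :
  (fun i => if i == n then 1 else 0 : K^o) \in bounded_seq.
Proof.
by apply/asboolP; exists 1 => i; case: ifP; rewrite ?modulus1 ?modulus0 ?ler01.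
Qed.
Definition unit_bseq n := BSeq (unit_bseq_subproof n).

Lemma cut_bseqS n (a : bseq) :
  cut_bseq n.+1 a = cut_bseq n a + a n *: unit_bseq n.
Proof.
apply: bseq_ext => i; rewrite bseqD bseqZ /= /cut_seq ltnS leq_eqVlt.
have [->|ni] := eqVneq i n; first by rewrite ltnn add0r mulr1.
by rewrite mulr0 addr0.
Qed.

Lemma cut_bseq0 (a : bseq) : cut_bseq 0 a = 0.
Proof. by apply: bseq_ext. Qed.

Lemma real_linear_cut (f : bseq -> R) n a : real_linear f ->
  f (cut_bseq n a) = \sum_(i < n) f (a i *: unit_bseq i).
Proof.
move=> [fD fZ]; elim: n => [|n IH].
  by rewrite cut_bseq0 big_ord0; have := fZ 0 0; rewrite scaler0 mul0r.
by rewrite cut_bseqS fD IH big_ord_recr.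
Qed.

End bounded_sequences.
Arguments bseq R k : clear implicits.

Section lp_norm.
Context {R : realType}.
Implicit Types u v : nat -> R.

(* Meaningful when [u] is nonnegative and its [m]-th powers are summable. *)
Definition lp_norm (m : nat) u : R :=
  fine (nsum (fun i => u i ^+ m)) `^ m%:R^-1.

Lemma nsum_Lnorm m u : (0 < m)%N -> (forall i, 0 <= u i) ->
  Lnorm counting (m%:R%:E)%E (EFin \o u) =
    (nsum (fun i => u i ^+ m)%R `^ m%:R^-1)%E.
Proof.
move=> m0 u0; rewrite Lnorm_counting ?ltr0n//; congr (_ `^ _)%E.
by apply: eq_eseriesr => i _; rewrite /= ger0_norm// powR_mulrn.
Qed.

Lemma lp_normE m u : (0 < m)%N -> (forall i, 0 <= u i) ->
  (nsum (fun i => u i ^+ m)%R < +oo)%E ->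
  Lnorm counting (m%:R%:E)%E (EFin \o u) = (lp_norm m u)%:E.
Proof.
move=> m0 u0 uoo; rewrite nsum_Lnorm// /lp_norm.
rewrite -[X in (X `^ _)%E]fineK ?poweR_EFin// ge0_fin_numE// nsum_ge0// => i.
exact: exprn_ge0.
Qed.

Lemma lp_normD m u v : (0 < m)%N -> (forall i, 0 <= u i) ->
  (forall i, 0 <= v i) ->
  (nsum (fun i => u i ^+ m)%R < +oo)%E ->
    (nsum (fun i => v i ^+ m)%R < +oo)%E ->
  (nsum (fun i => (u i + v i) ^+ m)%R < +oo)%E ->
  lp_norm m (fun i => u i + v i) <= lp_norm m u + lp_norm m v.
Proof.
move=> m0 u0 v0 uoo voo uvoo; have uv0 i : 0 <= u i + v i by rewrite addr_ge0.
have e1 := lp_normE m0 uv0 uvoo; have e2 := lp_normE m0 u0 uoo.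
have e3 := lp_normE m0 v0 voo.
have m1 : 1 <= m%:R :> R by rewrite ler1n.
have mf (w : nat -> R) : measurable_fun setT w by [].
have := minkowski_EFin counting (mf u) (mf v) m1.
rewrite e2 e3 -EFinD [X in (X <= _)%E -> _]e1.
by rewrite lee_fin.
Qed.

Lemma le_lp_norm m u v : (forall i, 0 <= u i <= v i) ->
  (nsum (fun i => v i ^+ m)%R < +oo)%E -> lp_norm m u <= lp_norm m v.
Proof.
move=> uv voo.
have uvm : (nsum (fun i => u i ^+ m)%R <= nsum (fun i => v i ^+ m)%R)%E.
  apply: le_nsum => i; case/andP: (uv i) => u0 uvi; rewrite exprn_ge0//=.
  by rewrite lerXn2r ?nnegrE// (le_trans u0).
have u0 : (0 <= nsum (fun i => u i ^+ m)%R)%E.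
  by apply: nsum_ge0 => i; rewrite exprn_ge0//; case/andP: (uv i).
rewrite /lp_norm ge0_ler_powR ?invr_ge0// ?nnegrE ?fine_ge0// ?(le_trans u0)//.
by apply: fine_le => //;
  rewrite ge0_fin_numE// ?(le_trans u0 uvm)// (le_lt_trans uvm).
Qed.

Lemma lp_normZ m (t : R) u : (0 < m)%N -> 0 <= t -> (forall i, 0 <= u i) ->
  (nsum (fun i => u i ^+ m)%R < +oo)%E ->
  lp_norm m (fun i => t * u i) = t * lp_norm m u.
Proof.
move=> m0 t0 u0 uoo; rewrite /lp_norm.
rewrite (eq_nsum (v := fun i => t ^+ m * u i ^+ m)); last by move=> i;
  rewrite exprMn.
rewrite nsumZ => [|i]; last exact: exprn_ge0.
have s0 : (0 <= nsum (fun i => u i ^+ m)%R)%E by apply: nsum_ge0 => i;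
  exact: exprn_ge0.
rewrite fineM// ?ge0_fin_numE//= powRM ?exprn_ge0 ?fine_ge0//.
by rewrite -powR_mulrn// -powRrM mulfV ?powRr1// pnatr_eq0 -lt0n.
Qed.

Lemma le_lp_norm_root m (y c S : R) : (0 < m)%N -> 0 <= y -> 0 <= c -> 0 <= S ->
  y ^+ m <= c ^+ m * S -> y <= c * S `^ m%:R^-1.
Proof.
move=> m0 y0 c0 S0 h; rewrite -(@ler_pXn2r _ m)// ?nnegrE ?mulr_ge0 ?powR_ge0//.
rewrite exprMn -[(_ `^ _) ^+ m]powR_mulrn ?powR_ge0// -powRrM mulVf ?powRr1//.
by rewrite pnatr_eq0 -lt0n.
Qed.

Lemma lp_norm_le m u (d : R) : (0 < m)%N -> (forall i, 0 <= u i) -> 0 <= d ->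
  (nsum (fun i => u i ^+ m)%R <= (d ^+ m)%:E)%E -> lp_norm m u <= d.
Proof.
move=> m0 u0 d0 ud; have s0 : (0 <= nsum (fun i => u i ^+ m)%R)%E.
  by apply: nsum_ge0 => i; exact: exprn_ge0.
have sfin : nsum (fun i => u i ^+ m)%R \is a fin_num.
  by rewrite ge0_fin_numE// (le_lt_trans ud)// ltry.
have -> : d = (d ^+ m) `^ m%:R^-1.
  by rewrite -powR_mulrn// -powRrM mulfV ?powRr1// pnatr_eq0 -lt0n.
rewrite ge0_ler_powR ?invr_ge0// ?nnegrE ?fine_ge0 ?exprn_ge0//.
by rewrite -lee_fin fineK.
Qed.

End lp_norm.

Section cotype_target.
Context {R : realType} {k : scalar_kind}.
Local Notation K := (scalars R k).
Context {E V Z : normedModType K} (B : V -> E -> K^o).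
Hypothesis pB : pairing B.

Lemma sign_avg_nsum n (F : {ffun 'I_n -> bool} -> nat -> R) :
  (forall e i, 0 <= F e i) ->
  (nsum (fun i => sign_avg (F^~ i)) = (2 ^+ n)^-1%:E * \sum_e nsum (F e))%E.
Proof.
move=> F0; rewrite /nsum -nneseries_sum => [|e i _]; last by rewrite lee_fin.
rewrite -nneseriesZl => [|i _]; last by apply: sume_ge0 => e _; rewrite lee_fin.
by apply: eq_eseriesr => i _; rewrite sumEFin -EFinM.
Qed.

(** Cotype 2 passes from the square sum of the [T (x i)] to a second moment of [T] on sign sums. Its
    power [2 ^ l] is at most a moment of order [2 ^ l.+1], where the domination of [T] applies
    inside the average; Khintchine then bounds each scalar sign sum. This is the convexity
    inequality behind Maurey's factorization. *)
Lemma cotype2_moment (C : R) (l n : nat) (T : E -> Z) (v : nat -> V)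
  (x : 'I_n -> E) :
  0 <= C ->
  l2 (fun i => rnorm (T (x i))) <= C * sign_l2 (sign_sum (fun i => T (x i))) ->
  (forall a y, T (a *: y) = a *: T y) -> (forall y z, T (y + z) = T y + T z) ->
  (forall e, ((rnorm (T e) ^+ (2 ^ l.+1))%:E <= power_sum (2 ^ l.+1)
    (fun i => B (v i) e))%E) ->
  (((\sum_i rnorm (T (x i)) ^+ 2) ^+ (2 ^ l))%:E <=
   ((C ^+ 2 * khintchine_const l) ^+ (2 ^ l))%:E *
   nsum (fun j => (\sum_i modulus (B (v j) (x i)) ^+ 2) ^+ (2 ^ l))%R)%E.
Proof.
move=> C0 cot TZ TD Tv; set m := (2 ^ l)%N.
have T0 : T 0 = 0 by have := TZ 0 0; rewrite !scale0r.
have TS e : sign_sum (fun i => T (x i)) e = T (sign_sum x e).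
  by rewrite /sign_sum (big_morph T TD T0); apply: eq_bigr => i _; rewrite TZ.
have sq2 : \sum_i rnorm (T (x i)) ^+ 2 <= C ^+ 2 * sign_avg
  (fun e => rnorm (T (sign_sum x e)) ^+ 2).
  rewrite -[leLHS]l2_sqr.
  have -> : C ^+ 2 * sign_avg (fun e => rnorm (T (sign_sum x e)) ^+ 2) =
      (C * sign_l2 (sign_sum (fun i => T (x i)))) ^+ 2.
    rewrite exprMn sign_l2_sqr; congr (_ * sign_avg _).
    by apply/funext => e; rewrite TS.
  by rewrite lerXn2r ?nnegrE ?mulr_ge0 ?l2_ge0 ?sign_l2_ge0.
have m1 : (\sum_i rnorm (T (x i)) ^+ 2) ^+ m <=
    (C ^+ 2) ^+ m * sign_avg (fun e => rnorm (T (sign_sum x e)) ^+ (2 ^ l.+1)).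
  apply: (@le_trans _ _
    ((C ^+ 2 * sign_avg (fun e => rnorm (T (sign_sum x e)) ^+ 2)) ^+ m)).
    rewrite lerXn2r// nnegrE; first by apply: sumr_ge0 => i _; exact: sqr_ge0.
    by apply: mulr_ge0;
      [exact: sqr_ge0|apply: sign_avg_ge0 => e; exact: sqr_ge0].
  rewrite exprMn ler_wpM2l ?exprn_ge0 ?sqr_ge0//.
  apply: le_trans (sign_avg_pow l _) _ => [e|]; first exact: sqr_ge0.
  by apply: le_sign_avg => e; rewrite expnS exprM.
apply: (@le_trans _ _ (((C ^+ 2) ^+ m)%:E *
    nsum (fun j => sign_avg
      (fun e => modulus (B (v j) (sign_sum x e)) ^+ (2 ^ l.+1)))%R)%E).
  rewrite (sign_avg_nsum
    (F := fun e j => modulus (B (v j) (sign_sum x e)) ^+ (2 ^ l.+1)));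
    last first.
    by move=> e j; exact: exp_modulus_ge0.
  apply: le_trans (_ : ((C ^+ 2) ^+ m * sign_avg
    (fun e => rnorm (T (sign_sum x e)) ^+ (2 ^ l.+1)))%:E <= _)%E.
    by rewrite lee_fin.
  rewrite EFinM lee_wpmul2l ?lee_fin ?exprn_ge0 ?sqr_ge0//.
  rewrite /sign_avg EFinM lee_wpmul2l ?lee_fin ?invr_ge0 ?exprn_ge0//.
  by rewrite -sumEFin; apply: lee_sum => e _; exact: Tv.
rewrite [(C ^+ 2 * _) ^+ m]exprMn EFinM -muleA lee_wpmul2l ?lee_fin ?exprn_ge0
  ?sqr_ge0//.
rewrite -nsumZ => [|j]; last by rewrite exprn_ge0// sumr_ge0// => i _;
  exact: sqr_ge0.
apply: le_nsum => j; rewrite sign_avg_ge0 => [|e]; last exact: exp_modulus_ge0.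
rewrite -exprMn /=.
have BS e : B (v j) (sign_sum x e) = sign_sum (fun i => B (v j) (x i)) e.
  by rewrite /sign_sum (pairing_sumr pB); apply: eq_bigr => i _;
    rewrite (pairingZr pB).
under [X in sign_avg X <= _]eq_fun do rewrite BS.
exact: khintchine.
Qed.

(** By [cotype2_moment] a weighted l_m seminorm on l_infinity dominates the cone generated by the
    pairs of [(|B (f i) y|^2)_i] and [|T y|^2]. The separating functional, read on the unit
    sequences, provides summable weights [lam i] for which [|T e|^2] is at most the sum of the
    [lam_i |B (f i) e|^2]. *)
Lemma cotype2_dominated2 (l : nat) (T : E -> Z) (c : R) :
  cotype2 Z -> linear T ->
  dominated B (2 ^ l.+1) (fun e => rnorm (T e)) c ->
  exists d : R, dominated B 2 (fun e => rnorm (T e)) d.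
Proof.
move=> /cotype2_pos[C C0 cotZ] lT [v vc vT].
have T0 : T 0 = 0 by have := lT (-1) 0 0; rewrite scaler0 addr0 scaleN1r addNr.
have TD x y : T (x + y) = T x + T y by have := lT 1 x y; rewrite !scale1r.
have TZ s x : T (s *: x) = s *: T x by have := lT s x 0; rewrite T0 !addr0.
set m := (2 ^ l)%N; have m0 : (0 < m)%N by rewrite expn_gt0.
pose t i := rnorm (v i); have t0 i : 0 <= t i by exact: rnorm_ge0.
(* Normalized so that [B (f i) e] is a bounded sequence; the size of [v i] moves into the weight
   [t i ^+ 2]. *)
pose f i := of_real k (t i)^-1 *: v i.
have vf i : v i = of_real k (t i) *: f i.
  rewrite /f scalerA -of_realM; have [ti0|ti0] := eqVneq (t i) 0.
    by rewrite ti0 mul0r of_real0 scale0r; exact: rnorm0_eq0.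
  by rewrite mulfV// of_real1 scale1r.
have f1 i : rnorm (f i) <= 1.
  rewrite rnormZ_modulus modulus_of_real ger0_norm ?invr_ge0// -/(t i).
  by have [->|ti0] := eqVneq (t i) 0; rewrite ?mulr0 ?ler01// mulVf.
have fe i e : modulus (B (f i) e) <= rnorm e.
  by apply: le_trans (pairing_le pB _ _) _; rewrite ler_piMl ?rnorm_ge0.
have vfe i e : modulus (B (v i) e) ^+ 2 = t i ^+ 2 * modulus (B (f i) e) ^+ 2.
  by rewrite {1}vf (pairingZl pB) modulusM modulus_of_real ger0_norm// exprMn.
pose W := bseq R k.
pose wt (a : W) i := t i ^+ 2 * modulus (a i).
have wt0 a i : 0 <= wt a i by rewrite mulr_ge0 ?sqr_ge0 ?modulus_ge0.
have uoo (u : nat -> R) M : (forall i, 0 <= u i <= M) ->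
    (nsum (fun i => (t i ^+ 2 * u i) ^+ m)%R < +oo)%E.
  move=> uM; have u0 i : 0 <= u i by case/andP: (uM i).
  have M0 : 0 <= M by case/andP: (uM 0%N); exact: le_trans.
  apply: (@le_lt_trans _ _ (nsum (fun i => M ^+ m * t i ^+ (2 ^ l.+1))%R)).
    apply: le_nsum => i;
      rewrite exprn_ge0 ?mulr_ge0 ?sqr_ge0//= exprMn -exprM -expnS mulrC.
    by rewrite ler_wpM2r ?exprn_ge0// lerXn2r ?nnegrE//; case/andP: (uM i).
  rewrite nsumZ => [|i]; last exact: exprn_ge0.
  rewrite lte_mul_pinfty ?lee_fin ?exprn_ge0//.
  exact: le_lt_trans vc (ltry _).
have wtoo a : (nsum (fun i => wt a i ^+ m)%R < +oo)%E.
  by have [M aM] := bseqP a; apply: (uoo _ M) => i; rewrite modulus_ge0/=.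
pose K0 := C ^+ 2 * khintchine_const l.
have K00 : 0 <= K0 by rewrite mulr_ge0 ?sqr_ge0 ?khintchine_const_ge0.
pose p (a : W) := K0 * lp_norm m (wt a).
have sp : sublinear (k := k) p.
  split=> [a b|s a s0].
    rewrite -mulrDr ler_wpM2l//.
    have le_wt i : wt (a + b) i <= wt a i + wt b i.
      by rewrite -mulrDr ler_wpM2l ?sqr_ge0// bseqD modulusD.
    have sumoo : (nsum (fun i => (wt a i + wt b i) ^+ m)%R < +oo)%E.
      have [M aM] := bseqP a; have [N bN] := bseqP b.
      have -> : (fun i => (wt a i + wt b i) ^+ m) =
          (fun i => (t i ^+ 2 * (modulus (a i) + modulus (b i))) ^+ m).
        by apply/funext => i; rewrite mulrDr.
      by apply: (uoo _ (M + N)) => i; rewrite addr_ge0 ?modulus_ge0//= lerD.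
    apply: le_trans (lp_normD m0 (wt0 a) (wt0 b) (wtoo a) (wtoo b) sumoo).
    by apply: le_lp_norm => // i; rewrite wt0/=.
  rewrite /p mulrCA ler_wpM2l// -lp_normZ//.
  have -> // : wt (of_real k s *: a) = fun i => s * wt a i.
  apply/funext => i; rewrite /wt bseqZ modulusM modulus_of_real ger0_norm//;
    ring.
pose S : set (W * R) := [set u : W * R | exists x : seq E,
  (forall i, u.1 i = of_real k (\sum_(y <- x) modulus (B (f i) y) ^+ 2)) /\
  u.2 = \sum_(y <- x) rnorm (T y) ^+ 2].
have exS (x : seq E) : exists a : W, forall i, a i =
  of_real k (\sum_(y <- x) modulus (B (f i) y) ^+ 2).
  apply: (bseq_of (M := \sum_(y <- x) rnorm y ^+ 2)) => i.
  rewrite modulus_of_real ger0_norm ?sumr_ge0// => [|y _]; last exact: sqr_ge0.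
  by apply: ler_sum => y _; rewrite lerXn2r ?nnegrE ?modulus_ge0 ?rnorm_ge0.
have pS : dominated_cone (k := k) p S.
  split.
  - have [a aE] := exS [::]; exists (a, 0), [::]; split=> //.
    by rewrite big_nil.
  - move=> [a r] [b s] [x [/= ax ->]] [y [/= bx ->]]; exists (x ++ y);
      split=> [i|] /=.
      by rewrite -[LHS]/(a i + b i) ax bx big_cat/= of_realD.
    by rewrite big_cat.
  - move=> s [a r] s0 [x [/= ax ->]];
      exists [seq of_real k (Num.sqrt s) *: y | y <- x].
    split=> [i|] /=.
      rewrite -[LHS]/(of_real k s * a i) ax -of_realM big_map mulr_sumr;
        congr of_real; apply: eq_bigr => y _.
      by rewrite (pairingZr pB) modulusM modulus_of_real ger0_norm ?sqrtr_ge0//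
        exprMn sqr_sqrtr.
    rewrite big_map mulr_sumr; apply: eq_bigr => y _.
    by rewrite TZ rnormZ_modulus modulus_of_real ger0_norm ?sqrtr_ge0// exprMn
      sqr_sqrtr.
  - move=> [a r] [x [/= ax ->]].
    apply: le_lp_norm_root => //.
    + by apply: sumr_ge0 => y _; exact: sqr_ge0.
    + by rewrite fine_ge0// nsum_ge0// => i; exact: exprn_ge0.
    rewrite -lee_fin EFinM fineK; last first.
      by rewrite ge0_fin_numE ?wtoo// nsum_ge0// => i; exact: exprn_ge0.
    rewrite (big_nth 0) big_mkord.
    apply: le_trans (cotype2_moment (ltW C0) (cotZ _ _) TZ TD vT) _.
    rewrite lee_wpmul2l ?lee_fin ?exprn_ge0// le_eqVlt; apply/orP; left;
      apply/eqP.
    apply: eq_nsum => i; congr (_ ^+ _).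
    rewrite /wt ax modulus_of_real ger0_norm ?sumr_ge0// => [|y _];
      last exact: sqr_ge0.
    rewrite mulr_sumr [RHS](big_nth 0) big_mkord; apply: eq_bigr => j _.
    by rewrite vfe.
have [g [lg gp gS]] := mazur_orlicz sp pS.
(* [g] may be negative on some unit sequences; replacing these values by 0 keeps the lower bound,
   since the sequences of the cone are nonnegative. *)
pose lam i := Num.max (g (unit_bseq i)) 0.
have lam0 i : 0 <= lam i by rewrite le_max lexx orbT.
have g0 : g 0 = 0 by have := lg.2 0 0; rewrite scaler0 mul0r.
have [one oneE] : exists a : W, forall i, a i = 1.
  by apply: (bseq_of (M := 1)) => i; rewrite modulus1.
pose L := p one.
have lamL : (nsum lam <= L%:E)%E.
  apply: nsum_le => // n; rewrite lee_fin.
  (* Indicator of the indices where [g] is positive: on its truncation [g] equals the partial sum of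
     [lam], and [p one] bounds it. *)
  have [b bE] : exists b : W, forall i, b i =
    if 0 < g (unit_bseq i) then 1 else 0.
    by apply: (bseq_of (M := 1)) => i; case: ifP;
      rewrite ?modulus1 ?modulus0 ?ler01.
  have -> : \sum_(i < n) lam i = g (cut_bseq n b).
    rewrite real_linear_cut//; apply: eq_bigr => i _; rewrite bE /lam.
    by case: ltP => gi; rewrite ?scale1r ?scale0r ?g0.
  apply: le_trans (gp _) _; apply: (ler_wpM2l K00).
  apply: le_lp_norm => [i|]; last exact: wtoo.
  rewrite wt0/= ler_wpM2l ?sqr_ge0// oneE modulus1 /= /cut_seq bE.
  by case: ifP => _; [case: ifP => _|]; rewrite ?modulus1 ?modulus0 ?ler01.
have L0 : 0 <= L by rewrite mulr_ge0// powR_ge0.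
exists (Num.sqrt L), (fun i => of_real k (Num.sqrt (lam i)) *: f i) => [|e].
  rewrite sqr_sqrtr//; apply: le_trans lamL; apply: le_nsum => i.
  rewrite exp_rnorm_ge0 rnormZ_modulus modulus_of_real ger0_norm ?sqrtr_ge0//
    exprMn sqr_sqrtr//=.
  by rewrite ler_piMr// expr_le1// rnorm_ge0.
have -> : power_sum 2 (fun i => B (of_real k (Num.sqrt (lam i)) *: f i) e) =
    nsum (fun i => lam i * modulus (B (f i) e) ^+ 2).
  apply: eq_nsum => i;
    rewrite -[rnorm _]/(modulus _) (pairingZl pB) modulusM modulus_of_real.
  by rewrite ger0_norm ?sqrtr_ge0// exprMn sqr_sqrtr.
apply/lee_addgt0Pr => eps eps0.
have [a aE] := exS [:: e].
have gT : rnorm (T e) ^+ 2 <= g a.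
  by apply: (gS (a, _)); exists [:: e]; split=> //; rewrite big_seq1.
pose d := eps / (K0 + 1); have d0 : 0 < d by rewrite divr_gt0// ltr_wpDl.
(* A functional on l_infinity is not determined by its values on unit sequences; the tail is
   controlled by [g <= p], as [p] is small on tails. *)
have [n tn] := nsum_tail (fun i => exprn_ge0 m (wt0 a i)) (wtoo a)
  (exprn_gt0 m d0).
have tailE : (nsum (fun i => wt (a - cut_bseq n a) i ^+ m)%R <= (d ^+ m)%:E)%E.
  rewrite (nsum_split n) => [|i]; last exact: exprn_ge0.
  rewrite big1 ?add0e => [|i _]; last first.
    rewrite /wt -[(a - _) _]/(a i - cut_seq n a i) /cut_seq ltn_ord subrr
      modulus0 mulr0.
    by rewrite expr0n eqn0Ngt m0.
  apply: le_trans tn; rewrite le_eqVlt; apply/orP; left; apply/eqP/eq_nsum => i.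
  by rewrite /wt -[(a - _) _]/(a (i + n)%N - cut_seq n a (i + n)%N) /cut_seq
    ltnNge leq_addl subr0.
have p_le : p (a - cut_bseq n a) <= eps.
  apply: (@le_trans _ _ (K0 * d));
    first by rewrite ler_wpM2l// lp_norm_le// ltW.
  by rewrite /d mulrCA ler_piMr ?(ltW eps0)// ler_pdivrMr ?mul1r ?ltr_wpDl//
    lerDl.
have ga : g a <= \sum_(i < n) lam i * modulus (B (f i) e) ^+ 2 + eps.
  have -> : a = cut_bseq n a + (a - cut_bseq n a) by rewrite addrC subrK.
  rewrite lg.1 lerD//; last by apply: le_trans p_le; exact: gp.
  rewrite real_linear_cut// ler_sum// => i _.
  rewrite aE lg.2 big_seq1 mulrC ler_wpM2r ?exp_modulus_ge0//.
  by rewrite le_max lexx.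
apply: (@le_trans _ _ (\sum_(i < n) lam i * modulus (B (f i) e) ^+ 2 + eps)%:E).
  by rewrite lee_fin (le_trans gT).
rewrite EFinD leeD2r//.
apply: (sum_le_nsum n (u := fun i => lam i * modulus (B (f i) e) ^+ 2)) => i.
by rewrite mulr_ge0 ?exp_modulus_ge0.
Qed.

End cotype_target.

(** * Real powers and change of exponent *)

Section reweighting.
Context {R : realType}.

(** The graph of [x^r] lies above its tangent at [a]: Young's inequality with exponents [r] and
    [r / (r - 1)]. *)
Lemma powR_tangent (r a x : R) : 1 <= r -> 0 <= a -> 0 <= x ->
  r * a `^ (r - 1) * x <= x `^ r + (r - 1) * a `^ r.
Proof.
move=> r1 a0 x0; have [->|rn1] := eqVneq r 1.
  by rewrite subrr mul0r addr0 powRr0 !mul1r powRr1.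
have r1' : 1 < r by rewrite lt_neqAle eq_sym rn1.
have r0 : 0 < r by lra.
have q0 : 0 < r / (r - 1) by rewrite divr_gt0// subr_gt0.
have := @conjugate_powR _ x (a `^ (r - 1)) r (r / (r - 1)) x0
  (powR_ge0 _ _) r0 q0 _.
have -> : r^-1 + (r / (r - 1))^-1 = 1 by field; rewrite subr_eq0 rn1 gt_eqF.
move=> /(_ erefl); rewrite -powRrM.
have -> : (r - 1) * (r / (r - 1)) = r by field; rewrite subr_eq0 rn1.
rewrite -(ler_pM2l r0) mulrDr => h.
have -> : r * a `^ (r - 1) * x = r * (x * a `^ (r - 1)) by ring.
apply: le_trans h _; rewrite le_eqVlt; apply/orP; left; apply/eqP.
by field; rewrite subr_eq0 rn1 gt_eqF.
Qed.

Lemma powRrK (x p : R) : 0 < p -> 0 <= x -> (x `^ p) `^ p^-1 = x.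
Proof. by move=> p0 x0; rewrite -powRrM mulfV ?gt_eqF// powRr1. Qed.

Lemma powRVrK (x p : R) : 0 < p -> 0 <= x -> (x `^ p^-1) `^ p = x.
Proof. by move=> p0 x0; rewrite -powRrM mulVf ?gt_eqF// powRr1. Qed.

Lemma poweR_inv_le (x : \bar R) (p s : R) : 0 < p -> 0 <= s -> (0 <= x)%E ->
  (x `^ p^-1 <= s%:E)%E = (x <= (s `^ p)%:E)%E.
Proof.
move=> p0 s0; have pV : p^-1 != 0 by rewrite invr_eq0 gt_eqF.
case: x => [x||] //= x0; last by rewrite (negbTE pV) !leye_eq.
rewrite lee_fin in x0; rewrite !lee_fin; apply/idP/idP => h.
  by rewrite -[x](powRVrK p0)// ge0_ler_powR ?(ltW p0)// nnegrE powR_ge0.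
by rewrite -[s](powRrK p0)// ge0_ler_powR ?invr_ge0 ?(ltW p0)// nnegrE powR_ge0.
Qed.

Lemma poweR_inv_ge (x : \bar R) (p s : R) : 0 < p -> 0 <= s -> (0 <= x)%E ->
  (s%:E <= x `^ p^-1)%E = ((s `^ p)%:E <= x)%E.
Proof.
move=> p0 s0; have pV : p^-1 != 0 by rewrite invr_eq0 gt_eqF.
case: x => [x||] //= x0; last by rewrite (negbTE pV) !leey.
rewrite lee_fin in x0; rewrite !lee_fin; apply/idP/idP => h.
  by rewrite -[x](powRVrK p0)// ge0_ler_powR ?(ltW p0)// nnegrE powR_ge0.
by rewrite -[s](powRrK p0)// ge0_ler_powR ?invr_ge0 ?(ltW p0)// nnegrE powR_ge0.
Qed.

End reweighting.

(** * Quasi p-nuclear operators *)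

Section strong_norms.
Context {R : realType} {k : scalar_kind}.
Local Notation K := (scalars R k).

Definition powR_sum (W : normedModType K) (p : R) (w : nat -> W) : \bar R :=
  nsum (fun i => rnorm (w i) `^ p).

Lemma powR_sum_ge0 (W : normedModType K) (p : R) (w : nat -> W) :
  (0 <= powR_sum p w)%E.
Proof. by apply: nsum_ge0 => i; exact: powR_ge0. Qed.

Lemma strong_norm_le (W : normedModType K) (p s : R) (w : nat -> W) :
  0 < p -> 0 <= s ->
  (strong_norm p w <= s%:E)%E = (powR_sum p w <= (s `^ p)%:E)%E.
Proof. by move=> p0 s0; exact: (poweR_inv_le p0 s0 (powR_sum_ge0 p w)). Qed.

Lemma le_strong_norm (W : normedModType K) (p s : R) (w : nat -> W) :
  0 < p -> 0 <= s ->
  (s%:E <= strong_norm p w)%E = ((s `^ p)%:E <= powR_sum p w)%E.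
Proof. by move=> p0 s0; exact: (poweR_inv_ge p0 s0 (powR_sum_ge0 p w)). Qed.

Lemma powR_sum_nat (W : normedModType K) (m : nat) (w : nat -> W) :
  powR_sum m%:R w = power_sum m w.
Proof. by apply: eq_nsum => i; rewrite powR_mulrn// rnorm_ge0. Qed.

Context {E V : normedModType K} (B : V -> E -> K^o).
Hypothesis pB : pairing B.

Lemma powR_sum_pairing_le p (v : nat -> V) e : 0 <= p ->
  (powR_sum p (fun i => B (v i) e) <= (rnorm e `^ p)%:E * powR_sum p v)%E.
Proof.
move=> p0; rewrite /powR_sum -nsumZ => [|i]; last exact: powR_ge0.
apply: le_nsum => i; rewrite powR_ge0/= -powRM ?rnorm_ge0// mulrC.
by rewrite ge0_ler_powR// ?nnegrE ?mulr_ge0 ?rnorm_ge0// pairing_le.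
Qed.

(* Jensen's inequality for the weights |v_i|^p, absorbed in the new sequence. *)
Lemma powR_sum_reweight (p q s : R) (v : nat -> V) :
  1 <= p -> p <= q -> 0 < s ->
  (powR_sum p v <= (s `^ p)%:E)%E ->
  exists2 y : nat -> V, (powR_sum q y <= (s `^ q)%:E)%E &
    forall e c, 0 <= c -> ((c `^ p)%:E <= powR_sum p (fun i => B (v i) e))%E ->
      ((c `^ q)%:E <= powR_sum q (fun i => B (y i) e))%E.
Proof.
move=> p1 pq s0 vs.
have p0 : 0 < p by lra.
have q0 : 0 < q by lra.
pose r := q / p; have r1 : 1 <= r by rewrite ler_pdivlMr// mul1r.
have prq : p * r = q by rewrite /r mulrCA mulfV ?mulr1// gt_eqF.
pose t i := rnorm (v i); have t0 i : 0 <= t i by exact: rnorm_ge0.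
have sp0 : 0 < s `^ p by exact: powR_gt0.
pose al i := t i `^ p / s `^ p.
have al0 i : 0 <= al i by rewrite divr_ge0// ?powR_ge0.
have al_sum : (nsum al <= 1%:E)%E.
  rewrite (eq_nsum (v := fun i => (s `^ p)^-1 * t i `^ p)); last by move=> i;
    rewrite mulrC.
  rewrite nsumZ => [|i]; last exact: powR_ge0.
  by rewrite muleC lee_pdivrMr// mul1e.
(* Where [al i] is nonzero this exponent makes [|B (y i) e|^q] equal to [al_i] times the power [r]
   of [|B (v i) e|^p / al_i], the summand of Jensen's inequality. *)
pose y i := of_real k (al i `^ ((1 - r) / q)) *: v i.
have yE (x : R) i : 0 <= x -> (al i `^ ((1 - r) / q) * x) `^ q =
  al i `^ (1 - r) * x `^ q.
  by move=> x0; rewrite powRM ?powR_ge0// -powRrM divfK// gt_eqF.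
exists y.
  apply: (@le_trans _ _ (nsum (fun i => s `^ q * al i))); last first.
    rewrite nsumZ// -[leRHS]mule1 lee_wpmul2l// lee_fin powR_ge0//.
  apply: le_nsum => i;
    rewrite powR_ge0/= /y rnormZ_modulus modulus_of_real ger0_norm ?powR_ge0//
    yE ?rnorm_ge0//.
  have [ti0|ti0] := eqVneq (t i) 0.
    by rewrite -/(t i) ti0 powR0 ?gt_eqF// mulr0 mulr_ge0// powR_ge0.
  have ai : al i != 0 by rewrite mulf_neq0 ?invr_eq0 ?powR_eq0 ?negb_and ?ti0
    ?gt_eqF.
  have -> : rnorm (v i) `^ q = al i `^ r * s `^ q.
    by rewrite -/(t i) -prq [in LHS]powRrM
      [s `^ _]powRrM -powRM ?powR_ge0// /al divfK// gt_eqF.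
  rewrite mulrA -powRD; last by rewrite ai implybT.
  by rewrite subrK powRr1// mulrC.
move=> e c c0 cA.
set A := powR_sum p _ in cA.
have Afin : A \is a fin_num.
  rewrite ge0_fin_numE ?powR_sum_ge0//;
    apply: le_lt_trans (powR_sum_pairing_le _ _ (ltW p0)) _.
  by rewrite lte_mul_pinfty ?lee_fin ?powR_ge0//;
    apply: le_lt_trans vs (ltry _).
pose a := fine A; have a0 : 0 <= a by rewrite fine_ge0// powR_sum_ge0.
have ca : c `^ p <= a by rewrite -lee_fin fineK.
pose X i := modulus (B (v i) e).
pose b i := modulus (B (y i) e) `^ q.
have b0 i : 0 <= b i by exact: powR_ge0.
have X0 i : 0 <= X i by exact: modulus_ge0.
(* The tangent at the mean [a] of the values [X_i^p / al_i], multiplied by [al i]. After summation a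
   total weight of at most 1 is enough. *)
have tangent i : r * a `^ (r - 1) * X i `^ p <= b i + (r - 1) * a `^ r * al i.
  have r10 : 0 <= r - 1 by rewrite subr_ge0.
  have [ti0|ti0] := eqVneq (t i) 0.
    have -> : X i = 0.
      apply/le_anti; rewrite X0 andbT; apply: le_trans (pairing_le pB _ _) _.
      by rewrite -/(t i) ti0 mul0r.
    rewrite powR0 ?gt_eqF// mulr0.
    exact: (addr_ge0 (b0 i) (mulr_ge0 (mulr_ge0 r10 (powR_ge0 _ _)) (al0 i))).
  have ai : al i != 0 by rewrite mulf_neq0 ?invr_eq0 ?powR_eq0 ?negb_and ?ti0
    ?gt_eqF.
  have ai0 : 0 < al i by rewrite lt_neqAle eq_sym ai; exact: al0.
  have x0 : 0 <= X i `^ p / al i by rewrite divr_ge0 ?powR_ge0.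
  have := powR_tangent r1 a0 x0; rewrite -(ler_pM2l ai0).
  have -> : al i * (r * a `^ (r - 1) * (X i `^ p / al i)) = r * a `^ (r - 1) *
    X i `^ p.
    by field.
  move=> h; apply: (le_trans h); rewrite mulrDr lerD//; last by rewrite mulrC.
  rewrite /b /y (pairingZl pB) modulusM modulus_of_real ger0_norm ?powR_ge0// yE
    ?modulus_ge0//.
  rewrite le_eqVlt; apply/orP; left; apply/eqP.
  rewrite powRM ?powR_ge0 ?invr_ge0// -powRrM prq mulrCA mulrC; congr (_ * _).
  rewrite -powR_inv1// -powRrM mulN1r powRN.
  by rewrite powRB ?powRr1// ai implybT.
have ab : ((a `^ r)%:E <= nsum b)%E.
  have [->|an0] := eqVneq a 0.
    by rewrite powR0 ?nsum_ge0// gt_eqF// (lt_le_trans ltr01).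
  have : (nsum (fun i => r * a `^ (r - 1) * X i `^ p)%R <=
      nsum (fun i => b i + (r - 1) * a `^ r * al i)%R)%E.
    apply: le_nsum => i; rewrite tangent andbT.
    exact: (mulr_ge0 (mulr_ge0 (le_trans ler01 r1) (powR_ge0 _ _))
      (powR_ge0 _ _)).
  rewrite nsumZ => [|i]; last exact: powR_ge0.
  have ra0 : 0 <= (r - 1) * a `^ r by rewrite mulr_ge0 ?powR_ge0// subr_ge0.
  rewrite nsumD// => [h|i]; last exact: (mulr_ge0 ra0 (al0 i)).
  rewrite nsumZ// in h.
  have h2 : ((r * a `^ r)%:E <= nsum b + ((r - 1) * a `^ r)%:E)%E.
    apply: (@le_trans _ _ (nsum b + ((r - 1) * a `^ r)%:E * nsum al)%E).
      apply: le_trans h; rewrite -[nsum _]/A -(fineK Afin) -EFinM lee_fin -/a.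
      have a_gt0 : 0 < a by rewrite lt_neqAle eq_sym an0.
      have -> : r * a `^ (r - 1) * a = r * (a * a `^ (r - 1)) by ring.
      by rewrite (mulr_powRB1 a0 (lt_le_trans ltr01 r1)).
    by rewrite leeD2l// -[leRHS]mule1 lee_wpmul2l.
  move: h2; case: (nsum b) => [z|_|];
    [|by rewrite leey|by rewrite addNye leeNy_eq].
  by rewrite -EFinD !lee_fin; lra.
apply: le_trans ab; rewrite lee_fin -prq powRrM.
by rewrite ge0_ler_powR// ?nnegrE ?powR_ge0//; lra.
Qed.

End strong_norms.

(** * Approximation by finite forms at exponent 1 *)

Section approximation.
Context {R : realType} {k : scalar_kind}.
Local Notation K := (scalars R k).
Context {E V Z : normedModType K} (B : V -> E -> K^o).
Hypothesis pB : pairing B.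

Lemma dominated1D phi psi (c d : R) : (forall e, 0 <= phi e) ->
  (forall e, 0 <= psi e) ->
  dominated B 1 phi c -> dominated B 1 psi d ->
  dominated B 1 (fun e => phi e + psi e) (c + d).
Proof.
move=> phi0 psi0 Dphi Dpsi.
pose chi n := if n is 0%N then phi else if n is 1%N then psi else fun=> 0.
pose cd n := if n is 0%N then c else if n is 1%N then d else 0.
have sum2 (h : nat -> \bar R) : (forall n, 0 <= h n)%E ->
  (forall n, h n.+2 = 0)%E ->
    (\sum_(n <oo) h n = h 0%N + h 1%N)%E.
  move=> h0 hz; rewrite (nneseries_split 0 2) => [|? _]; last exact: h0.
  rewrite eseries0 ?adde0; last by move=> [|[|]].
  by rewrite add0n !big_nat_recr//= big_geq// add0e.
have nonneg (f : E -> R) b : (forall e, 0 <= f e) -> dominated B 1 f b ->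
  0 <= b.
  by move=> f0 [z zb _]; rewrite -lee_fin -[b]expr1; apply: le_trans zb;
    exact: power_sum_ge0.
apply: (@dominated1_series _ _ _ _ B pB chi cd) => [[|[|n]]||e|[|[|n]] e|e] //=.
- exists (fun=> 0) => [|e]; first by rewrite /power_sum nsum0// => i;
    rewrite rnorm0 expr1.
  by rewrite expr1 power_sum_ge0.
- rewrite sum2// => -[|[|n]]; rewrite lee_fin//=.
    exact: nonneg Dphi.
  exact: nonneg Dpsi.
- by rewrite addr_ge0.
by rewrite sum2 ?EFinD// => -[|[|n]]; rewrite lee_fin /=.
Qed.

Lemma finite_form_dominated1 (F : E -> Z) : finite_form B F ->
  exists c : R, dominated B 1 (fun e => rnorm (F e)) c.
Proof.
move=> [n [a [z FE]]]; exists (\sum_i rnorm (z i) * rnorm (a i)).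
apply: (dominated_finite pB (a := fun i => of_real k (rnorm (z i)) *: a i)) =>
  // [|e].
  rewrite expr1 le_eqVlt; apply/orP; left; apply/eqP; apply: eq_bigr => i _.
  by rewrite expr1 rnormZ_modulus modulus_of_real ger0_norm ?rnorm_ge0.
rewrite expr1 FE; apply: le_trans (rnorm_sum _ _ _) _; apply: ler_sum => i _.
by rewrite expr1 (pairingZl pB) modulusM modulus_of_real ger0_norm ?rnorm_ge0//
  rnormZ_modulus mulrC.
Qed.

Lemma cotype2_approx (T : E -> Z) (C p s : R) (v : nat -> V) :
  0 < C -> rademacher_lifting V C -> cotype2 Z -> linear T -> 1 <= p -> 0 < s ->
  (powR_sum p v <= (s `^ p)%:E)%E ->
  (forall e, ((rnorm (T e) `^ p)%:E <= powR_sum p (fun i => B (v i) e))%E) ->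
  forall eps : R, 0 < eps ->
  exists2 F, finite_form B F & dominated B 1 (fun e => rnorm (T e - F e)) eps.
Proof.
move=> C0 liftV cotZ lT p1 s0 vs vT eps eps0.
pose l := Num.bound p.
have pl : p <= (2 ^ l.+1)%:R.
  apply: (@le_trans _ _ l%:R); first by rewrite ltW// archi_boundP//; lra.
  by rewrite ler_nat ltnW// (ltn_trans (ltnSn l))// ltn_expl.
have [y ys yT] := powR_sum_reweight pB p1 pl s0 vs.
have DT : dominated B (2 ^ l.+1) (fun e => rnorm (T e)) s.
  exists y => [|e]; first by rewrite -powR_sum_nat -powR_mulrn// ltW.
  by rewrite -powR_sum_nat -powR_mulrn ?rnorm_ge0//; apply: yT;
    rewrite ?rnorm_ge0.
have [d Dd] := cotype2_dominated2 pB cotZ lT DT.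
have C20 : 0 < 96 * C ^+ 2 by rewrite mulr_gt0// exprn_gt0.
(* Extrapolation will be applied to the error [T - F] and not to [T]; its factor is divided out
   beforehand. *)
have eps'0 : 0 < eps / (96 * C ^+ 2) by rewrite divr_gt0.
have [F FF DF] := approx_dominated2 pB lT Dd eps'0.
have C2n : 96 * C ^+ 2 != 0 by rewrite gt_eqF.
exists F => //; rewrite -[eps](divfK C2n).
by apply: (dominated2_dominated1 pB) => // e; exact: rnorm_ge0.
Qed.

(** An approximation with error 1, plus the finite form itself. It serves to show that the ideal is
    closed under differences, since at exponent 1 majorants of two operators can be concatenated. *)
Lemma cotype2_dominated1 (T : E -> Z) (C p s : R) (v : nat -> V) :
  0 < C -> rademacher_lifting V C -> cotype2 Z -> linear T -> 1 <= p -> 0 < s ->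
  (powR_sum p v <= (s `^ p)%:E)%E ->
  (forall e, ((rnorm (T e) `^ p)%:E <= powR_sum p (fun i => B (v i) e))%E) ->
  exists2 c : R, 0 < c & dominated B 1 (fun e => rnorm (T e)) c.
Proof.
move=> C0 liftV cotZ lT p1 s0 vs vT.
have [F FF DF] := cotype2_approx C0 liftV cotZ lT p1 s0 vs vT ltr01.
have [c Dc] := finite_form_dominated1 FF.
have c0 : 0 <= c.
  have [z zb _] := Dc.
  by rewrite -lee_fin -[c]expr1; apply: le_trans zb; exact: power_sum_ge0.
exists (1 + c); first by rewrite ltr_pwDl.
apply: (@le_dominated _ _ _ _ B 1 _ (fun e => rnorm (T e - F e) + rnorm (F e))
  (1 + c)).
- by rewrite lexx andbT addr_ge0.
- by move=> e; rewrite rnorm_ge0/= -{1}(subrK (F e) (T e)) rnormD.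
by apply: dominated1D => // e; exact: rnorm_ge0.
Qed.

(** Reweighting from 1 to [p] keeps the constant, so smallness at exponent 1 passes to exponent
    [p]. *)
Lemma dominated1_powR_sum phi (c p : R) : (forall e, 0 <= phi e) -> 1 <= p ->
  0 < c ->
  dominated B 1 phi c ->
  exists2 v : nat -> V, (powR_sum p v <= (c `^ p)%:E)%E &
    forall e, ((phi e `^ p)%:E <= powR_sum p (fun i => B (v i) e))%E.
Proof.
move=> phi0 p1 c0 [z zc zphi].
have [|y yc yphi] := powR_sum_reweight (p := 1) (q := p) (v := z) pB
  (lexx 1) p1 c0.
  by rewrite -[X in powR_sum X]/(1%:R) powR_sum_nat powRr1 ?(ltW c0)//
    -[c]expr1.
exists y => // e; apply: yphi => //.
by rewrite -[X in powR_sum X]/(1%:R) powR_sum_nat powRr1// -[phi e]expr1.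
Qed.

End approximation.

(** Approximability makes the closure all of [I], and every coset of the group [I] by a member is
    [I] itself. *)
Lemma trivial_quotient (R : realType) (k : scalar_kind)
  (X : normedModType (scalars R k))
    (I : set (bounded_operator X X)) (N : bounded_operator X X -> \bar R) :
  I 0 -> (forall S T, I S -> I T -> I (S - T)) ->
  (forall T (e : R), I T -> 0 < e ->
    exists2 F, finite_rank X X F & (N (T - F)%R < e%:E)%E) ->
  ideal_quotient I N = [set coset (finite_rank_closure I N) 0].
Proof.
move=> I0 IB Iapprox.
have JI : finite_rank_closure I N = I.
  apply/seteqP; split=> [T []//|T IT]; split=> // e e0; exact: Iapprox.
have cosetI T : I T -> coset I T = I.
  move=> IT; have IN S : I S -> I (- S) by move=> IS; rewrite -sub0r; exact: IB.
  apply/seteqP; split=> [_ [S IS <-]|S IS]; first by rewrite -[S]opprK;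
    apply: IB => //; exact: IN.
  by exists (S - T); [exact: IB|rewrite addrC subrK].
rewrite /ideal_quotient /quotient JI; apply/seteqP;
  split=> [_ [T IT <-]|_ ->] /=.
  by rewrite !cosetI.
by exists 0.
Qed.

Section quasi_nuclear.
Context {R : realType} {k : scalar_kind}.
Local Notation K := (scalars R k).
Context {X : normedModType K}.

Definition eval_dual (f : dual X) (x : X) : K^o := f x.

Lemma pairing_eval_dual : pairing eval_dual.
Proof.
split=> [x a f g|f a x y|f x] //.
- by rewrite /eval_dual linearP.
exact: dual_le.
Qed.

Lemma finite_form_operator (F : X -> X) : finite_form eval_dual F ->
  exists2 S : bounded_operator X X, S =1 F & finite_rank X X S.
Proof.
move=> FF; have [FD FZ] := finite_form_linear pairing_eval_dual FF.
have [n [a [z FE]]] := FF.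
have lF : linear F by move=> b x y; rewrite FD FZ.
have Fc x : rnorm (F x) <= (\sum_i rnorm (a i) * rnorm (z i)) * rnorm x.
  rewrite FE mulr_suml; apply: le_trans (rnorm_sum _ _ _) _;
    apply: ler_sum => i _.
  by rewrite rnormZ_modulus mulrAC ler_wpM2r ?rnorm_ge0// dual_le.
have [S SF _] := operator_of_bounded lF Fc.
exists S => //; exists n, z => x; exists (fun i => a i x).
by rewrite SF FE.
Qed.

Lemma QN_dominated (T : bounded_operator X X) (p : R) : 1 <= p -> QN p X X T ->
  exists s (v : nat -> dual X), [/\ 0 < s, (powR_sum p v <= (s `^ p)%:E)%E &
    forall x, ((rnorm (T x) `^ p)%:E <=
      powR_sum p (fun i => eval_dual (v i) x))%E].
Proof.
move=> p1 [v [voo vT]]; have p0 : 0 < p by lra.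
have v0 : (0 <= strong_norm p v)%E by exact: poweR_ge0.
exists (fine (strong_norm p v) + 1), v; split.
- by rewrite ltr_wpDl// fine_ge0.
- rewrite -strong_norm_le ?addr_ge0 ?fine_ge0//.
  rewrite EFinD fineK ?ge0_fin_numE// leeDl//.
by move=> x; rewrite -le_strong_norm ?rnorm_ge0.
Qed.

Lemma dominated1_QN (T : bounded_operator X X) (p c : R) : 1 <= p -> 0 < c ->
  dominated eval_dual 1 (fun x => rnorm (T x)) c ->
  QN p X X T /\ (QN_norm p T <= c%:E)%E.
Proof.
move=> p1 c0 DT; have p0 : 0 < p by lra.
have [|v vc vT] := dominated1_powR_sum pairing_eval_dual _ p1 c0 DT.
  by move=> x; exact: rnorm_ge0.
have vc' : (strong_norm p v <= c%:E)%E by rewrite strong_norm_le// ltW.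
have maj : QN_majorant p T v.
  split; first exact: le_lt_trans vc' (ltry _).
  by move=> x; rewrite le_strong_norm ?rnorm_ge0.
split; first by exists v.
by apply: le_trans vc'; apply: ereal_inf_lbound; exists v.
Qed.

Lemma cotype2_QN (p : R) : cotype2 X -> 1 <= p ->
  ideal_quotient (QN p X X) (QN_norm p) =
  [set coset (finite_rank_closure (QN p X X) (QN_norm p)) 0].
Proof.
move=> cotX p1; have [C [C0 liftV]] := cotype2_lifting_dual cotX.
have DQN T : QN p X X T -> exists2 c : R, 0 < c & dominated eval_dual 1
  (fun x => rnorm (T x)) c.
  move=> /(QN_dominated p1)[s [v [s0 vs vT]]].
  exact: (cotype2_dominated1 pairing_eval_dual C0 liftV cotX
    (operator_linear T) p1 s0 vs vT).
apply: trivial_quotient => [|S T /DQN[c c0 DS] /DQN[d d0 DT]|T e QT e0].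
- apply: (dominated1_QN p1 ltr01 _).1; exists (fun=> 0) => [|x].
    by rewrite /power_sum nsum0// => i; rewrite rnorm0 expr1.
  by rewrite rnorm0 expr1 power_sum_ge0.
- apply: (dominated1_QN p1 (addr_gt0 c0 d0) _).1.
  have D := dominated1D pairing_eval_dual (fun x => rnorm_ge0 (S x))
    (fun x => rnorm_ge0 (T x)) DS DT.
  apply: le_dominated D; first by rewrite lexx andbT addr_ge0// ltW.
  by move=> x; rewrite rnorm_ge0 rnormB.
have [s [v [s0 vs vT]]] := QN_dominated p1 QT.
have e20 : 0 < e / 2 by rewrite divr_gt0.
have [F FF DF] := cotype2_approx pairing_eval_dual C0 liftV cotX
  (operator_linear T) p1 s0 vs vT e20.
have [S SF frS] := finite_form_operator FF.
exists S => //; apply: le_lt_trans (dominated1_QN p1 e20 _).2 _;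
  last by rewrite lte_fin; lra.
have -> // : (fun x => rnorm ((T - S) x)) = fun x => rnorm (T x - F x).
by apply/funext => x; rewrite -[(T - S) x]/(T x - S x) SF.
Qed.

End quasi_nuclear.

(** * Sinha-Karn p-compact operators *)

Section norming.
Context {R : realType} {k : scalar_kind}.
Local Notation K := (scalars R k).

(** Hahn-Banach applied to the ray through [v]. Unlike the half-norming vector of a functional, the
    norm is attained. *)
Lemma exists_norming (X : normedModType K) (v : X) :
  exists2 f : dual X, rnorm f <= 1 & rnorm v <= scalar_re (f v).
Proof.
have sp : sublinear (k := k) (fun x : X => rnorm x).
  split=> [x y|t x t0]; first exact: rnormD.
  by rewrite rnormZ_modulus modulus_of_real ger0_norm.
pose S : set (X * R) :=
  [set u | exists2 t, 0 <= t & u = (of_real k t *: v, t * rnorm v)].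
have pS : dominated_cone (k := k) (fun x : X => rnorm x) S.
  split.
  - by exists (of_real k 0 *: v, 0 * rnorm v), 0.
  - move=> _ _ [t t0 ->] [s s0 ->]; exists (t + s); first exact: addr_ge0.
    by rewrite of_realD scalerDl mulrDl.
  - move=> t _ t0 [s s0 ->]; exists (t * s); first exact: mulr_ge0.
    by rewrite of_realM scalerA mulrA.
  - by move=> _ [t t0 ->] /=; rewrite rnormZ_modulus modulus_of_real ger0_norm.
have [l [ll lp lS]] := mazur_orlicz sp pS.
have [f f1 fl] :=
  dual_of_real_linear ler01 ll
  (fun x => le_trans (lp x) (eq_ind_r (fun y => _ <= y) (lexx _) (mul1r _))).
exists f => //; rewrite fl; apply: (lS (v, rnorm v)).
by exists 1; rewrite ?ler01// of_real1 scale1r mul1r.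
Qed.

Lemma cvg_rnorm (X : normedModType K) (u : nat -> X) (x : X) :
  (forall eps : R, 0 < eps -> exists N, forall n, (N <= n)%N ->
    rnorm (x - u n) <= eps) ->
  u @ \oo --> x.
Proof.
move=> ux; apply/cvgrPdist_le => e e0.
have e0' : 0 < scalar_re e.
  have eE := scalar_reK (ltW e0); rewrite -eE in e0.
  rewrite lt_neqAle; apply/andP; split;
    last by rewrite -(of_real_le (k := k)) of_real0 ltW.
  by apply: contraTneq e0 => <-; rewrite of_real0 ltxx.
have [N Nx] := ux _ e0'.
exists N => // n Nn /=.
by rewrite -of_real_rnorm -(scalar_reK (ltW e0)) of_real_le; exact: Nx.
Qed.

Lemma rnorm_cvg (X : normedModType K) (u : nat -> X) (x : X) : u @ \oo --> x ->
  forall eps : R, 0 < eps -> exists N, forall n, (N <= n)%N ->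
    rnorm (x - u n) <= eps.
Proof.
move=> /cvgrPdist_le ux eps eps0.
have e0 : 0 < of_real k eps.
  rewrite lt_neqAle -of_real0 of_real_le ltW// andbT.
  by apply: contraTneq eps0 => /(congr1 (@scalar_re R k));
    rewrite !of_realK => <-; rewrite ltxx.
have [N _ Nx] := ux _ e0; exists N => n Nn.
by have := Nx n Nn; rewrite /= -of_real_rnorm of_real_le.
Qed.

End norming.

Section sinha_karn.
Context {R : realType} {k : scalar_kind}.
Local Notation K := (scalars R k).
Context {X : normedModType K}.

Definition dual_eval (x : X) (f : dual X) : K^o := f x.

Lemma pairing_dual_eval : pairing dual_eval.
Proof.
split=> [f a x y|x a f g|x f] //.
- by rewrite /dual_eval linearP.
by rewrite mulrC; exact: dual_le.
Qed.

Lemma exists_adjoint (T : bounded_operator X X) :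
  exists2 A : dual X -> dual X, linear A & forall f x, A f x = f (T x).
Proof.
have /choice[A AE] (f : dual X) : exists g : dual X, forall x, g x = f (T x).
  have lfT : linear (fun x => f (T x) : K^o) by move=> a x y; rewrite !linearP.
  have fTc x : rnorm (f (T x) : K^o) <= (rnorm f * operator_norm T) * rnorm x.
    apply: le_trans (dual_le _ _) _; rewrite -mulrA ler_wpM2l ?rnorm_ge0//.
    exact: operator_le.
  by have [g gE _] := operator_of_bounded lfT fTc; exists g.
exists A => // a f g; apply: dual_ext => x.
by rewrite AE -[(a *: A f + A g) x]/(a * A f x + A g x) !AE.
Qed.

(* The Hahn-Banach theorem extends e |-> e(Sx) from the sequences (e(z_i)) to a
   functional bounded by the l_1 norm, that is, to a bounded sequence. *)
Lemma adjoint_dominated_hull (S : bounded_operator X X) (z : nat -> X) (c : R) :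
  (power_sum 1 z <= c%:E)%E ->
  (forall (f : dual X) x, modulus (f (S x)) <=
    rnorm x * fine (power_sum 1 (fun i => dual_eval (z i) f))) ->
  forall x, rnorm x <= 1 -> exists lam : nat ->
    K, (forall i, modulus (lam i) <= 1) /\
    (series (fun i => lam i *: z i) @ \oo --> S x).
Proof.
move=> zc Sz x x1.
have zoo : (power_sum 1 z < +oo)%E by exact: le_lt_trans zc (ltry _).
pose t i := rnorm (z i); have t0 i : 0 <= t i by exact: rnorm_ge0.
have too : (nsum t < +oo)%E.
  by rewrite (eq_nsum (v := fun i => rnorm (z i) ^+ 1)) // => i; rewrite expr1.
pose f i := of_real k (t i)^-1 *: z i.
have zf i : z i = of_real k (t i) *: f i.
  rewrite /f scalerA -of_realM; have [ti0|ti0] := eqVneq (t i) 0.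
    by rewrite ti0 mul0r of_real0 scale0r; exact: rnorm0_eq0.
  by rewrite mulfV// of_real1 scale1r.
have f1 i : rnorm (f i) <= 1.
  rewrite rnormZ_modulus modulus_of_real ger0_norm ?invr_ge0// -/(t i).
  by have [->|ti0] := eqVneq (t i) 0; rewrite ?mulr0 ?ler01// mulVf.
pose W := bseq R k.
pose wt (a : W) i := t i * modulus (a i).
have wt0 a i : 0 <= wt a i by rewrite mulr_ge0 ?modulus_ge0.
have uoo (u : nat -> R) M : (forall i, 0 <= u i <= M) ->
  (nsum (fun i => t i * u i)%R < +oo)%E.
  move=> uM; have u0 i : 0 <= u i by case/andP: (uM i).
  have M0 : 0 <= M by case/andP: (uM 0%N); exact: le_trans.
  apply: (@le_lt_trans _ _ (nsum (fun i => M * t i)%R)).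
    apply: le_nsum => i; rewrite mulr_ge0//= mulrC ler_wpM2r//;
      by case/andP: (uM i).
  by rewrite nsumZ// lte_mul_pinfty ?lee_fin.
have wtoo a : (nsum (wt a) < +oo)%E.
  by have [M aM] := bseqP a; apply: (uoo _ M) => i; rewrite modulus_ge0/=.
have wtfin a : nsum (wt a) \is a fin_num by rewrite ge0_fin_numE ?nsum_ge0.
pose p (a : W) := fine (nsum (wt a)).
have sp : sublinear (k := k) p.
  split=> [a b|s a s0].
    rewrite -lee_fin EFinD !fineK// -nsumD//; apply: le_nsum => i.
    by rewrite wt0/= -mulrDr ler_wpM2l// modulusD.
  rewrite -lee_fin EFinM !fineK// -nsumZ//; apply: le_nsum => i.
  rewrite wt0/= /wt -[(_ *: a) i]/(of_real k s * a i) modulusM modulus_of_real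
    ger0_norm//.
  by rewrite mulrCA.
(* As [|x| <= 1] and [t_i |e(f_i)| = |e(z_i)|], the hypothesis on [S] puts this cone below the
   weighted l_1 seminorm [p]. *)
pose Q : set (W * R) := [set u : W * R | exists e : dual X,
  (forall i, u.1 i = e (f i)) /\ u.2 = scalar_re (e (S x))].
have exQ (e : dual X) : exists a : W, forall i, a i = e (f i).
  apply: (bseq_of (M := rnorm e)) => i.
  by apply: le_trans (dual_le _ _) _; rewrite ler_piMr ?rnorm_ge0.
have pQ : dominated_cone (k := k) p Q.
  split.
  - by have [a aE] := exQ 0; exists (a, scalar_re ((0 : dual X) (S x))), 0.
  - move=> [a r] [b s] [e [/= ae ->]] [g [/= bg ->]]; exists (e + g);
      split=> [i|] /=.
      by rewrite -[LHS]/(a i + b i) ae bg.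
    by rewrite -scalar_reD.
  - move=> s [a r] s0 [e [/= ae ->]]; exists (of_real k s *: e);
      split=> [i|] /=.
      by rewrite -[LHS]/(of_real k s * a i) ae.
    by rewrite -scalar_reM.
  - move=> [a r] [e [/= ae ->]] /=.
    apply: le_trans (scalar_re_le_modulus _) _; apply: le_trans (Sz e x) _.
    apply: (@le_trans _ _ (fine (power_sum 1 (fun i => dual_eval (z i) e)))).
      by rewrite ler_piMl// fine_ge0// power_sum_ge0.
    rewrite le_eqVlt; apply/orP; left; apply/eqP; congr fine;
      apply: eq_nsum => i.
    rewrite expr1 /wt ae {1}/dual_eval
      {1}zf linearZ -[rnorm _]/(modulus (of_real k (t i) * e (f i))).
    by rewrite modulusM modulus_of_real ger0_norm.
have [g [lg gp gQ]] := mazur_orlicz sp pQ.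
have wtu (s : K) i j :
    wt ((s : K^o) *: unit_bseq i) j = if j == i then t i * modulus s else 0.
  rewrite /wt -[((s : K^o) *: unit_bseq i) j]/(s * (if j == i then 1 else 0)).
  by case: eqP => [->|_]; rewrite ?mulr1// mulr0 modulus0 mulr0.
(* On the line of a unit sequence [g] is the real part of multiplication by a scalar whose modulus
   [p] bounds by [t i]; the coefficient [mu_i / t_i] thus has modulus at most 1. *)
have /choice[mu muP] i : exists m : K, modulus m <= t i /\
    forall s : K, g ((s : K^o) *: unit_bseq i) = scalar_re (s * m).
  have [||s|h h1 hE] :=
    @dual_of_real_linear R k K^o (fun s => g (s *: unit_bseq i)) (t i).
  - exact: t0.
  - split=> [s r|r s]; first by rewrite scalerDl lg.1.
    by rewrite -lg.2 scalerA.
  - apply: le_trans (gp _) _; rewrite /p (nsum_fin (n := i.+1))//=.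
      rewrite big_ord_recr big1/= => [|j _]; last by rewrite wtu ltn_eqF.
      by rewrite add0r wtu eqxx.
    by move=> j ij; rewrite wtu gtn_eqF.
  exists (h 1); split.
    have r1 : rnorm (1 : K^o) = 1 by exact: modulus1.
    by have := dual_le h 1; rewrite r1 mulr1 => /le_trans; apply.
  move=> s; rewrite -hE; congr scalar_re.
  have -> : s = s *: (1 : K^o) by rewrite -[RHS]/(s * 1) mulr1.
  rewrite linearZ; congr (_ * _).
  by rewrite -[RHS]/(s * 1) mulr1.
exists (fun i => mu i * of_real k (t i)^-1); split=> [i|].
  rewrite modulusM modulus_of_real ger0_norm ?invr_ge0//.
  have [->|ti0] := eqVneq (t i) 0; first by rewrite invr0 mulr0.
  have ti_gt0 : 0 < t i by rewrite lt_neqAle eq_sym ti0; exact: t0.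
  by rewrite ler_pdivrMr// mul1r (muP i).1.
apply: cvg_rnorm => eps eps0.
have [N tN] := nsum_tail t0 too eps0.
exists N => n Nn; rewrite /series /= big_mkord.
set w := \sum_(i < n) _.
(* A functional of norm at most 1 that norms the remainder turns the tail bound, which is uniform
   over the dual ball, into convergence in norm. *)
have [h h1 hv] := exists_norming (S x - w); apply: (le_trans hv).
have [a aE] := exQ h.
have ga : scalar_re (h (S x)) <= g a by apply: (gQ (a, _)); exists h.
have gcut : g (cut_bseq n a) = scalar_re (h w).
  rewrite real_linear_cut// linear_sum scalar_re_sum; apply: eq_bigr => i _.
  have hZ b v : h (b *: v) = b * h v by rewrite linearZ.
  rewrite (muP i).2 aE hZ; congr scalar_re.
  by rewrite [RHS]hZ mulrC mulrA.
have -> : scalar_re (h (S x - w)) = scalar_re (h (S x)) - scalar_re (h w).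
  by rewrite linearB scalar_reB.
apply: (@le_trans _ _ (p (a - cut_bseq n a))).
  rewrite lerBlDr -gcut; apply: (le_trans ga).
  rewrite -{1}(subrK (cut_bseq n a) a) lg.1 lerD2r; exact: gp.
rewrite -lee_fin fineK// (nsum_split n)// big1 ?add0e => [|i _]; last first.
  by rewrite /wt -[(a - _) _]/(a i - cut_seq n a i) /cut_seq ltn_ord subrr
    modulus0 mulr0.
apply: le_trans tN.
rewrite [leRHS](nsum_split (n - N)) => [|i]; last exact: t0.
apply: (@le_trans _ _ (nsum (fun i => t (i + (n - N) + N)%N))); last first.
  by rewrite leeDr// lee_fin sumr_ge0.
apply: le_nsum => i;
  rewrite wt0/= /wt -[(a - _) _]/(a (i + n)%N - cut_seq n a (i + n)%N).
rewrite /cut_seq ltnNge leq_addl subr0 -addnA subnK// ler_piMr// aE.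
apply: le_trans (dual_le _ _) _; apply: mulr_ile1 => //; exact: rnorm_ge0.
Qed.

Lemma powR_div (a b p : R) : 0 <= a -> 0 < b ->
  (a / b) `^ p = a `^ p / b `^ p.
Proof.
move=> a0 b0; have bp0 : b `^ p != 0 by rewrite gt_eqF// powR_gt0.
apply: (mulIf bp0); rewrite mulfVK//.
rewrite -powRM; [|exact: divr_ge0 (ltW b0)|exact: ltW].
by rewrite mulfVK// gt_eqF.
Qed.

(** Hoelder's inequality on partial sums, from Young's inequality for [b_i / s]; in the c_0 ball the
    bound [|a_i| <= 1] is enough. *)
Lemma conjugate_ball_sum_le (p s : R) (a : nat -> K^o) (b : nat -> R) n :
  1 <= p ->
  0 <= s -> (forall i, 0 <= b i) -> conjugate_ball p a ->
  (nsum (fun i => b i `^ p)%R <= (s `^ p)%:E)%E ->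
  \sum_(i < n) modulus (a i) * b i <= s.
Proof.
move=> p1 s0 b0; rewrite /conjugate_ball; have [->|pn1] := eqVneq p 1.
  move=> [_ a1]; rewrite powRr1// => bs.
  apply: (@le_trans _ _ (\sum_(i < n) b i)).
    by apply: ler_sum => i _; rewrite ler_piMl//; exact: a1.
  rewrite -lee_fin; apply: le_trans bs.
  rewrite (eq_nsum (v := b)); last by move=> i; rewrite powRr1.
  exact: sum_le_nsum.
have p1' : 1 < p by rewrite lt_neqAle eq_sym pn1.
have p0 : 0 < p by lra.
pose q := (1 - p^-1)^-1.
have q0 : 0 < q by rewrite invr_gt0 subr_gt0 invf_lt1.
have qV : q^-1 = 1 - p^-1 by rewrite /q invrK.
rewrite /= -/q strong_norm_le// powR1 => aq bp.
have aq_n : \sum_(i < n) modulus (a i) `^ q <= 1.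
  by rewrite -lee_fin; apply: le_trans aq; apply: sum_le_nsum => i;
    exact: powR_ge0.
have bp_n : \sum_(i < n) b i `^ p <= s `^ p.
  by rewrite -lee_fin; apply: le_trans bp;
    apply: (sum_le_nsum n (u := fun i => b i `^ p)) => i; exact: powR_ge0.
have [sz|sn0] := eqVneq s 0.
  rewrite sz powR0 ?gt_eqF// in bp_n; rewrite sz big1// => i _.
  suff /eqP : b i `^ p = 0 by rewrite powR_eq0 => /andP[/eqP -> _];
    rewrite mulr0.
  apply/le_anti; rewrite powR_ge0 andbT; apply: le_trans bp_n.
  by rewrite (bigD1 i)//= lerDl sumr_ge0// => j _; exact: powR_ge0.
have s_gt0 : 0 < s by rewrite lt_neqAle eq_sym sn0.
have young i : modulus (a i) * b i <=
  s * (modulus (a i) `^ q / q + (b i `^ p / s `^ p) / p).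
  have bs0 : 0 <= b i / s by rewrite divr_ge0.
  have pq : q^-1 + p^-1 = 1 by rewrite qV subrK.
  rewrite -powR_div//.
  have := conjugate_powR (modulus_ge0 (a i)) bs0 q0 p0 pq.
  rewrite -(ler_pM2l s_gt0); apply: le_trans.
  by rewrite [b i / s]mulrC mulrCA mulVKf.
apply: (@le_trans _ _
  (\sum_(i < n) s * (modulus (a i) `^ q / q + (b i `^ p / s `^ p) / p))).
  by apply: ler_sum => i _; exact: young.
rewrite -mulr_sumr big_split/= -!mulr_suml -[leRHS]mulr1 ler_pM2l//.
rewrite -[leRHS](subrK p^-1) -qV lerD//.
  by rewrite ler_piMl// invr_ge0 ltW.
rewrite ler_piMl ?invr_ge0 ?(ltW p0)// ler_pdivrMr ?powR_gt0// mul1r//.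
Qed.

(** One half of the duality between SK_p and QN_p: Hoelder's inequality on the partial sums that
    represent [T x] bounds [|f (T x)|] by the l_p norm of the sequence [f (y i)]. *)
Lemma SK_adjoint_dominated (T : bounded_operator X X) (A : dual X -> dual X)
  (p : R) :
  1 <= p -> (forall f x, A f x = f (T x)) -> SK p X X T ->
  exists s (y : nat -> X), [/\ 0 < s, (powR_sum p y <= (s `^ p)%:E)%E &
    forall f, ((rnorm (A f) `^ p)%:E <=
      powR_sum p (fun i => dual_eval (y i) f))%E].
Proof.
move=> p1 AE [y [yoo Ty]]; have p0 : 0 < p by lra.
have y0 : (0 <= strong_norm p y)%E by exact: poweR_ge0.
pose s := fine (strong_norm p y) + 1.
have s0 : 0 < s by rewrite ltr_wpDl// fine_ge0.
have ys : (powR_sum p y <= (s `^ p)%:E)%E.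
  by rewrite -strong_norm_le ?(ltW s0)// EFinD fineK ?ge0_fin_numE// leeDl.
exists s, y; split => // f.
pose P := powR_sum p (fun i => dual_eval (y i) f).
have P0 : (0 <= P)%E by exact: powR_sum_ge0.
have Pfin : P \is a fin_num.
  rewrite ge0_fin_numE//;
    apply: le_lt_trans (powR_sum_pairing_le pairing_dual_eval _ _ (ltW p0)) _.
  by rewrite lte_mul_pinfty ?lee_fin ?powR_ge0//;
    apply: le_lt_trans ys (ltry _).
pose c := fine P `^ p^-1.
have cP : c `^ p = fine P by rewrite powRVrK// fine_ge0.
have c0 : 0 <= c by exact: powR_ge0.
suff Afc : rnorm (A f) <= c.
  rewrite -/P -(fineK Pfin) lee_fin -cP ge0_ler_powR ?(ltW p0)// nnegrE//;
    exact: rnorm_ge0.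
rewrite rnormE; apply: operator_norm_le => x x1;
  rewrite -[rnorm _]/(modulus _) AE.
have [a ba cvT] := Ty _ (ex_intro2 _ _ x x1 erefl).
apply/ler_addgt0Pr => eps eps0.
have f1 : 0 < rnorm f + 1 by rewrite ltr_wpDl// rnorm_ge0.
have eps'0 : 0 < eps / (rnorm f + 1) by rewrite divr_gt0.
have [N /(_ N (leqnn N)) NT] := rnorm_cvg cvT eps'0.
set w := series _ N in NT.
have -> : f (T x) = f w + f (T x - w) by rewrite linearB addrC subrK.
apply: le_trans (modulusD _ _) _; apply: lerD.
  rewrite /w /series /= big_mkord linear_sum;
    apply: le_trans (modulus_sum _ _ _) _.
  under eq_bigr do rewrite linearZ modulusM.
  apply: (@conjugate_ball_sum_le p c a (fun i => modulus (f (y i)))) => // [i|].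
    exact: modulus_ge0.
  by rewrite cP fineK.
apply: le_trans (dual_le _ _) _;
  apply: (@le_trans _ _ (rnorm f * (eps / (rnorm f + 1)))).
  by rewrite ler_wpM2l ?rnorm_ge0.
by rewrite mulrCA ler_piMr ?(ltW eps0)// ler_pdivrMr// mul1r lerDl.
Qed.

(* With r_i the tails of the series of the t_i, the choice theta_i =
   (r_i / r_0)^(1/2) makes the sum of the t_i / theta_i telescope. *)
Lemma summable_c0_factor (t : nat -> R) (c : R) : (forall i, 0 <= t i) ->
  (nsum t <= c%:E)%E ->
  exists theta : nat -> R, [/\ forall i, 0 <= theta i <= 1,
    forall i, theta i = 0 -> t i = 0,
    forall eps, 0 < eps -> exists N, forall n, (N <= n)%N -> theta n <= eps &
    (nsum (fun i => t i / theta i)%R <= (2 * c)%:E)%E].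
Proof.
move=> t0 tc; pose r i := fine (nsum (fun j => t (j + i)%N)).
have rfin i : nsum (fun j => t (j + i)%N) \is a fin_num.
  rewrite ge0_fin_numE ?nsum_ge0//; apply: (@le_lt_trans _ _ (nsum t)).
    by rewrite [leRHS](nsum_split i)// leeDr// lee_fin sumr_ge0.
  exact: le_lt_trans tc (ltry _).
have r0 i : 0 <= r i by rewrite fine_ge0// nsum_ge0.
have rS i : r i = t i + r i.+1.
  apply: EFin_inj; rewrite EFinD !fineK// (nsum_split 1)// big_ord1 add0n.
  by congr (_ + _)%E; apply: eq_nsum => j; rewrite addn1 addSnnS.
have rle i : r i.+1 <= r i by rewrite (rS i) lerDr.
have r_le0 i : r i <= r 0%N by elim: i => // i; exact: le_trans.
have r0c : r 0%N <= c.
  by rewrite -lee_fin fineK//; apply: le_trans tc; rewrite le_eqVlt; apply/orP;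
    left;
    apply/eqP/eq_nsum => i; rewrite addn0.
pose theta i := Num.sqrt (r i) / Num.sqrt (r 0%N).
have tr i : r i = 0 -> t i = 0.
  by move=> ri; have := rS i; rewrite ri; have := t0 i; have := r0 i.+1; lra.
exists theta; split=> [i|i|eps eps0|].
- rewrite divr_ge0//=; have [r00|r00] := eqVneq (Num.sqrt (r 0%N)) 0.
    by rewrite /theta r00 invr0 mulr0 ler01.
  by rewrite ler_pdivrMr ?mul1r ?ler_wsqrtr// lt_neqAle eq_sym r00 sqrtr_ge0.
- move=> /eqP; rewrite /theta mulf_eq0 invr_eq0 !sqrtr_eq0 => /orP[ri|r00].
    by apply: tr; apply/le_anti; rewrite ri r0.
  by apply: tr; apply/le_anti; rewrite r0 (le_trans (r_le0 i)).
- have [r00|r00] := eqVneq (Num.sqrt (r 0%N)) 0.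
    by exists 0%N => n _; rewrite /theta r00 invr0 mulr0 ltW.
  have sr0 : 0 < Num.sqrt (r 0%N) by rewrite lt_neqAle eq_sym r00 sqrtr_ge0.
  have d0 : 0 < (eps * Num.sqrt (r 0%N)) ^+ 2 by rewrite exprn_gt0// mulr_gt0.
  have [N tN] := nsum_tail t0 (le_lt_trans tc (ltry c)) d0.
  exists N => n Nn; rewrite /theta ler_pdivrMr//.
  have rn : r n <= r N.
    by rewrite -(subnK Nn); elim: (n - N)%N => // m IH;
      rewrite addSn (le_trans (rle _)).
  have e0 : 0 <= eps * Num.sqrt (r 0%N) by rewrite mulr_ge0// ltW.
  rewrite -[leRHS](ger0_norm e0) -sqrtr_sqr ler_wsqrtr// (le_trans rn)//.
  by rewrite -lee_fin fineK.
(* With [u = sqrt r_i] and [v = sqrt r_(i+1)], one has [t_i / u = (u^2 - v^2) / u <= 2 (u - v)];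
   this is the origin of the factor 2. *)
have tele n : \sum_(i < n) t i / Num.sqrt (r i) <=
  2 * (Num.sqrt (r 0%N) - Num.sqrt (r n)).
  elim: n => [|n IH]; first by rewrite big_ord0 subrr mulr0.
  rewrite big_ord_recr/=.
  suff : t n / Num.sqrt (r n) <=
    2 * (Num.sqrt (r n) - Num.sqrt (r n.+1)) by lra.
  have srn := sqr_sqrtr (r0 n); have srn1 := sqr_sqrtr (r0 n.+1).
  have sle : Num.sqrt (r n.+1) <= Num.sqrt (r n) by rewrite ler_wsqrtr.
  have [rn|rn] := eqVneq (Num.sqrt (r n)) 0.
    by rewrite rn invr0 mulr0 in sle *; lra.
  have rn_gt0 : 0 < Num.sqrt (r n) by rewrite lt_neqAle eq_sym rn sqrtr_ge0.
  rewrite ler_pdivrMr//;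
    have -> : t n = Num.sqrt (r n) ^+ 2 - Num.sqrt (r n.+1) ^+ 2.
    by rewrite srn srn1 (rS n) addrK.
  have := sqrtr_ge0 (r n.+1);
    move: (Num.sqrt (r n)) (Num.sqrt (r n.+1)) sle rn_gt0 => u v uv u0 v0.
  by have := mulr_ge0 (ltW u0) v0; have := sqr_ge0 (u - v); nra.
apply: nsum_le => [i|n].
  by rewrite divr_ge0// divr_ge0.
rewrite lee_fin.
have -> : \sum_(i < n) t i / theta i = Num.sqrt (r 0%N) *
  \sum_(i < n) t i / Num.sqrt (r i).
  by rewrite mulr_sumr; apply: eq_bigr => i _; rewrite /theta invfM invrK; ring.
apply: (@le_trans _ _ (Num.sqrt (r 0%N) * (2 * Num.sqrt (r 0%N)))).
  rewrite ler_wpM2l ?sqrtr_ge0//; apply: le_trans (tele n) _.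
  by rewrite ler_wpM2l// gerBl sqrtr_ge0.
by rewrite mulrCA -expr2 sqr_sqrtr// ler_wpM2l.
Qed.

(** The coefficients from [adjoint_dominated_hull] are merely bounded. Writing [lam_i z_i] as
    [lam_i w_i] times [z_i / w_i] moves part of the size of [z_i] into the coefficients, which then
    lie in the required ball. The factor 2 comes from the c_0 case [p = 1]. *)
Lemma dominated1_SK (T : bounded_operator X X) (A : dual X -> dual X)
  (p c : R) :
  1 <= p -> 0 < c -> (forall f x, A f x = f (T x)) ->
  dominated dual_eval 1 (fun f => rnorm (A f)) c ->
  SK p X X T /\ (SK_norm p T <= (2 * c)%:E)%E.
Proof.
move=> p1 c0 AE [z zc zA]; have p0 : 0 < p by lra.
have c20 : 0 <= 2 * c by rewrite mulr_ge0// ltW.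
suff [y [yc yT]] : exists y : nat -> X, (strong_norm p y <= (2 * c)%:E)%E /\
    forall x, rnorm x <= 1 -> p_convex_hull p y (T x).
  have maj : SK_majorant p T y.
    by split; [exact: le_lt_trans yc (ltry _)|move=> _ [x x1 <-]; exact: yT].
  split; first by exists y.
  by apply: le_trans yc; apply: ereal_inf_lbound; exists y.
rewrite expr1 in zc.
have zfin (f : dual X) : power_sum 1 (fun i => dual_eval (z i) f) \is a fin_num.
  apply: (power_sum_fin_num pairing_dual_eval); exact: le_lt_trans zc (ltry _).
have hull := adjoint_dominated_hull zc (S := T) _.
have {}hull : forall x, rnorm x <= 1 -> exists lam : nat ->
  K, (forall i, modulus (lam i) <= 1) /\
    (series (fun i => lam i *: z i) @ \oo --> T x).
  apply: hull => f x; rewrite -AE; apply: le_trans (dual_le _ _) _.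
  rewrite mulrC ler_wpM2l ?rnorm_ge0// -lee_fin fineK//.
  by have := zA f; rewrite expr1.
pose t i := rnorm (z i); have t0 i : 0 <= t i by exact: rnorm_ge0.
have tc : (nsum t <= c%:E)%E.
  by rewrite (eq_nsum (v := fun i => rnorm (z i) ^+ 1)) // => i; rewrite expr1.
have [p_1|pn1] := eqVneq p 1.
  have [th [th01 tht thc thsum]] := summable_c0_factor t0 tc.
  exists (fun i => of_real k (th i)^-1 *: z i); split.
    rewrite strong_norm_le// p_1 powRr1//; apply: le_trans thsum.
    rewrite le_eqVlt; apply/orP; left; apply/eqP/eq_nsum => i.
    rewrite powRr1; last exact: rnorm_ge0.
    have /andP[th0 _] := th01 i.
    rewrite rnormZ_modulus modulus_of_real ger0_norm; first by rewrite mulrC.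
    by rewrite invr_ge0.
  move=> x x1; have [lam [lam1 lamT]] := hull x x1.
  exists (fun i => lam i * of_real k (th i)).
    rewrite /conjugate_ball p_1 eqxx; split=> [|i].
      apply: cvg_rnorm => eps eps0; have [N Nth] := thc _ eps0;
        exists N => n Nn.
      rewrite sub0r rnormN -[rnorm _]/(modulus (lam n * of_real k (th n)))
        modulusM modulus_of_real.
      have /andP[th0 _] := th01 n.
      by rewrite ger0_norm//; apply: le_trans (Nth n Nn); rewrite ler_piMl.
    rewrite -[rnorm _]/(modulus (lam i * of_real k (th i))) modulusM
      modulus_of_real.
    have /andP[th0 th1] := th01 i.
    by rewrite ger0_norm// mulr_ile1 ?modulus_ge0.
  rewrite (_ : (fun i => _) = (fun i => lam i *: z i)) //.
  apply/funext => i; rewrite scalerA -mulrA -of_realM.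
  have [/tht ti|thi] := eqVneq (th i) 0.
    by rewrite (rnorm0_eq0 ti) !scaler0.
  by rewrite mulfV// of_real1 mulr1.
have p1' : 1 < p by rewrite lt_neqAle eq_sym pn1.
pose q := (1 - p^-1)^-1.
have qV0 : 0 < 1 - p^-1 by rewrite subr_gt0 invf_lt1.
have q0 : 0 < q by rewrite invr_gt0.
(* Then [w_i^q = t_i / c] sums to at most 1, while [(t_i / w_i)^p = c^(p-1) t_i] sums to at most
   [c^p]. *)
pose w i := (t i / c) `^ (1 - p^-1).
have w0 i : 0 <= w i by exact: powR_ge0.
have tic0 i : 0 <= t i / c by rewrite divr_ge0// ltW.
exists (fun i => of_real k (w i)^-1 *: z i); split.
  rewrite strong_norm_le//; apply: (@le_trans _ _ (c `^ p)%:E); last first.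
    by rewrite lee_fin ge0_ler_powR ?(ltW p0)// ?nnegrE ?(ltW c0)//; lra.
  apply: (@le_trans _ _ (nsum (fun i => c `^ (p - 1) * t i))).
    apply: le_nsum => i;
      rewrite powR_ge0/= rnormZ_modulus modulus_of_real ger0_norm ?invr_ge0//.
    rewrite -/(t i); have [->|ti0] := eqVneq (t i) 0.
      by rewrite mulr0 powR0 ?gt_eqF// mulr0.
    have ti_gt0 : 0 < t i by rewrite lt_neqAle eq_sym ti0; exact: t0.
    have wp : w i `^ p = (t i / c) `^ (p - 1).
      by rewrite /w -powRrM mulrBl mul1r mulVf// gt_eqF.
    have -> : (w i)^-1 * t i = t i / w i by rewrite mulrC.
    have wi_gt0 : 0 < w i by rewrite powR_gt0// divr_gt0.
    rewrite powR_div// wp ler_pdivrMr ?powR_gt0 ?divr_gt0// mulrAC -powRM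
      ?(ltW c0)//.
    have -> : c * (t i / c) = t i by rewrite mulrCA mulfV ?mulr1// gt_eqF.
    by rewrite mulrC mulr_powRB1.
  rewrite nsumZ//; apply: (@le_trans _ _ ((c `^ (p - 1))%:E * c%:E)%E).
    by rewrite lee_wpmul2l ?lee_fin ?powR_ge0.
  by rewrite -EFinM mulrC mulr_powRB1// ltW.
move=> x x1; have [lam [lam1 lamT]] := hull x x1.
exists (fun i => lam i * of_real k (w i)).
  rewrite /conjugate_ball (negbTE pn1) /= -/q strong_norm_le// powR1.
  apply: (@le_trans _ _ (nsum (fun i => c^-1 * t i))).
    apply: le_nsum => i; rewrite powR_ge0/=.
    rewrite -[rnorm _]/(modulus (lam i * of_real k (w i))) modulusM
      modulus_of_real ger0_norm//.
    apply: (@le_trans _ _ (w i `^ q)).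
      by rewrite ge0_ler_powR ?(ltW q0)// ?nnegrE ?mulr_ge0 ?modulus_ge0//
        ler_piMl.
    by rewrite /w -powRrM /q mulfV ?gt_eqF// powRr1// mulrC.
  rewrite nsumZ//; apply: (@le_trans _ _ (c^-1%:E * c%:E)%E).
    by rewrite lee_wpmul2l ?lee_fin ?invr_ge0 ?(ltW c0).
  by rewrite -EFinM mulVf// gt_eqF.
rewrite (_ : (fun i => _) = (fun i => lam i *: z i)) //.
apply/funext => i; rewrite scalerA -mulrA -of_realM.
have [wi|wi] := eqVneq (w i) 0.
  suff ti : t i = 0 by rewrite (rnorm0_eq0 ti) !scaler0.
  move/eqP: wi; rewrite powR_eq0 => /andP[/eqP/eqP];
    rewrite mulf_eq0 invr_eq0 (gt_eqF c0) orbF.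
  by move/eqP.
by rewrite mulfV// of_real1 mulr1.
Qed.

(** If [F f] is the sum of the [f(a_i) z_i], exchanging the roles of vectors and functionals gives
    [S x] as the sum of the [z_i(x) a_i]. *)
Lemma finite_form_adjoint (F : dual X -> dual X) : finite_form dual_eval F ->
  exists2 S : bounded_operator X X, finite_rank X X S & forall f x, F f x =
    f (S x).
Proof.
move=> [n [a [z FE]]].
pose G x := \sum_i z i x *: a i.
have lG : linear G.
  move=> b x y; rewrite /G scaler_sumr -big_split; apply: eq_bigr => i _.
  have -> : z i (b *: x + y) = b * z i x + z i y by rewrite linearP.
  by rewrite /= scalerDl scalerA.
have Gc x : rnorm (G x) <= (\sum_i rnorm (z i) * rnorm (a i)) * rnorm x.
  rewrite mulr_suml; apply: le_trans (rnorm_sum _ _ _) _; apply: ler_sum => i _.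
  by rewrite rnormZ_modulus mulrAC ler_wpM2r ?rnorm_ge0// dual_le.
have [S SG _] := operator_of_bounded lG Gc.
exists S => [|f x]; first by exists n, a => x; exists (fun i => z i x);
  rewrite SG.
rewrite SG FE dual_sum_apply linear_sum; apply: eq_bigr => i _.
by rewrite dualZ_apply linearZ mulrC.
Qed.

Lemma cotype2_SK (p : R) : cotype2 (dual X) -> 1 <= p ->
  ideal_quotient (SK p X X) (SK_norm p) =
  [set coset (finite_rank_closure (SK p X X) (SK_norm p)) 0].
Proof.
move=> cotX p1; have [C [C0 liftV]] := cotype2_lifting_predual cotX.
have DSK T : SK p X X T -> exists (c : R) (A : dual X -> dual X), [/\ 0 < c,
    forall f x, A f x = f (T x) & dominated dual_eval 1
      (fun f => rnorm (A f)) c].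
  move=> SKT; have [A lA AE] := exists_adjoint T.
  have [s [v [s0 vs vT]]] := SK_adjoint_dominated p1 AE SKT.
  have [c c0 Dc] :=
    cotype2_dominated1 pairing_dual_eval C0 liftV cotX lA p1 s0 vs vT.
  by exists c, A.
apply: trivial_quotient =>
  [|S T /DSK[c [A [c0 AE DS]]] /DSK[d [A' [d0 AE' DT]]]|T e KT e0].
- apply: (@dominated1_SK 0 (fun=> 0) p 1 p1 ltr01 _ _).1 => [f x|].
    by rewrite -[(0 : bounded_operator X X) x]/(0 : X) linear0.
  exists (fun=> 0) => [|f].
    by rewrite /power_sum nsum0// => i; rewrite rnorm0 expr1.
  by rewrite rnorm0 expr1 power_sum_ge0.
- apply: (@dominated1_SK (S - T) (fun f => A f - A' f) p (c + d) p1
    (addr_gt0 c0 d0) _ _).1.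
    move=> f x; rewrite -[(S - T) x]/(S x - T x)
      -[(A f - A' f) x]/(A f x - A' f x).
    by rewrite AE AE' linearB.
  have D := dominated1D pairing_dual_eval (fun f => rnorm_ge0 (A f))
    (fun f => rnorm_ge0 (A' f)) DS DT.
  apply: le_dominated D; first by rewrite lexx andbT addr_ge0// ltW.
  by move=> x; rewrite rnorm_ge0 rnormB.
have [A lA AE] := exists_adjoint T.
have [s [v [s0 vs vT]]] := SK_adjoint_dominated p1 AE KT.
(* [dominated1_SK] doubles the constant, and the final inequality is strict. *)
have e40 : 0 < e / 4 by rewrite divr_gt0.
have [F FF DF] :=
  cotype2_approx pairing_dual_eval C0 liftV cotX lA p1 s0 vs vT e40.
have [S frS FS] := finite_form_adjoint FF.
exists S => //.
have := (@dominated1_SK (T - S) (fun f => A f - F f) p (e / 4) p1 e40 _ DF).2.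
move=> /(_ _)/wrap[f x|].
  rewrite -[(T - S) x]/(T x - S x) -[(A f - F f) x]/(A f x - F f x).
  by rewrite AE FS linearB.
by move=> /le_lt_trans; apply; rewrite lte_fin; lra.
Qed.

End sinha_karn.

Theorem theorem3p12 (R : realType) (k : scalar_kind)
    (X : completeNormedModType (scalars R k)) :
  (cotype2 X ->
     forall p : R, 1 <= p ->
       ideal_quotient (QN p X X) (QN_norm p) =
       [set coset (finite_rank_closure (QN p X X) (QN_norm p)) 0]) /\
  (cotype2 (dual X) ->
     forall p : R, 1 <= p ->
       ideal_quotient (SK p X X) (SK_norm p) =
       [set coset (finite_rank_closure (SK p X X) (SK_norm p)) 0]).
Proof. by split=> cotX p p1; [exact: cotype2_QN|exact: cotype2_SK]. Qed.
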